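(* Let $l$ be a positive integer for which $D_l$ is simple. The $\mathcal W$-algebra $\mathcal{WD}_l$ with central charge $l$ is isomorphic to the sum of the vertex algebra $V_l$ and the irreducible $V_l$-module $L(\hat{\mathcal D}^+;e(\det),l)$: it contains $V_l$ as a vertex subalgebra and, as a $V_l$-module, $\mathcal{WD}_l\cong V_l\oplus L(\hat{\mathcal D}^+;e(\det),l)$. Here $e(\det)$ consists of the single exponent $1$ with multiplicity $2l$.
   Context: **$\hat{\mathcal D}^+$ and modules.** $\hat{\mathcal D}=\mathcal D\oplus\mathbb CC$, $\mathcal D$ spanned by $t^kf(D)$ ($k\in\mathbb Z$, $f\in\mathbb C[w]$, $D=t\partial_t$), $C$ central, $[t^rf(D),t^sg(D)]=t^{r+s}(f(D+s)g(D)-f(D)g(D+r))+\Psi\,C$, $\Psi$ antisymmetric, $\Psi=\sum_{-r\le j\le-1}f(j)g(j+r)$ if $r=-s\ge0$, $\Psi=0$ if $r+s\ne0$; $\deg t^kf(D)=k$. $\hat{\mathcal D}^+$ is the subalgebra spanned by $C$ and $t^kg(D+(k+1)/2)$, $g$ an odd polynomial. For a finite set $e$ of nonzero exponents $e_i$ with multiplicities $n_i$, $L(\hat{\mathcal D}^+;e,c)$ is the irreducible highest weight module (highest weight vector killed by positive degree) with highest weight $\xi$, $\xi(C)=c$, $-\sum_{n\text{ odd}}\xi((D+\frac12)^n)\frac{x^n}{n!}=\frac{\sum_in_i(\cosh(e_ix)-1)}{2\sinh(x/2)}$. **Vertex algebra $V_l$.** Let $W^n_k=-\frac12(t^{k+n}\partial_t^n+(-1)^{n+1}\partial_t^nt^{k+n})$,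 $n$ odd, $k\in\mathbb Z$, $W^n(z)=\sum_kW^n_kz^{-k-n-1}$. $V_c=L(\hat{\mathcal D}^+;\varnothing,c)$ is the irreducible quotient of the vacuum module induced from the one-dimensional module over $\mathrm{span}\{W^n_k:n+k\ge0,\ n\text{ odd}\}\oplus\mathbb CC$ on which the $W^n_k$ act by $0$ and $C$ by $c$. It is a vertex algebra with vacuum $|0\rangle$, translation operator $W^1_{-1}$, generated by the fields $Y(W^n_{-n-1}|0\rangle,z)=W^n(z)$. A $V_l$-module structure on a $\hat{\mathcal D}^+$-module of central charge $l$ is the one in which $W^n_{-n-1}|0\rangle$ acts by the field $W^n(z)$. **$\mathcal{WD}_l$.** $\mathcal{WD}_l$ with central charge $l$ is the $\mathcal W$-algebra of the simple Lie algebra $D_l=\mathfrak{so}(2l)$ at central charge $l$; it is known to be the vertex algebra $\mathcal W(\widehat{\mathfrak{so}}(2l)/\mathfrak{so}(2l),1)$ of $\mathfrak{so}(2l)$-invariants in the basic representation (irreducible vacuum module of level $1$) of $\widehat{\mathfrak{so}}(2l)$, where $\mathfrak{so}(2l)$ is the horizontal subalgebra. *)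

(* Defs.v *)
From HB Require Import structures.
From mathcomp Require Import all_boot all_order all_algebra.
From mathcomp Require Import boolp classical_sets reals.
From mathcomp Require Import complex.

Set Implicit Arguments.
Unset Strict Implicit.
Unset Printing Implicit Defensive.

Import Order.TTheory GRing.Theory Num.Theory.
Local Open Scope ring_scope.

(** * Subspaces and irreducibility *)

Section Irreducibility.
Variables (K : numFieldType) (M : lmodType K).

Definition is_subspace (P : set M) : Prop :=
  P 0 /\ forall (a : K) (x y : M), P x -> P y -> P (a *: x + y).

(* [ops] is the set of operators through which an algebra acts on [M]. *)
Definition irreducible_under (ops : set (M -> M)) : Prop :=
  (exists x : M, x <> 0) /\
  forall P : set M, is_subspace P ->
    (forall (g : M -> M) (x : M), ops g -> P x -> P (g x)) ->
    (forall x : M, P x -> x = 0) \/ (forall x : M, P x).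

End Irreducibility.

(** * Vertex algebras and their modules *)

Section VertexAlgebras.
Variable K : numFieldType.

(* m (m - 1) ... (m - j + 1) / j! *)
Definition binz (m : int) (j : nat) : K :=
  (\prod_(i < j) (m%:~R - i%:R)) / j`!%:R.

(* The states of [V] act on [M] by the fields
     YM(a, z) = \sum_n YM a n z^(-n-1);
   [Y] is the n-th product of [V], and the products of [V] and the action on
   [M] are related by the Borcherds identity (which contains locality). Both
   sums over j >= 0 in that identity have finitely many nonzero terms, so that
   it is stated for all sufficiently long partial sums. *)
Definition va_action (V M : lmodType K) (vac : V) (Y : V -> int -> V -> V)
    (YM : V -> int -> M -> M) : Prop :=
  [/\ forall (n : int) (u : M), linear (fun a : V => YM a n u),
      forall (a : V) (n : int), linear (YM a n),
      forall (a : V) (u : M), exists N : int,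
        forall n : int, N <= n -> YM a n u = 0,
      forall (n : int) (u : M), YM vac n u = if n == -1 then u else 0
    & forall (a b : V) (u : M) (m n k : int), exists N0 : nat,
        forall N : nat, (N0 <= N)%N ->
          \sum_(j < N) binz m j *: YM (Y a (n + j%:Z) b) (m + k - j%:Z) u =
          \sum_(j < N) ((-1) ^+ j * binz n j) *:
            (YM a (m + n - j%:Z) (YM b (k + j%:Z) u)
             - (-1) ^ n *: YM b (n + k - j%:Z) (YM a (m + j%:Z) u))].

Record vertexAlgebra := VertexAlgebra {
  va_sort :> lmodType K;
  va_vac : va_sort;
  va_T : va_sort -> va_sort;
  va_Y : va_sort -> int -> va_sort -> va_sort;
  va_actionP : va_action va_vac va_Y va_Y;
  va_creation : forall a : va_sort,
    va_Y a (-1) va_vac = a /\ forall n : int, 0 <= n -> va_Y a n va_vac = 0;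
  va_T_linear : linear va_T;
  va_T_vac : va_T va_vac = 0;
  va_T_covariant : forall (a b : va_sort) (n : int),
    va_T (va_Y a n b) - va_Y a n (va_T b) = - (n%:~R *: va_Y a (n - 1) b)
}.

Record va_module (V : vertexAlgebra) (M : lmodType K) := VaModule {
  vm_Y :> V -> int -> M -> M;
  vm_actionP : va_action (va_vac V) (@va_Y V) vm_Y
}.

Definition va_module_irreducible (V : vertexAlgebra) (M : lmodType K)
    (YM : va_module V M) : Prop :=
  irreducible_under
    [set g : M -> M | exists (a : V) (n : int), g = YM a n]%classic.

Definition va_hom (V W : vertexAlgebra) (phi : V -> W) : Prop :=
  [/\ linear phi, phi (va_vac V) = va_vac W
    & forall (a b : V) (n : int), phi (va_Y a n b) = va_Y (phi a) n (phi b)].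

End VertexAlgebras.

(** * The Lie algebras [\hat D] and [\hat D^+] *)

Section DPlus.
Variable K : numFieldType.

(* The homogeneous element t^k f(D) is represented by the pair (k, f). *)

(* [t^r f(D), t^s g(D)] = t^(r+s) (dbracket r s f g)(D) + dcocycle r s f g C *)
Definition dbracket (r s : int) (f g : {poly K}) : {poly K} :=
  (f \Po ('X + (s%:~R)%:P)) * g - f * (g \Po ('X + (r%:~R)%:P)).

(* \sum_(-r <= j <= -1) f(j) g(j + r), reindexed by j = - i.+1 *)
Definition dcocycle_pos (r : nat) (f g : {poly K}) : K :=
  \sum_(i < r) f.[- i.+1%:R] * g.[r%:R - i.+1%:R].

Definition dcocycle (r s : int) (f g : {poly K}) : K :=
  if r + s != 0 then 0
  else match r with
       | Posz n => dcocycle_pos n f g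
       | Negz n => - dcocycle_pos n.+1 g f
       end.

(* t^k f(D) belongs to \hat D^+. *)
Definition dplus (k : int) (f : {poly K}) : Prop :=
  exists g : {poly K}, g \Po (- 'X) = - g /\
    f = g \Po ('X + ((k + 1)%:~R / 2)%:P).

(* [\hat D^+] is the direct sum of the line spanned by [C] and of its
   homogeneous components, so that a representation is given by the action of
   [C] and of the elements t^k f(D) with [dplus k f]. The value of [dact k f]
   when [dplus k f] fails is irrelevant. *)
Record dplus_rep (M : lmodType K) := DplusRep {
  dact :> int -> {poly K} -> M -> M;
  dactC : M -> M;
  dact_linear : forall (k : int) (f : {poly K}), dplus k f -> linear (dact k f);
  dactC_linear : linear dactC;
  dact_linear_l : forall (k : int) (a : K) (f g : {poly K}) (u : M),
    dplus k f -> dplus k g ->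
    dact k (a *: f + g) u = a *: dact k f u + dact k g u;
  dact_bracket : forall (r s : int) (f g : {poly K}) (u : M),
    dplus r f -> dplus s g ->
    dact r f (dact s g u) - dact s g (dact r f u) =
    dact (r + s) (dbracket r s f g) u + dcocycle r s f g *: dactC u;
  dactC_central : forall (k : int) (f : {poly K}) (u : M),
    dplus k f -> dactC (dact k f u) = dact k f (dactC u)
}.

Definition dplus_irreducible (M : lmodType K) (rho : dplus_rep M) : Prop :=
  irreducible_under
    [set g : M -> M | (exists (k : int) (f : {poly K}),
                         dplus k f /\ g = rho k f) \/ g = dactC rho]%classic.

(* Formal power series, given by their coefficients. *)
Definition cosh_series (a : K) (n : nat) : K :=
  if odd n then 0 else a ^+ n / n`!%:R.
Definition sinh_series (a : K) (n : nat) : K :=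
  if odd n then a ^+ n / n`!%:R else 0.
Definition series_mul (u v : nat -> K) (n : nat) : K :=
  \sum_(i < n.+1) u i * v (n - i)%N.

(* [xi n] is the value of the highest weight on (D + 1/2)^n, n odd; [e] lists
   the pairs (e_i, n_i). The denominator 2 sinh(x/2) is cleared. *)
Definition weight_of_exponents (e : seq (K * K)) (xi : nat -> K) : Prop :=
  forall N : nat,
    series_mul (fun n => if odd n then - (xi n / n`!%:R) else 0)
               (fun n => 2 * sinh_series (1 / 2) n) N =
    \sum_(p <- e) p.2 * (cosh_series p.1 N - (N == 0%N)%:R).

(* M is the module L(\hat D^+; e, c) *)
Definition is_L (e : seq (K * K)) (c : K) (M : lmodType K)
    (rho : dplus_rep M) : Prop :=
  dplus_irreducible rho /\
  exists (v : M) (xi : nat -> K),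
    [/\ v <> 0,
        forall (k : int) (f : {poly K}), 0 < k -> dplus k f -> rho k f v = 0,
        forall n : nat, odd n -> rho 0 (('X + (1 / 2)%:P) ^+ n) v = xi n *: v,
        dactC rho v = c *: v
      & weight_of_exponents e xi].

(* The polynomial f with W^n_k = t^k f(D), obtained from
     t^(k+n) d^n = t^k D (D - 1) ... (D - n + 1),
     d^n t^(k+n) = t^k (D + k + 1) ... (D + k + n). *)
Definition Wpoly (n : nat) (k : int) : {poly K} :=
  - (1 / 2) *: (\prod_(i < n) ('X - (i%:R)%:P)
     + (-1) ^+ n.+1 *: \prod_(i < n) ('X + ((k + i.+1%:Z)%:~R)%:P)).

Definition Wact (M : lmodType K) (rho : dplus_rep M) (n : nat) (k : int) :
    M -> M :=
  rho k (Wpoly n k).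

(* V, with the action rho of \hat D^+, is the vertex algebra V_c. A module is
   an irreducible quotient of the induced vacuum module exactly when it is
   irreducible and has a nonzero vector on which the inducing subalgebra acts
   by the prescribed character. *)
Definition is_Vc (c : K) (V : vertexAlgebra K) (rho : dplus_rep V) : Prop :=
  [/\ dplus_irreducible rho,
      [/\ va_vac V <> 0,
          forall (n : nat) (k : int), odd n -> 0 <= n%:Z + k ->
            Wact rho n k (va_vac V) = 0
        & dactC rho (va_vac V) = c *: va_vac V],
      va_T (v:=V) =1 Wact rho 1 (-1)
    & forall (n : nat) (k : int), odd n ->
        va_Y (Wact rho n (- n.+1%:Z) (va_vac V)) (k + n%:Z) =1 Wact rho n k].

(* W^n_{-n-1}|0> acts on M by W^n(z), whose coefficient of z^(-(k+n)-1) is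
   W^n_k. *)
Definition compatible_module (V : vertexAlgebra K) (rhoV : dplus_rep V)
    (M : lmodType K) (rhoM : dplus_rep M) (YM : va_module V M) : Prop :=
  forall (n : nat) (k : int), odd n ->
    YM (Wact rhoV n (- n.+1%:Z) (va_vac V)) (k + n%:Z) =1 Wact rhoM n k.

End DPlus.

(** * so(n), its affinization, and the invariants of the basic module *)

Section AffineSo.
Variables (K : numFieldType) (n : nat).

Definition so_mx (x : 'M[K]_n) : Prop := x^T = - x.

Definition lie_mx (x y : 'M[K]_n) : 'M[K]_n := x *m y - y *m x.

Definition so_simple : Prop :=
  (exists x y : 'M[K]_n, [/\ so_mx x, so_mx y & lie_mx x y <> 0]) /\
  forall I : set 'M[K]_n, is_subspace I ->
    (forall x, I x -> so_mx x) ->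
    (forall x y, so_mx x -> I y -> I (lie_mx x y)) ->
    (forall x, I x -> x = 0) \/ (forall x, so_mx x -> I x).

(* The invariant form for which the long roots have square length 2. *)
Definition so_form (x y : 'M[K]_n) : K := \tr (x *m y) / 2.

(* [sact x m] is the action of x t^m, for x in so(n), and [sactK] that of the
   central element. *)
Record so_affine_rep (M : lmodType K) := SoAffineRep {
  sact :> 'M[K]_n -> int -> M -> M;
  sactK : M -> M;
  sact_linear : forall (x : 'M[K]_n) (m : int), so_mx x -> linear (sact x m);
  sactK_linear : linear sactK;
  sact_linear_l : forall (m : int) (a : K) (x y : 'M[K]_n) (u : M),
    so_mx x -> so_mx y ->
    sact (a *: x + y) m u = a *: sact x m u + sact y m u;
  sact_bracket : forall (x y : 'M[K]_n) (p q : int) (u : M),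
    so_mx x -> so_mx y ->
    sact x p (sact y q u) - sact y q (sact x p u) =
    sact (lie_mx x y) (p + q) u
    + (if p + q == 0 then p%:~R * so_form x y else 0) *: sactK u;
  sactK_central : forall (x : 'M[K]_n) (m : int) (u : M),
    so_mx x -> sactK (sact x m u) = sact x m (sactK u)
}.

Definition so_affine_irreducible (M : lmodType K) (rho : so_affine_rep M) :
    Prop :=
  irreducible_under
    [set g : M -> M | (exists (x : 'M[K]_n) (m : int),
                         so_mx x /\ g = rho x m) \/ g = sactK rho]%classic.

(* B is the irreducible vacuum module of level 1, with its structure of vertex
   algebra, in which (x t^-1)|0> has the field x(z) = \sum_m (x t^m) z^(-m-1). *)
Definition is_basic_va (B : vertexAlgebra K) (rho : so_affine_rep B) : Prop :=
  [/\ so_affine_irreducible rho,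
      [/\ va_vac B <> 0,
          forall (x : 'M[K]_n) (m : int), so_mx x -> 0 <= m ->
            rho x m (va_vac B) = 0
        & sactK rho (va_vac B) = va_vac B]
    & forall (x : 'M[K]_n) (m : int), so_mx x ->
        va_Y (rho x (-1) (va_vac B)) m =1 rho x m].

Definition so_invariant (M : lmodType K) (rho : so_affine_rep M) (u : M) :
    Prop :=
  forall x : 'M[K]_n, so_mx x -> rho x 0 u = 0.

(* W is the vertex algebra W(\hat so(n)/so(n), 1). *)
Definition is_so_invariants_va (W : vertexAlgebra K) : Prop :=
  exists (B : vertexAlgebra K) (rho : so_affine_rep B) (iota : W -> B),
    [/\ is_basic_va rho, va_hom iota, injective iota
      & forall u : B, so_invariant rho u <-> exists w : W, u = iota w].

End AffineSo.

(* The W-algebra of D_l = so(2l) at central charge l, in its realization as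
   W(\hat so(2l)/so(2l), 1). *)
Definition is_WD (K : numFieldType) (l : nat) (W : vertexAlgebra K) : Prop :=
  is_so_invariants_va l.*2 W.

Definition e_det (K : numFieldType) (l : nat) : seq (K * K) :=
  [:: (1, (2 * l)%:R)].

(* Main.v *)
(* Let psi^i, i < 2l, be free fermions. The basic module of so(2l)^ is the even
   part of their Fock space: the currents psi^i psi^j generate it from the
   vacuum and act irreducibly on it, because the quartic part of the normally
   ordered product of the currents ij and jk vanishes, which yields all the
   operators psi^i_a psi^k_b. The algebra \hat D^+ acts by the O(2l)-invariant
   quadratic operators \sum_i psi^i_a psi^i_b.

   The so(2l)-invariants of the even part split according to the parity of the
   number of fermions of a fixed index, that is, under O(2l)/SO(2l). Modulo the
   raising operators the Casimir operator of so(2l) is a function of the numbers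
   of fermions of each mode; as it kills the invariants, the only singular
   vectors are the vacuum and the product of all psi^i_{-1}, whose weights are
   those of V_l and of L(\hat D^+; e(det), l). Both halves are therefore
   irreducible, and an irreducible highest weight module is determined by its
   weight. Goddard's uniqueness argument identifies the fields W^n(z) with vertex
   operators of the basic vertex algebra, and the vertex algebra structure is
   transported along these isomorphisms. *)
Require Import Defs.
From HB Require Import structures.
From mathcomp Require Import all_boot all_order all_algebra finmap.
From mathcomp Require Import boolp classical_sets functions reals.
From mathcomp Require Import complex.
From mathcomp Require Import zify ring.
Set Implicit Arguments.
Unset Strict Implicit.
Unset Printing Implicit Defensive.
Import Order.TTheory GRing.Theory Num.Theory.
Local Open Scope ring_scope.

(** Three obstacles shape the argument. First, the operators are infinite sums of fermion bilinears.
    They are controlled by their commutators with the fermions, which fix an operator up to a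
    scalar: every bracket reduces to a matrix identity and one vacuum coefficient, and these
    coefficients give the level 1 and the central charge 2l/2 = l. Second, no Verma module is built:
    two irreducible modules of equal highest weight are compared inside their product, through the
    submodule generated by the pair of highest weight vectors. This needs an operator grading both
    sides; for the abstract basic vertex algebra it comes from the Sugawara vector. Third, with n =
    2l and N_a the number of fermions in mode a, the Casimir function is the sum of N_a (N_a - n -
    2a). As N_a <= n, no term is positive, and the sum is zero only if mode 0 is empty or full and
    all other modes are empty; whence the two singular vectors. The same congruence modulo a
    submodule shows that the highest weight vector generates. Simplicity of D_l enters as l > 1: the
    product of the currents ij and jk needs three distinct indices. *)

Section LinearMaps.
Variables (K : numFieldType) (U V : lmodType K) (f : U -> V).
Hypothesis f_lin : linear f.

Lemma linD u v : f (u + v) = f u + f v.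
Proof. by have := f_lin 1 u v; rewrite !scale1r. Qed.

Lemma lin0 : f 0 = 0.
Proof. by apply: (addrI (f 0)); rewrite -linD !addr0. Qed.

Lemma linZ a u : f (a *: u) = a *: f u.
Proof. by have := f_lin a u 0; rewrite !addr0 lin0 addr0. Qed.

Lemma linN u : f (- u) = - f u.
Proof. by rewrite -scaleN1r linZ scaleN1r. Qed.

Lemma linB u v : f (u - v) = f u - f v.
Proof. by rewrite linD linN. Qed.

Lemma lin_sum (I : Type) (r : seq I) (P : pred I) (F : I -> U) :
  f (\sum_(i <- r | P i) F i) = \sum_(i <- r | P i) f (F i).
Proof.
by elim/big_rec2: _ => [|i y1 y2 _ <-]; rewrite ?lin0 ?linD.
Qed.

End LinearMaps.

Section LinearCombinators.
Variable K : numFieldType.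

Lemma lin_id (U : lmodType K) : linear (fun u : U => u).
Proof. by []. Qed.

Lemma lin_comp (U V W : lmodType K) (f : V -> W) (g : U -> V) :
  linear f -> linear g -> linear (fun u => f (g u)).
Proof. by move=> fl gl a u v; rewrite gl fl. Qed.

Lemma lin_add (U V : lmodType K) (f g : U -> V) :
  linear f -> linear g -> linear (fun u => f u + g u).
Proof. by move=> fl gl a u v; rewrite gl fl scalerDr addrACA. Qed.

Lemma lin_scale (U V : lmodType K) (c : K) (f : U -> V) :
  linear f -> linear (fun u => c *: f u).
Proof. by move=> fl a u v; rewrite fl scalerDr !scalerA mulrC. Qed.

Lemma lin_opp (U V : lmodType K) (f : U -> V) :
  linear f -> linear (fun u => - f u).
Proof. by move=> fl a u v; rewrite fl opprD scalerN. Qed.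

Lemma lin_sub (U V : lmodType K) (f g : U -> V) :
  linear f -> linear g -> linear (fun u => f u - g u).
Proof. by move=> fl gl; apply: lin_add => //; apply: lin_opp. Qed.

Lemma lin_zero (U V : lmodType K) : linear (fun _ : U => 0 : V).
Proof. by move=> a u v; rewrite scaler0 addr0. Qed.

Lemma lin_bigsum (U V : lmodType K) (I : Type) (r : seq I)
    (F : I -> U -> V) :
  (forall i, linear (F i)) -> linear (fun u => \sum_(i <- r) F i u).
Proof.
move=> Fl a u v; rewrite scaler_sumr -big_split /=.
by apply: eq_bigr => i _; rewrite Fl.
Qed.

End LinearCombinators.

Section Subspaces.
Variables (K : numFieldType) (M : lmodType K) (P : set M).
Hypothesis Psub : is_subspace P.

Lemma sub0 : P 0. Proof. by case: Psub. Qed.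

Lemma subD x y : P x -> P y -> P (x + y).
Proof. by move=> Px Py; have := Psub.2 1 _ _ Px Py; rewrite scale1r. Qed.

Lemma subZ a x : P x -> P (a *: x).
Proof. by move=> Px; have := Psub.2 a _ _ Px sub0; rewrite addr0. Qed.

Lemma subN x : P x -> P (- x).
Proof. by move=> Px; rewrite -scaleN1r; apply: subZ. Qed.

Lemma subB x y : P x -> P y -> P (x - y).
Proof. by move=> Px Py; apply: subD => //; apply: subN. Qed.

Lemma sub_sum (I : Type) (r : seq I) (Q : pred I) (F : I -> M) :
  (forall i, Q i -> P (F i)) -> P (\sum_(i <- r | Q i) F i).
Proof. by move=> PF; elim/big_ind: _ => //; [exact: sub0|exact: subD]. Qed.

Lemma subZ_inv a x : a != 0 -> P (a *: x) -> P x.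
Proof. by move=> a0 /(subZ a^-1); rewrite scalerA mulVf // scale1r. Qed.

End Subspaces.

(** * Finitely supported sums over the integers *)

Section IntSums.
Variables (K : numFieldType) (V : lmodType K).
Implicit Types (t s : int -> V) (w : int * nat).

Definition zbounded w t :=
  forall a : int, a < w.1 \/ w.1 + w.2%:Z <= a -> t a = 0.

Definition zfinite t := exists w, zbounded w t.

Definition zwindow w t := \sum_(0 <= i < w.2) t (w.1 + i%:Z).

(** Any window containing the support gives the same value ([zsumE]), so the choice made by [xget]
    is harmless. A family of infinite support gets the empty default window, hence the sum 0. *)
Definition zsum t := zwindow (xget (0, 0%N) [set w | zbounded w t]%classic) t.

Lemma zwindow_le w w' t :
  w'.1 <= w.1 -> w.1 + w.2%:Z <= w'.1 + w'.2%:Z -> zbounded w t ->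
  zwindow w' t = zwindow w t.
Proof.
case: w w' => [lo L] [lo' L'] /= h1 h2 b; rewrite /zwindow /=.
have [d lo_eq] : exists d : nat, lo = lo' + d%:Z by exists `|lo - lo'|%N; lia.
have dL : (d + L <= L')%N by lia.
rewrite (big_cat_nat (n := (d + L)%N)) //= (big_cat_nat (n := d) (p := (d + L)%N)) ?leq_addr //=.
have -> : \sum_(0 <= i < d) t (lo' + i) = 0.
  by rewrite big_nat big1 // => i hi; apply: b => /=; left; lia.
have -> : \sum_(d + L <= i < L') t (lo' + i) = 0.
  by rewrite big_nat big1 // => i hi; apply: b => /=; right; lia.
rewrite add0r addr0 -{1}[d]add0n big_addn addKn.
by apply: eq_bigr => i _; congr t; lia.
Qed.

Lemma zsumE w t : zbounded w t -> zsum t = zwindow w t.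
Proof.
move=> b; rewrite /zsum; case: xgetP => [w' _ /= bw'|/(_ w)/(_ b)//].
case: w w' b bw' => [lo L] [lo' L'] b b'.
have [M [h1 h2 h3 h4]] : exists M : nat,
    [/\ - M%:Z <= lo, - M%:Z <= lo', lo + L%:Z <= M%:Z & lo' + L'%:Z <= M%:Z].
  exists (`|lo| + `|lo'| + L + L')%N; split; lia.
rewrite -(@zwindow_le (lo', L') (- M%:Z, (M + M)%N)) -1?(@zwindow_le (lo, L) (- M%:Z, (M + M)%N)) //=.
all: lia.
Qed.

Lemma zboundedP t (lo hi : int) :
  (forall a, a < lo -> t a = 0) -> (forall a, hi <= a -> t a = 0) ->
  zbounded (lo, `|lo|%N + `|hi|%N)%N t.
Proof.
by move=> tlo thi a /= [/tlo//|ha]; apply: thi; lia.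
Qed.

Lemma zfiniteP t (lo hi : int) :
  (forall a, a < lo -> t a = 0) -> (forall a, hi <= a -> t a = 0) -> zfinite t.
Proof. by move=> tlo thi; eexists; exact: (zboundedP tlo thi). Qed.

Lemma zfiniteE t : zfinite t -> exists (lo hi : int),
  (forall a, a < lo -> t a = 0) /\ (forall a, hi <= a -> t a = 0).
Proof.
move=> [w b]; exists w.1, (w.1 + w.2%:Z).
by split=> a ha; apply: b; [left|right].
Qed.

Lemma zfinite_max t s : zfinite t -> zfinite s ->
  exists w, zbounded w t /\ zbounded w s.
Proof.
move=> /zfiniteE[lo [hi [b1 b2]]] /zfiniteE[lo' [hi' [b1' b2']]].
pose M := (`|lo| + `|hi| + `|lo'| + `|hi'|)%N.
exists (- M%:Z, (M + M)%N); split=> a /= [] ha.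
- by apply: b1; lia.
- by apply: b2; lia.
- by apply: b1'; lia.
- by apply: b2'; lia.
Qed.

Lemma eq_zsum t s : t =1 s -> zsum t = zsum s.
Proof. by move/funext ->. Qed.

Lemma eq_zfinite t s : t =1 s -> zfinite t -> zfinite s.
Proof. by move/funext ->. Qed.

Lemma zfinite0 t : (forall a, t a = 0) -> zfinite t.
Proof. by move=> t0; exists (0, 0%N). Qed.

Lemma zsum0 t : (forall a, t a = 0) -> zsum t = 0.
Proof. by move=> t0; rewrite (@zsumE (0, 0%N)) // /zwindow big_geq. Qed.

Lemma zfiniteD t s : zfinite t -> zfinite s -> zfinite (fun a => t a + s a).
Proof.
move=> /zfinite_max/[apply] -[w [bt bs]]; exists w => a ha.
by rewrite bt // bs // addr0.
Qed.

Lemma zsumD t s : zfinite t -> zfinite s ->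
  zsum (fun a => t a + s a) = zsum t + zsum s.
Proof.
move=> /zfinite_max/[apply] -[w [bt bs]]; rewrite !(@zsumE w) //.
  by rewrite /zwindow -big_split.
by move=> a ha; rewrite bt // bs // addr0.
Qed.

Lemma zfinite_sum (I : Type) (r : seq I) (T : I -> int -> V) :
  (forall i, zfinite (T i)) -> zfinite (fun a => \sum_(i <- r) T i a).
Proof.
move=> Tf; elim: r => [|i r IH].
  by apply: zfinite0 => a; rewrite big_nil.
by under [X in zfinite X]funext do rewrite big_cons; apply: zfiniteD.
Qed.

Lemma zsum_sum (I : Type) (r : seq I) (T : I -> int -> V) :
  (forall i, zfinite (T i)) ->
  zsum (fun a => \sum_(i <- r) T i a) = \sum_(i <- r) zsum (T i).
Proof.
move=> Tf; elim: r => [|i r IH].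
  by rewrite big_nil; apply: zsum0 => a; rewrite big_nil.
rewrite big_cons -IH -zsumD //; last exact: zfinite_sum.
by apply: eq_zsum => a; rewrite big_cons.
Qed.

Lemma zsum_subspace (P : set V) t :
  is_subspace P -> (forall a, P (t a)) -> P (zsum t).
Proof. by move=> Ps Pt; apply: sub_sum. Qed.

Lemma zfinite_refl t p : zfinite t -> zfinite (fun a => t (p - a)).
Proof.
move=> /zfiniteE[lo [hi [b1 b2]]].
by apply: (@zfiniteP _ (p - hi + 1) (p - lo + 1)) => a ha; [apply: b2|apply: b1]; lia.
Qed.

Lemma zsum_refl t p : zfinite t -> zsum (fun a => t (p - a)) = zsum t.
Proof.
move=> [[lo L] b]; rewrite (@zsumE (p - lo - L%:Z + 1, L)) ?(zsumE b).
  rewrite /zwindow /= big_nat_rev /= big_nat [RHS]big_nat.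
  by apply: eq_bigr => i hi /=; congr t; lia.
by move=> a /= ha; apply: b => /=; case: ha => ha; [right|left]; lia.
Qed.

Lemma zsum_single t a0 : (forall a, a != a0 -> t a = 0) -> zsum t = t a0.
Proof.
move=> t0; rewrite (@zsumE (a0, 1%N)); first by rewrite /zwindow big_nat1 addr0.
by move=> a /= ha; apply: t0; lia.
Qed.

Lemma zfinite_single t a0 : (forall a, a != a0 -> t a = 0) -> zfinite t.
Proof. by move=> t0; apply: (@zfiniteP _ a0 (a0 + 1)) => a ha; apply: t0; lia. Qed.

End IntSums.

Lemma zfinite_lin (K : numFieldType) (U V : lmodType K) (f : U -> V)
    (t : int -> U) : linear f -> zfinite t -> zfinite (fun a => f (t a)).
Proof. by move=> fl [w b]; exists w => a ha; rewrite b // lin0. Qed.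

Lemma zsum_lin (K : numFieldType) (U V : lmodType K) (f : U -> V)
    (t : int -> U) : linear f -> zfinite t -> f (zsum t) = zsum (fun a => f (t a)).
Proof.
move=> fl [w b]; rewrite (zsumE b) (@zsumE _ _ w) ?lin_sum //.
by move=> a ha; rewrite b // lin0.
Qed.

Lemma zsumB (K : numFieldType) (V : lmodType K) (t s : int -> V) :
  zfinite t -> zfinite s -> zsum (fun a => t a - s a) = zsum t - zsum s.
Proof.
move=> tf sf; rewrite zsumD //; last exact: (zfinite_lin (lin_opp (@lin_id _ _))).
by rewrite (zsum_lin (f := -%R)) //; apply: (lin_opp (@lin_id _ _)).
Qed.

(** Lagrange interpolation: a polynomial vanishing at every point of the support window other than
    [a0] isolates the term at [a0]. *)
Lemma zsum_interpolation (K : numFieldType) (V : lmodType K) (P : set V)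
    (t : int -> V) :
  is_subspace P -> zfinite t ->
  (forall f : {poly K}, P (zsum (fun a => f.[a%:~R] *: t a))) ->
  forall a, P (t a).
Proof.
move=> Ps [w b] Pt a0.
case: (boolP (w.1 <= a0 < w.1 + w.2%:Z)) => [h0|h0]; last first.
  by rewrite b; [exact: sub0|lia].
pose r := [seq w.1 + i%:Z | i <- iota 0 w.2 & w.1 + i%:Z != a0].
pose f : {poly K} := \prod_(c <- r) ('X - (c%:~R)%:P).
have fE (x : int) : f.[x%:~R] = \prod_(c <- r) (x - c)%:~R.
  rewrite horner_prod; apply: eq_bigr => c _.
  by rewrite hornerXsubC intrB.
have := Pt f; rewrite (zsum_single (a0 := a0)) => [|a aa0].
  apply: subZ_inv => //; rewrite fE prodf_seq_neq0; apply/allP => c.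
  case/mapP => i; rewrite mem_filter => /andP[ia _] ->.
  by rewrite intr_eq0 subr_eq0 eq_sym.
case: (boolP (w.1 <= a < w.1 + w.2%:Z)) => [/andP[ha1 ha2]|na]; last first.
  by rewrite b ?scaler0 //; lia.
rewrite fE (_ : \prod_(_ <- _) _ = 0) ?scale0r //.
apply/eqP; rewrite prodf_seq_eq0; apply/hasP; exists a; last by rewrite subrr eqxx.
apply/mapP; exists `|a - w.1|%N; last by lia.
by rewrite mem_filter mem_iota; lia.
Qed.

(** * Uniqueness of irreducible highest weight modules *)

Section HighestWeight.
Variables (K : numFieldType) (X1 X2 : lmodType K) (I : Type) (ok : I -> Prop).
Variables (deg : I -> int) (A1 : I -> X1 -> X1) (A2 : I -> X2 -> X2).
Variables (e1 : X1 -> X1) (e2 : X2 -> X2) (h : K) (v1 : X1) (v2 : X2).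
Variable P2 : set X2.
Hypothesis A1_lin : forall i, ok i -> linear (A1 i).
Hypothesis A2_lin : forall i, ok i -> linear (A2 i).
Hypothesis e1_lin : linear e1.
Hypothesis e2_lin : linear e2.
(** This form covers both the affine algebra and \hat D^+: the bracket is one operator plus a
    multiple of another, the central element, with the same labels and coefficient on both
    modules. *)
Hypothesis A_bracket : forall i j, ok i -> ok j ->
  exists k c k', [/\ ok k, ok k',
    forall u, A1 i (A1 j u) = A1 j (A1 i u) + (A1 k u + c *: A1 k' u)
  & forall u, A2 i (A2 j u) = A2 j (A2 i u) + (A2 k u + c *: A2 k' u)].
Hypothesis A_hw : forall i, ok i -> 0 <= deg i ->
  exists c, A1 i v1 = c *: v1 /\ A2 i v2 = c *: v2.
Hypothesis e1_deg : forall i u, ok i -> deg i < 0 ->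
  e1 (A1 i u) = A1 i (e1 u) - (deg i)%:~R *: A1 i u.
Hypothesis e2_deg : forall i u, ok i -> deg i < 0 ->
  e2 (A2 i u) = A2 i (e2 u) - (deg i)%:~R *: A2 i u.
Hypothesis e1_hw : e1 v1 = h *: v1.
Hypothesis e2_hw : e2 v2 = h *: v2.
Hypothesis v1_neq0 : v1 <> 0.
Hypothesis v2_neq0 : v2 <> 0.
Hypothesis irr1 : forall Q : set X1, is_subspace Q ->
  (forall i u, ok i -> Q u -> Q (A1 i u)) ->
  (forall u, Q u -> u = 0) \/ (forall u, Q u).
Hypothesis P2_sub : is_subspace P2.
Hypothesis P2_stable : forall i u, ok i -> P2 u -> P2 (A2 i u).
Hypothesis P2_hw : P2 v2.
Hypothesis irr2 : forall Q : set X2, is_subspace Q ->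
  (forall i u, ok i -> Q u -> Q (A2 i u)) -> (forall u, Q u -> P2 u) ->
  (forall u, Q u -> u = 0) \/ (forall u, P2 u -> Q u).

(* The submodule of [X1 * X2] generated by [(v1, v2)]; it turns out to be the
   graph of the isomorphism. *)
Inductive hw_graph : X1 -> X2 -> Prop :=
| hw_graph_hw : hw_graph v1 v2
| hw_graph_lin a x1 x2 y1 y2 : hw_graph x1 x2 -> hw_graph y1 y2 ->
    hw_graph (a *: x1 + y1) (a *: x2 + y2)
| hw_graph_op i x1 x2 : ok i -> deg i < 0 -> hw_graph x1 x2 ->
    hw_graph (A1 i x1) (A2 i x2).

Lemma hw_graph0 : hw_graph 0 0.
Proof.
have := hw_graph_lin (-1) hw_graph_hw hw_graph_hw.
by rewrite !scaleN1r !addNr.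
Qed.

Lemma hw_graphD x1 x2 y1 y2 : hw_graph x1 x2 -> hw_graph y1 y2 ->
  hw_graph (x1 + y1) (x2 + y2).
Proof. by move=> hx /(hw_graph_lin 1 hx); rewrite !scale1r. Qed.

Lemma hw_graphZ a x1 x2 : hw_graph x1 x2 -> hw_graph (a *: x1) (a *: x2).
Proof. by move=> /hw_graph_lin/(_ hw_graph0) => /(_ a); rewrite !addr0. Qed.

(** The graph is generated by lowering operators only. An arbitrary operator is commuted past them
    until it meets the highest weight pair; the induction ranges over all operators, so it also
    absorbs the bracket terms. *)
Lemma hw_graph_stable i x1 x2 : ok i -> hw_graph x1 x2 ->
  hw_graph (A1 i x1) (A2 i x2).
Proof.
move=> oki hx; elim: hx i oki => {x1 x2}
    [|a x1 x2 y1 y2 _ IHx _ IHy|j x1 x2 okj dj hx IH] i oki.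
- case: (ltP (deg i) 0) => di; first exact: hw_graph_op hw_graph_hw.
  by have [c [-> ->]] := A_hw oki di; apply: hw_graphZ hw_graph_hw.
- rewrite A1_lin // A2_lin //; apply: hw_graph_lin; [exact: IHx|exact: IHy].
have [k [c [k' [okk okk' -> ->]]]] := A_bracket oki okj.
apply: hw_graphD; first by apply: hw_graph_op => //; apply: IH.
by apply: hw_graphD; [exact: IH|apply: hw_graphZ; exact: IH].
Qed.

(** Subtracts the eigenvalue h + d + 1. Products of such operators recognise vectors built from
    eigenvalues above h without decomposing them, and no factor kills a vector of eigenvalue h,
    since d + 1 is nonzero. A lowering operator merely translates [d] ([wshift_op]). *)
Definition wshift (X : lmodType K) (e : X -> X) (d : nat) (x : X) :=
  e x - (h + d.+1%:R) *: x.

Section WeightShift.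
Variables (X : lmodType K) (e : X -> X).
Hypothesis e_lin : linear e.
Local Notation s := (wshift e).

Lemma wshift_lin d : linear (s d).
Proof. exact: lin_sub e_lin (lin_scale _ (@lin_id _ _)). Qed.

Lemma wshifts_lin ds : linear (fun x => foldr s x ds).
Proof. by elim: ds => // d ds IH a u v; rewrite /= IH wshift_lin. Qed.

Lemma wshiftC d d' x : s d (s d' x) = s d' (s d x).
Proof.
rewrite /wshift !(linB e_lin) !(linZ e_lin) !scalerBr !scalerA [(h + d'.+1%:R) * _]mulrC.
by rewrite !opprB addrACA [RHS]addrACA; congr (_ + _); exact: addrC.
Qed.

Lemma wshiftsC ds d x : foldr s (s d x) ds = s d (foldr s x ds).
Proof. by elim: ds => //= d' ds ->; exact: wshiftC. Qed.

Lemma wshifts_catl ds ds' x : foldr s x ds = 0 -> foldr s x (ds' ++ ds) = 0.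
Proof. by rewrite foldr_cat => ->; exact: lin0 (wshifts_lin ds'). Qed.

Lemma wshifts_catr ds ds' x : foldr s x ds = 0 -> foldr s x (ds ++ ds') = 0.
Proof.
rewrite foldr_cat => H; elim: ds' => //= d ds' IH.
by rewrite wshiftsC IH; exact: lin0 (wshift_lin d).
Qed.

Lemma wshifts_hw v ds : e v = h *: v -> v <> 0 -> foldr s v ds <> 0.
Proof.
move=> ev v0.
have -> : foldr s v ds = (\prod_(d <- ds) - d.+1%:R) *: v.
  elim: ds => [|d ds IH]; first by rewrite big_nil scale1r.
  rewrite big_cons /= IH /wshift (linZ e_lin) ev !scalerA -scalerBl.
  by congr (_ *: _); ring.
move/eqP; rewrite scaler_eq0 => /orP[|/eqP//].
rewrite prodf_seq_eq0 => /hasP[d _] /=.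
by rewrite oppr_eq0 pnatr_eq0.
Qed.

End WeightShift.

Lemma wshift_op (X : lmodType K) (e A : X -> X) (k d : nat) x :
  linear A -> (forall u, e (A u) = A (e u) - (- k%:Z)%:~R *: A u) ->
  wshift e (k + d) (A x) = A (wshift e d x).
Proof.
move=> Al eA; rewrite /wshift eA (linB Al) (linZ Al) -addrA -opprD -scalerDl.
by congr (_ - _ *: _); rewrite -addnS natrD rmorphN /=; ring.
Qed.

Lemma wshifts_op (X : lmodType K) (e A : X -> X) (k : nat) ds x :
  linear A -> (forall u, e (A u) = A (e u) - (- k%:Z)%:~R *: A u) ->
  foldr (wshift e) (A x) (map (addn k) ds) = A (foldr (wshift e) x ds).
Proof. by move=> Al eA; elim: ds => //= d ds ->; exact: wshift_op. Qed.

Lemma wshift_op_hw (X : lmodType K) (e A : X -> X) (k : nat) v :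
  linear A -> (forall u, e (A u) = A (e u) - (- k.+1%:Z)%:~R *: A u) ->
  e v = h *: v -> wshift e k (A v) = 0.
Proof.
move=> Al eA ev; rewrite /wshift eA ev (linZ Al) -scalerBl -scalerBl.
by rewrite rmorphN /= [X in X *: _](_ : _ = 0) ?scale0r //; ring.
Qed.

(* Modulo the line through [(v1, v2)], elements of the graph only involve
   eigenvalues [h + d] of [e1], [e2] with [d > 0]. *)
Lemma hw_graph_weights x1 x2 : hw_graph x1 x2 -> exists c ds,
  foldr (wshift e1) (x1 - c *: v1) ds = 0 /\
  foldr (wshift e2) (x2 - c *: v2) ds = 0.
Proof.
elim=> {x1 x2} [|a x1 x2 y1 y2 _ [c [ds [H1 H2]]] _ [c' [ds' [H1' H2']]]|
    i x1 x2 oki di _ [c [ds [H1 H2]]]].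
- by exists 1, [::]; rewrite /= !scale1r !subrr.
- exists (a * c + c'), (ds ++ ds').
  have E (X : lmodType K) (x y v : X) :
      a *: x + y - (a * c + c') *: v = a *: (x - c *: v) + (y - c' *: v).
    by rewrite scalerDl scalerBr scalerA opprD addrACA.
  rewrite !E (wshifts_lin e1_lin) (wshifts_lin e2_lin).
  rewrite (wshifts_catr e1_lin _ H1) (wshifts_catl e1_lin _ H1').
  rewrite (wshifts_catr e2_lin _ H2) (wshifts_catl e2_lin _ H2').
  by rewrite !scaler0 !addr0.
have [d degE] : exists d : nat, deg i = - d.+1%:Z.
  by exists `|deg i|.-1; lia.
have D1 u : e1 (A1 i u) = A1 i (e1 u) - (- d.+1%:Z)%:~R *: A1 i u.
  by rewrite e1_deg // degE.
have D2 u : e2 (A2 i u) = A2 i (e2 u) - (- d.+1%:Z)%:~R *: A2 i u.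
  by rewrite e2_deg // degE.
exists 0, ([:: d] ++ map (addn d.+1) ds); rewrite !scale0r !subr0.
have -> : A1 i x1 = c *: A1 i v1 + A1 i (x1 - c *: v1).
  by rewrite [in RHS](linB (A1_lin oki)) (linZ (A1_lin oki)) addrC subrK.
have -> : A2 i x2 = c *: A2 i v2 + A2 i (x2 - c *: v2).
  by rewrite [in RHS](linB (A2_lin oki)) (linZ (A2_lin oki)) addrC subrK.
rewrite (wshifts_lin e1_lin) (wshifts_lin e2_lin).
rewrite (@wshifts_catr _ _ e1_lin [:: d]); last exact: wshift_op_hw (A1_lin oki) D1 e1_hw.
rewrite (@wshifts_catr _ _ e2_lin [:: d]); last exact: wshift_op_hw (A2_lin oki) D2 e2_hw.
rewrite !scaler0 !add0r !(@wshifts_catl _ _ _ (map (addn d.+1) ds)) //.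
- by rewrite (wshifts_op _ _ (A2_lin oki) D2) H2; exact: lin0 (A2_lin oki).
- by rewrite (wshifts_op _ _ (A1_lin oki) D1) H1; exact: lin0 (A1_lin oki).
Qed.

(** The scalar [c] of [hw_graph_weights] is common to both components. The zero first component
    forces c = 0, and then a product of shifts would kill [v2], contrary to [wshifts_hw]. *)
Lemma hw_graph_0v2 : ~ hw_graph 0 v2.
Proof.
move=> /hw_graph_weights[c [ds []]]; rewrite sub0r.
have [->|c0] := eqVneq c 0.
  by rewrite !scale0r subr0 => _; exact: wshifts_hw.
rewrite -[- (c *: v1)]scaleNr (linZ (wshifts_lin e1_lin ds)) => /eqP.
rewrite scaler_eq0 oppr_eq0 (negPf c0) => /eqP H _; move: H.
exact: wshifts_hw.
Qed.

Lemma hw_graph_v10 : ~ hw_graph v1 0.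
Proof.
move=> /hw_graph_weights[c [ds []]]; rewrite sub0r.
have [->|c0] := eqVneq c 0.
  by rewrite !scale0r subr0 => H _; move: H; exact: wshifts_hw.
rewrite -[- (c *: v2)]scaleNr (linZ (wshifts_lin e2_lin ds)) => _ /eqP.
rewrite scaler_eq0 oppr_eq0 (negPf c0) => /eqP; exact: wshifts_hw.
Qed.

(** Goursat's lemma: both projections of the graph are onto by irreducibility, and the fibres over 0
    are submodules that miss the highest weight vectors, hence are zero. *)
Theorem hw_iso : exists f : X1 -> X2,
  [/\ linear f, injective f, forall x, P2 (f x),
      forall y, P2 y -> exists x, f x = y
    & f v1 = v2 /\ forall i x, ok i -> f (A1 i x) = A2 i (f x)].
Proof.
have GP2 : forall x y, hw_graph x y -> P2 y.
  move=> x y; elim=> // [a x1 x2 y1 y2 _ Px _ Py|i x1 x2 oki _ _]; first exact: P2_sub.2.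
  exact: P2_stable.
have Gtot x : exists y, hw_graph x y.
  have [] := irr1 (Q := [set x | exists y, hw_graph x y]%classic) => [||H|H].
  - split; first by exists 0; exact: hw_graph0.
    by move=> a u v [y0 hy] [z hz]; exists (a *: y0 + z); apply: hw_graph_lin.
  - by move=> i u oki [y0 hy]; exists (A2 i y0); apply: hw_graph_stable.
  - by case: v1_neq0; apply: H; exists v2; exact: hw_graph_hw.
  exact: H.
have Gsurj y : P2 y -> exists x, hw_graph x y.
  have [] := irr2 (Q := [set y | exists x, hw_graph x y]%classic) => [|||H|H Py].
  - split; first by exists 0; exact: hw_graph0.
    by move=> a u v [x0 hx] [z hz]; exists (a *: x0 + z); apply: hw_graph_lin.
  - by move=> i u oki [x0 hx]; exists (A1 i x0); apply: hw_graph_stable.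
  - by move=> u [x0]; apply: GP2.
  - by case: v2_neq0; apply: H; exists v1; exact: hw_graph_hw.
  exact: H.
have G0y : forall y, hw_graph 0 y -> y = 0.
  have [] := irr2 (Q := [set y | hw_graph 0 y]%classic) => [|||H y|H y].
  - split; first exact: hw_graph0.
    by move=> a u v hu /(hw_graph_lin a hu); rewrite scaler0 addr0.
  - by move=> i u oki /(hw_graph_stable oki); rewrite lin0 //; exact: A1_lin.
  - by move=> u; apply: GP2.
  - exact: H.
  by have := hw_graph_0v2 (H _ P2_hw).
have Gx0 : forall x, hw_graph x 0 -> x = 0.
  have [] := irr1 (Q := [set x | hw_graph x 0]%classic) => [||H x|H x].
  - split; first exact: hw_graph0.
    by move=> a u v hu /(hw_graph_lin a hu); rewrite scaler0 addr0.
  - by move=> i u oki /(hw_graph_stable oki); rewrite lin0 //; exact: A2_lin.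
  - exact: H.
  by have := hw_graph_v10 (H v1).
have Gfun : forall x y z, hw_graph x y -> hw_graph x z -> y = z.
  move=> x y z h1 /(hw_graph_lin (-1)) /(_ h1); rewrite !scaleN1r addNr => /G0y.
  by rewrite addrC => /eqP; rewrite subr_eq0 => /eqP.
have /choice[f fP] := Gtot; exists f; split.
- by move=> a u v; apply: (Gfun _ _ _ (fP _)); apply: hw_graph_lin.
- move=> x y fxy; apply/eqP; rewrite -subr_eq0 -opprB oppr_eq0 addrC; apply/eqP/Gx0.
  have := hw_graph_lin (-1) (fP x) (fP y).
  by rewrite fxy !scaleN1r addNr.
- by move=> x; apply: GP2 (fP x).
- by move=> y /Gsurj[x hx]; exists x; apply: Gfun (fP x) hx.
split; first exact: Gfun (fP _) hw_graph_hw.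
by move=> i x oki; apply: Gfun (fP _) (hw_graph_stable oki (fP x)).
Qed.

End HighestWeight.

(** * The fermionic Fock space *)

Section Fock.
Local Open Scope fset_scope.
Local Open Scope ring_scope.
Variables (K : numFieldType) (T : countType).

(** The Fock space is the exterior algebra on the modes [T], in coordinates: a vector is a finitely
    supported function of the finite set of occupied modes. *)
Definition fock_finite : {pred ({fset T} -> K^o)} :=
  fun u => `[< exists s : seq {fset T}, forall S, u S != 0 -> S \in s >].

Lemma fock_finite_submod : submod_closed fock_finite.
Proof.
split; first by apply/asboolP; exists [::] => S; rewrite eqxx.
move=> a u v /asboolP[s hs] /asboolP[s' hs'].
apply/asboolP; exists (s ++ s') => S; apply: contraNT; rewrite mem_cat negb_or.
move=> /andP[/(contraNeq (hs _)) uS /(contraNeq (hs' _)) vS].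
by rewrite !fctE uS vS scaler0 addr0.
Qed.

HB.instance Definition _ :=
  GRing.isSubmodClosed.Build K ({fset T} -> K^o) fock_finite fock_finite_submod.

Record fock := Fock { fock_fun : {fset T} -> K^o; fock_funP : fock_fun \in fock_finite }.
HB.instance Definition _ := [isSub for fock_fun].
HB.instance Definition _ := [Choice of fock by <:].
HB.instance Definition _ := [SubChoice_isSubLmodule of fock by <:].

Definition fock_app (u : fock) (S : {fset T}) : K := fock_fun u S.
Coercion fock_app : fock >-> Funclass.

Implicit Types (u v : fock) (S : {fset T}) (h : T).

Lemma fockP u v : (forall S, u S = v S) -> u = v.
Proof. by move=> uv; apply: val_inj; apply/funext. Qed.

Lemma fockD u v S : (u + v : fock) S = u S + v S. Proof. by []. Qed.
Lemma fockN u S : (- u : fock) S = - u S. Proof. by []. Qed.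
Lemma fockZ a u S : (a *: u : fock) S = a * u S. Proof. by []. Qed.
Lemma fock0 S : (0 : fock) S = 0. Proof. by []. Qed.

Lemma fock_sum (I : Type) (r : seq I) (F : I -> fock) S :
  (\sum_(i <- r) F i : fock) S = \sum_(i <- r) F i S.
Proof. by elim/big_rec2: _ => // i x y _ <-. Qed.

Lemma fock_support u : exists s : seq {fset T}, forall S, u S != 0 -> S \in s.
Proof. by have /asboolP := fock_funP u. Qed.

(** The Jordan-Wigner signs require a total order on the modes; the injection of the countable type
    [T] into the naturals provides one. *)
Definition mode_rank : T -> nat := @choice.pickle T.

Lemma mode_rank_inj : injective mode_rank.
Proof. exact: pcan_inj (@choice.pickleK T). Qed.

(* [(-1) ^ k] where [k] elements of [S] precede [h]. *)
Definition fsign h S : K :=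
  (-1) ^+ (\sum_(j <- S) (mode_rank j < mode_rank h)%N).

Lemma fsign2 h S : fsign h S * fsign h S = 1.
Proof. by rewrite /fsign -exprD addnn -signr_odd odd_double. Qed.

Lemma fsignU h h' S : h' \notin S ->
  fsign h (h' |` S) = (-1) ^+ (mode_rank h' < mode_rank h)%N * fsign h S.
Proof. by move=> h'S; rewrite /fsign big_fsetU1 // exprD. Qed.

Lemma fsignD h h' S : h' \in S ->
  fsign h (S `\ h') = (-1) ^+ (mode_rank h' < mode_rank h)%N * fsign h S.
Proof.
move=> h'S; rewrite -{2}[S](fsetD1K h'S) fsignU ?mulrA ?in_fsetD1 ?eqxx //.
by rewrite -exprD addnn -signr_odd odd_double mul1r.
Qed.

Lemma fsign_swap h h' : h != h' ->
  (-1) ^+ (mode_rank h' < mode_rank h)%N = - (-1) ^+ (mode_rank h < mode_rank h')%N :> K.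
Proof.
move=> hh'; case: ltngtP => [|_|/mode_rank_inj E].
- by rewrite expr0 expr1.
- by rewrite expr0 expr1 opprK.
- by rewrite E eqxx in hh'.
Qed.

Definition ann_fun h (u : {fset T} -> K) S : K :=
  if h \in S then 0 else fsign h S * u (h |` S).

Definition cre_fun h (u : {fset T} -> K) S : K :=
  if h \in S then fsign h S * u (S `\ h) else 0.

Lemma ann_finite h u : ann_fun h u \in fock_finite.
Proof.
have [s hs] := fock_support u; apply/asboolP.
exists [seq S0 `\ h | S0 <- s] => S; rewrite /ann_fun.
case: ifP => [|hS]; first by rewrite eqxx.
rewrite mulf_eq0 negb_or => /andP[_ /hs us]; apply/mapP; exists (h |` S) => //.
by rewrite fsetU1K // hS.
Qed.

Lemma cre_finite h u : cre_fun h u \in fock_finite.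
Proof.
have [s hs] := fock_support u; apply/asboolP.
exists [seq h |` S0 | S0 <- s] => S; rewrite /cre_fun.
case: ifP => [hS|]; last by rewrite eqxx.
rewrite mulf_eq0 negb_or => /andP[_ /hs us]; apply/mapP; exists (S `\ h) => //.
by rewrite fsetD1K.
Qed.

Definition ann h u : fock := Fock (ann_finite h u).
Definition cre h u : fock := Fock (cre_finite h u).

Lemma annE h u S : ann h u S = if h \in S then 0 else fsign h S * u (h |` S).
Proof. by []. Qed.

Lemma creE h u S : cre h u S = if h \in S then fsign h S * u (S `\ h) else 0.
Proof. by []. Qed.

Lemma ann_linear h : linear (ann h).
Proof.
move=> a u v; apply: fockP => S; rewrite fockD fockZ !annE.
by case: ifP => _; rewrite ?mulr0 ?addr0 // fockD fockZ; ring.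
Qed.

Lemma cre_linear h : linear (cre h).
Proof.
move=> a u v; apply: fockP => S; rewrite fockD fockZ !creE.
by case: ifP => _; rewrite ?mulr0 ?addr0 // fockD fockZ; ring.
Qed.

Lemma ann_ann h h' u : ann h (ann h' u) = - ann h' (ann h u).
Proof.
apply: fockP => S; rewrite fockN !annE !in_fset1U.
have [<-|hh'] := eqVneq h h'; first by case: ifP => _; rewrite ?eqxx ?mulr0 oppr0.
rewrite /=.
have [hS|hS] := boolP (h \in S); have [h'S|h'S] := boolP (h' \in S) => //=;
  rewrite ?mulr0 ?oppr0 //.
rewrite !fsignU // (fsign_swap hh') fsetUCA; ring.
Qed.

Lemma cre_cre h h' u : cre h (cre h' u) = - cre h' (cre h u).
Proof.
apply: fockP => S; rewrite fockN !creE !in_fsetD1.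
have [<-|hh'] := eqVneq h h'; first by case: ifP => _; rewrite ?eqxx ?mulr0 oppr0.
rewrite /=.
have [hS|hS] := boolP (h \in S); have [h'S|h'S] := boolP (h' \in S) => //=;
  rewrite ?mulr0 ?oppr0 //.
rewrite !fsignD // (fsign_swap hh') fsetDDl fsetDDl [[fset h] `|` _]fsetUC; ring.
Qed.

Lemma ann_cre h h' u :
  ann h (cre h' u) = (if h == h' then u else 0) - cre h' (ann h u).
Proof.
apply: fockP => S; rewrite fockD fockN annE !creE annE !in_fset1U !in_fsetD1.
have [<-|hh'] := eqVneq h h'.
  rewrite ?eqxx /=.
  have [hS|hS] := boolP (h \in S); rewrite ?sub0r ?subr0.
    by rewrite fsetD1K // fsignD // ltnn mul1r mulrA fsign2 mul1r subrr.
  by rewrite fsetU1K // fsignU // ltnn mul1r mulrA fsign2 mul1r.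
rewrite /= ?fock0 sub0r.
have [hS|hS] := boolP (h \in S); have [h'S|h'S] := boolP (h' \in S) => //=;
  rewrite ?mulr0 ?oppr0 //.
rewrite fsignU // fsignD // [X in _ * (_ * X)](_ : _ = u (h |` (S `\ h'))).
  by rewrite (fsign_swap hh'); ring.
congr (u _); apply/fsetP => j; rewrite !(in_fset1U, in_fsetD1).
by have [->|] := eqVneq j h; rewrite ?hh'.
Qed.

Definition fket_fun (S0 S : {fset T}) : K := (S == S0)%:R.

Lemma fket_finite S0 : fket_fun S0 \in fock_finite.
Proof.
apply/asboolP; exists [:: S0] => S; rewrite /fket_fun inE.
by case: (S == S0); rewrite ?eqxx.
Qed.

Definition fket S0 : fock := Fock (fket_finite S0).
Definition fvac : fock := fket fset0.

Lemma fketE S0 S : fket S0 S = (S == S0)%:R. Proof. by []. Qed.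

Lemma fvac_neq0 : fvac <> 0.
Proof.
by move=> /(congr1 (fun u : fock => u fset0))/eqP; rewrite fketE eqxx oner_eq0.
Qed.

Lemma ann_fvac h : ann h fvac = 0.
Proof.
apply: fockP => S; rewrite annE fock0; case: ifP => // hS.
rewrite fketE; case: eqP => [E|]; last by rewrite mulr0.
by have := fset1U1 h S; rewrite E in_fset0.
Qed.

Lemma cre_fket h S0 : h \notin S0 -> cre h (fket S0) = fsign h S0 *: fket (h |` S0).
Proof.
move=> hS0; apply: fockP => S; rewrite fockZ creE !fketE.
have [->|SS] := eqVneq S (h |` S0).
  by rewrite fset1U1 fsetU1K // eqxx fsignU // ltnn mul1r.
rewrite mulr0; case: ifP => // hS; case: eqP => [E|]; last by rewrite mulr0.
by rewrite -E fsetD1K // eqxx in SS.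
Qed.

Lemma fket_cre h S : h \in S -> fket S = fsign h S *: cre h (fket (S `\ h)).
Proof.
move=> hS; rewrite cre_fket ?in_fsetD1 ?eqxx // fsetD1K // fsignD // ltnn mul1r.
by rewrite scalerA fsign2 scale1r.
Qed.

Lemma fock_expand u (s : seq {fset T}) : uniq s -> (forall S, u S != 0 -> S \in s) ->
  u = \sum_(S0 <- s) u S0 *: fket S0.
Proof.
move=> us hs; apply: fockP => S; rewrite fock_sum.
have [Ss|Ss] := boolP (S \in s).
  rewrite (bigD1_seq S) // big1 ?addr0 => [|S' SS'].
    by rewrite fockZ fketE eqxx mulr1 [RHS]addr0.
  by rewrite [LHS]fockZ fketE eq_sym (negPf SS') mulr0.
rewrite big_seq big1 => [|S' S's]; first by apply/eqP; apply: contraR Ss => /hs.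
rewrite fockZ fketE; case: eqP => [E|]; last by rewrite mulr0.
by rewrite E S's in Ss.
Qed.

Lemma fock_basis_ind (P : set fock) :
  is_subspace P -> forall u, (forall S, u S != 0 -> P (fket S)) -> P u.
Proof.
move=> Ps u uP; have [s hs] := fock_support u.
rewrite (@fock_expand u (undup s)) ?undup_uniq => //; last first.
  by move=> S; rewrite mem_undup; apply: hs.
apply: sub_sum => // S _; have [->|/uP] := eqVneq (u S) 0; last exact: subZ.
by rewrite scale0r; apply: sub0.
Qed.

Lemma fock_ind (P : set fock) : is_subspace P -> P fvac ->
  (forall h u, P u -> P (cre h u)) -> forall u, P u.
Proof.
move=> Ps Pv Pc u; apply: fock_basis_ind => // S _.
move: {2}#|` S| (erefl #|` S|) => k; elim: k S => [|k IH] S Sk.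
  by move/cardfs0_eq: Sk => ->.
have /fset0Pn[h hS] : S != fset0 by rewrite -cardfs_gt0 Sk.
rewrite (fket_cre hS); apply: subZ => //; apply: Pc; apply: IH.
by apply/eqP; rewrite -eqSS -Sk (cardfsD1 h S) hS.
Qed.

Lemma fock_even_ind (P : set fock) : is_subspace P -> P fvac ->
  (forall h h' u, P u -> P (cre h (cre h' u))) ->
  forall u, (forall S, u S != 0 -> ~~ odd #|` S|) -> P u.
Proof.
move=> Ps Pv Pc u uev; apply: fock_basis_ind => // S /uev.
move: {2}#|` S| (leqnn #|` S|) => k; elim: k S => [|k IH] S Sk Sev.
  by move: Sk; rewrite leqn0 => /eqP/cardfs0_eq ->.
have [->//|/fset0Pn[h hS]] := eqVneq S fset0.
have E1 := cardfsD1 h S; rewrite hS /= add1n in E1.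
have /fset0Pn[h' h'S] : S `\ h != fset0.
  by rewrite -cardfs_gt0; move: Sev; rewrite E1 /=; case: #|` _|.
have E2 := cardfsD1 h' (S `\ h); rewrite h'S /= add1n in E2.
rewrite (fket_cre hS) (fket_cre h'S) (linZ (cre_linear h)).
do 2!apply: subZ => //; apply/Pc/IH; first by move: Sk; rewrite E1 E2 ltnS; exact: ltnW.
by move: Sev; rewrite E1 E2 /= negbK.
Qed.

Lemma fock_vacuum u : (forall h, ann h u = 0) -> u = u fset0 *: fvac.
Proof.
move=> u0; apply: fockP => S; rewrite fockZ fketE.
have [->|/fset0Pn[h hS]] := eqVneq S fset0; first by rewrite mulr1.
rewrite mulr0; have := congr1 (fun v : fock => v (S `\ h)) (u0 h).
rewrite annE in_fsetD1 eqxx /= fsetD1K // => /eqP.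
by rewrite mulf_eq0 signr_eq0 => /eqP.
Qed.

End Fock.

Arguments fock_app : simpl never.
Arguments ann : simpl never.
Arguments cre : simpl never.
Arguments fket : simpl never.

(** * Free fermion modes and their anticommutation relations *)

Section Fermions.
Variables (K : numFieldType) (n : nat).
Local Notation F := (fock K ('I_n * nat)%type).
Implicit Types (u v : F) (i j k : 'I_n) (a b e p q : int).

(* [psi i a] is the coefficient of z^(-a-1) of the i-th free fermion field. *)
Definition psi i a : F -> F :=
  match a with Posz m => ann (i, m) | Negz m => cre (i, m) end.

Local Notation vac := (fvac K ('I_n * nat)%type).

Lemma psi_linear i a : linear (psi i a).
Proof. by case: a => m; [exact: ann_linear|exact: cre_linear]. Qed.

Lemma psi0 i a : psi i a 0 = 0. Proof. exact: lin0 (psi_linear i a). Qed.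

Lemma psi_car i a j b u :
  psi i a (psi j b u) = ((i == j) && (a + b == -1))%:R *: u - psi j b (psi i a u).
Proof.
case: a b => [m|m] [m'|m'] /=.
- by rewrite ann_ann (_ : _ + _ == _ = false) ?andbF ?scale0r ?sub0r //; lia.
- rewrite ann_cre -pair_eqE /= (_ : (m%:Z + Negz m' == -1) = (m == m')); last lia.
  by case: (_ && _); rewrite ?scale1r ?scale0r.
- rewrite ann_cre -pair_eqE /= (_ : (Negz m + m'%:Z == -1) = (m' == m)); last lia.
  rewrite [j == i]eq_sym; case: (_ && _); rewrite ?scale1r ?scale0r opprB.
    by rewrite addrC subrK.
  by rewrite subr0 add0r.
- by rewrite cre_cre (_ : _ + _ == _ = false) ?andbF ?scale0r ?sub0r //; lia.
Qed.

Lemma psi_anti i a j b u : ((i == j) && (a + b == -1)) = false ->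
  psi i a (psi j b u) = - psi j b (psi i a u).
Proof. by move=> H; rewrite psi_car H scale0r sub0r. Qed.

Lemma psi_vac i a : 0 <= a -> psi i a vac = 0.
Proof. by case: a => m // _; exact: ann_fvac. Qed.

Lemma psi_coef_vac i a u : a < 0 -> psi i a u fset0 = 0.
Proof. by case: a => m // _; rewrite /= creE in_fset0. Qed.

Lemma psi_cutoff u : exists N : nat, forall i a, N%:Z <= a -> psi i a u = 0.
Proof.
move: u; apply: (@fock_ind _ _
  (fun u => exists N : nat, forall i a, N%:Z <= a -> psi i a u = 0)) => [||[j m] u [N IH]].
- split; first by exists 0%N => i a _; exact: psi0.
  move=> c u v [N IHu] [N' IHv]; exists (N + N')%N => i a ha.
  by rewrite psi_linear IHu ?IHv ?scaler0 ?addr0 //; lia.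
- by exists 0%N => i a; exact: psi_vac.
- exists (N + m.+1)%N => i a ha; rewrite -[cre _ u]/(psi j (Negz m) u) psi_anti.
    by rewrite IH ?psi0 ?oppr0 //; lia.
  by apply/andP => -[_]; lia.
Qed.

(** Schur's lemma for the Clifford algebra: the annihilators kill [D vac], so it is a multiple of
    the vacuum, and the creators spread the same scalar over the whole space. *)
Lemma psi_comm_scalar (D : F -> F) : linear D ->
  (forall i a u, D (psi i a u) = psi i a (D u)) ->
  forall u, D u = D vac fset0 *: u.
Proof.
move=> Dl Dpsi; have Dvac : D vac = D vac fset0 *: vac.
  apply: fock_vacuum => -[i m].
  by rewrite -[ann _ _]/(psi i m%:Z (D vac)) -Dpsi psi_vac // (lin0 Dl).
apply: (@fock_ind _ _ (fun u => D u = D vac fset0 *: u)) => [||[j m] u IH] //.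
- split; first by rewrite (lin0 Dl) scaler0.
  by move=> c u v; rewrite Dl => -> ->; rewrite scalerDr !scalerA mulrC.
- rewrite -[cre _ u]/(psi j (Negz m) u) Dpsi IH.
  by rewrite (linZ (psi_linear _ _)).
Qed.

(** * Normally ordered quadratic operators *)

Definition nord i a j b u : F :=
  if a < 0 then psi i a (psi j b u) else - psi j b (psi i a u).

Lemma nord_linear i a j b : linear (nord i a j b).
Proof.
have l (i' j' : 'I_n) (a' b' : int) : linear (fun u => psi i' a' (psi j' b' u)).
  exact: lin_comp (psi_linear _ _) (psi_linear _ _).
by rewrite /nord; case: (a < 0); [|apply: lin_opp]; exact: l.
Qed.

Lemma nord_neq i a j b u : i != j -> nord i a j b u = psi i a (psi j b u).
Proof.
by move=> /negPf ij; rewrite /nord; case: ifP => // _; rewrite [RHS]psi_anti ?ij.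
Qed.

Lemma nord_anti i a j b u : nord i a j b u = - nord j b i a u.
Proof.
rewrite /nord; case: ltP => ha; case: ltP => hb; rewrite ?opprK // psi_anti ?opprK //.
  by apply/andP => -[_]; lia.
by apply/andP => -[_]; lia.
Qed.

Lemma nord_psi i a j b k e u : nord i a j b (psi k e u) =
  psi k e (nord i a j b u) + ((j == k) && (b + e == -1))%:R *: psi i a u
   - ((i == k) && (a + e == -1))%:R *: psi j b u.
Proof.
have E (i1 j1 : 'I_n) (a1 b1 : int) : psi i1 a1 (psi j1 b1 (psi k e u)) =
    psi k e (psi i1 a1 (psi j1 b1 u)) + ((j1 == k) && (b1 + e == -1))%:R *: psi i1 a1 u
   - ((i1 == k) && (a1 + e == -1))%:R *: psi j1 b1 u.
  rewrite (psi_car j1 b1) (linB (psi_linear _ _)) (linZ (psi_linear _ _)).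
  by rewrite (psi_car i1 a1 k) opprB addrCA addrA.
rewrite /nord; case: ifP => _; rewrite E //.
by rewrite (linN (psi_linear _ _)) !opprD opprK addrAC.
Qed.

(** An infinite sum of bilinears of total mode [b], with coefficient function [c]. Normal ordering
    leaves finitely many nonzero terms on each vector ([nord_finite]), as [zsum] requires. *)
Definition Qop i j b (c : int -> K) u : F :=
  zsum (fun a => c a *: nord i a j (b - a) u).

Lemma nord_finite i j b (c : int -> K) u :
  zfinite (fun a => c a *: nord i a j (b - a) u).
Proof.
have [N hN] := psi_cutoff u.
apply: (@zfiniteP _ _ _ (Num.min 0 (b - N%:Z)) N%:Z) => a ha; rewrite /nord.
  rewrite lt_min in ha; case/andP: ha => -> ha.
  by rewrite hN ?psi0 ?scaler0 //; lia.
by rewrite ltNge (_ : 0 <= a) /= ?hN ?psi0 ?oppr0 ?scaler0 //; lia.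
Qed.

Lemma Qop_linear i j b c : linear (Qop i j b c).
Proof.
move=> x u v; rewrite /Qop (zsum_lin (f := GRing.scale x)); first last.
- exact: nord_finite.
- exact: lin_scale (@lin_id _ _).
rewrite -zsumD.
- by apply: eq_zsum => a; rewrite nord_linear scalerDr !scalerA mulrC.
- by apply: zfinite_lin (nord_finite _ _ _ _ _); apply: lin_scale (@lin_id _ _).
- exact: nord_finite.
Qed.

Lemma Qop_scale i j b c x u : Qop i j b (fun a => x * c a) u = x *: Qop i j b c u.
Proof.
rewrite /Qop (zsum_lin (f := GRing.scale x)); first last.
- exact: nord_finite.
- exact: lin_scale (@lin_id _ _).
by apply: eq_zsum => a; rewrite scalerA.
Qed.

Lemma Qop_add i j b c d u :
  Qop i j b (fun a => c a + d a) u = Qop i j b c u + Qop i j b d u.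
Proof.
rewrite /Qop -zsumD; try exact: nord_finite.
by apply: eq_zsum => a; rewrite scalerDl.
Qed.

Lemma Qop_psi i j b c k e u : Qop i j b c (psi k e u) =
  psi k e (Qop i j b c u)
   + ((j == k)%:R * c (b + 1 + e)) *: psi i (b + 1 + e) u
   - ((i == k)%:R * c (-1 - e)) *: psi j (b + 1 + e) u.
Proof.
rewrite /Qop (zsum_lin (psi_linear k e)); last exact: nord_finite.
pose t1 a := c a *: psi k e (nord i a j (b - a) u).
pose t2 a := (c a * ((j == k) && (b - a + e == -1))%:R) *: psi i a u.
pose t3 a := (c a * ((i == k) && (a + e == -1))%:R) *: psi j (b - a) u.
have z2 a : a != b + 1 + e -> t2 a = 0.
  move=> ha; rewrite /t2 (_ : _ && _ = false) ?mulr0 ?scale0r //.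
  by apply/andP => -[_]; lia.
have z3 a : a != -1 - e -> t3 a = 0.
  move=> ha; rewrite /t3 (_ : _ && _ = false) ?mulr0 ?scale0r //.
  by apply/andP => -[_]; lia.
have f1 : zfinite t1.
  apply: (@eq_zfinite _ _ (fun a => psi k e (c a *: nord i a j (b - a) u))).
    by move=> a; rewrite (linZ (psi_linear _ _)).
  by apply: zfinite_lin (psi_linear _ _) (nord_finite _ _ _ _ _).
have f2 := zfinite_single z2; have f3 := zfinite_single z3.
transitivity (zsum (fun a => t1 a + t2 a - t3 a)).
  apply: eq_zsum => a; rewrite nord_psi scalerBr scalerDr !scalerA.
  by rewrite /t1 /t2 /t3.
rewrite zsumB // ?zsumD //; last exact: zfiniteD.
congr (_ + _ - _).
- by apply: eq_zsum => a; rewrite /t1 (linZ (psi_linear _ _)).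
- rewrite (zsum_single z2) /t2 (_ : b - _ + e == -1) ?andbT 1?mulrC //.
  by apply/eqP; ring.
- rewrite (zsum_single z3) /t3 (_ : -1 - e + e == -1) ?andbT 1?mulrC //; last lia.
  by congr (_ *: psi _ _ _); ring.
Qed.

Lemma Qop_coef_vac i j b c u : b < 0 -> Qop i j b c u fset0 = 0.
Proof.
move=> b0; apply: (@zsum_subspace _ _ (fun v : F => v fset0 = 0)) => [|a].
  by split=> [|x v w Hv Hw]; rewrite ?fock0 // fockD fockZ Hv Hw mulr0 addr0.
rewrite fockZ /nord; case: ltP => ha; first by rewrite psi_coef_vac ?mulr0.
by rewrite fockN psi_coef_vac ?oppr0 ?mulr0 //; lia.
Qed.

Lemma Qop_vac0 i j b c : -1 <= b -> Qop i j b c vac = 0.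
Proof.
move=> b0; apply: zsum0 => a; rewrite /nord; case: ltP => ha.
  by rewrite [psi j _ _]psi_vac ?psi0 ?scaler0 //; lia.
by rewrite [psi i _ _]psi_vac // psi0 oppr0 scaler0.
Qed.

Lemma Qop_vac i j (m : nat) c : Qop i j (- m%:Z - 1) c vac =
  \sum_(t < m) c (- t.+1%:Z) *: psi i (- t.+1%:Z) (psi j (t%:Z - m%:Z) vac).
Proof.
rewrite /Qop (@zsumE _ _ (- m%:Z, m)) => [|a /= ha]; last first.
  rewrite /nord; case: ltP => a0; last first.
    by rewrite [psi i a _]psi_vac // psi0 oppr0 scaler0.
  by rewrite [psi j _ _]psi_vac ?psi0 ?scaler0 //; lia.
rewrite /zwindow /= big_nat_rev /= big_mkord; apply: eq_bigr => t _.
have -> : - m%:Z + (0 + m - t.+1)%N%:Z = - t.+1%:Z by have := ltn_ord t; lia.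
rewrite /nord (_ : - t.+1%:Z < 0) //; do 2!congr (_ _); congr (psi _ _ _); lia.
Qed.

(** * Operators acting as derivations on the fermions *)

Definition fderiv (X : F -> F) p (m : int -> 'M[K]_n) : Prop :=
  [/\ linear X,
      forall k e u, X (psi k e u) =
        psi k e (X u) + \sum_i m e i k *: psi i (e + p) u,
      p <= 0 -> forall u, X u fset0 = 0
    & 0 <= p -> X vac = 0].

(** Commutators with the fermions determine an operator only up to a scalar. The two vacuum clauses
    of [fderiv] remove this freedom: they force the vacuum expectation to be 0 whatever the sign of
    [p]. *)
Lemma fderiv_vac_coef X p m : fderiv X p m -> X vac fset0 = 0.
Proof.
move=> [_ _ X1 X2]; case: (leP p 0) => [/X1 ->//|/ltW/X2 ->].
by rewrite fock0.
Qed.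

(** X Y - Y X - Z commutes with every fermion, hence is a scalar by [psi_comm_scalar]; it is read
    off on the vacuum, where Z contributes nothing. All central terms on the Fock space arise from
    this scalar. *)
Lemma fderiv_comm X Y Z p q m m' u : fderiv X p m -> fderiv Y q m' ->
  fderiv Z (p + q) (fun e => m (e + q) *m m' e - m' (e + p) *m m e) ->
  X (Y u) - Y (X u) = Z u + (X (Y vac) fset0 - Y (X vac) fset0) *: u.
Proof.
move=> hX hY hZ.
have [Xl Xp _ _] := hX; have [Yl Yp _ _] := hY; have [Zl Zp _ _] := hZ.
pose D u := X (Y u) - Y (X u) - Z u.
have Dl : linear D.
  by apply: lin_sub => //; apply: lin_sub; apply: lin_comp.
have Dpsi i a v : D (psi i a v) = psi i a (D v).
  rewrite /D Yp Xp (linD Xl) Xp (lin_sum Xl) (linD Yl) Yp (lin_sum Yl) Zp.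
  have E (A : F -> F) r s (m1 m2 : int -> 'M[K]_n) : linear A ->
      (forall k e u, A (psi k e u) =
        psi k e (A u) + \sum_i m1 e i k *: psi i (e + r) u) ->
      \sum_j A (m2 a j i *: psi j (a + s) v) =
      \sum_j m2 a j i *: psi j (a + s) (A v) +
      \sum_j (m1 (a + s) *m m2 a) j i *: psi j (a + (r + s)) v.
    move=> Al Ap; transitivity (\sum_j (m2 a j i *: psi j (a + s) (A v) +
        \sum_k (m1 (a + s) k j * m2 a j i) *: psi k (a + (r + s)) v)).
      apply: eq_bigr => j _; rewrite (linZ Al) Ap scalerDr; congr (_ + _).
      rewrite scaler_sumr; apply: eq_bigr => k _; rewrite scalerA mulrC.
      by congr (_ *: psi _ _ _); ring.
    rewrite big_split /=; congr (_ + _); rewrite exchange_big /=.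
    by apply: eq_bigr => k _; rewrite -scaler_suml mxE.
  rewrite (E X p q m m' Xl Xp) (E Y q p m' m Yl Yp).
  set S1 := \sum_j m' _ _ _ *: _; set S2 := \sum_j m _ _ _ *: _.
  set S3 := \sum_j _ *: _; set S4 := \sum_j (m' _ *m _) _ _ *: _.
  have -> : \sum_j (m (a + q) *m m' a - m' (a + p) *m m a) j i *: psi j (a + (p + q)) v
      = S3 - S4.
    rewrite /S3 /S4 [q + p]addrC -sumrB; apply: eq_bigr => j _.
    by rewrite !mxE scalerBl.
  rewrite !(linB (psi_linear _ _)).
  by apply: fockP => S; rewrite !(fockD, fockN); ring.
have := psi_comm_scalar Dl Dpsi u; rewrite /D fockD !fockN fockD fockN.
rewrite (fderiv_vac_coef hZ) subr0 => <-.
by apply: fockP => S; rewrite !(fockD, fockN); ring.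
Qed.

End Fermions.

Arguments psi : simpl never.
Arguments nord : simpl never.
Arguments Qop : simpl never.

(** * The currents of so(n) on the fermions, at level 1 *)

Section Currents.
Variables (K : numFieldType) (n : nat).
Local Notation F := (fock K ('I_n * nat)%type).
Local Notation vac := (fvac K ('I_n * nat)%type).
Implicit Types (u v : F) (i j k : 'I_n) (a b e p q r s : int).

(** On a pair of creators, [X] reaches the vacuum only by turning the first creator into the
    annihilator of the second. This forces p = t and selects the matrix entry (j, i). *)
Lemma fderiv_Qop_vac_coef X p (m : int -> 'M[K]_n) i j (t : nat) c :
  fderiv X p m -> 0 < p ->
  X (Qop i j (- t%:Z - 1) c vac) fset0 =
  (p == t%:Z)%:R * \sum_(a < t) c (- a.+1%:Z) * m (- a.+1%:Z) j i.
Proof.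
move=> [Xl Xp _ X0] p0; rewrite Qop_vac (lin_sum Xl) fock_sum mulr_sumr.
apply: eq_bigr => a _; rewrite (linZ Xl) fockZ Xp fockD fock_sum.
rewrite psi_coef_vac // add0r mulrCA; congr (_ * _).
have at' := ltn_ord a; rewrite (bigD1 j) // big1 => [|k kj].
  rewrite fockZ psi_car eqxx [_ && _]/= fockD fockN fockZ psi_coef_vac; last lia.
  rewrite [LHS]addr0 subr0 fketE eqxx mulr1 mulrC; congr (_%:R * _).
  by congr nat_of_bool; lia.
rewrite fockZ psi_car (negPf kj) scale0r sub0r fockN psi_coef_vac; last lia.
by rewrite oppr0 mulr0.
Qed.

Definition som (x : 'M[K]_n) p u : F :=
  (1 / 2) *: \sum_i \sum_j x i j *: Qop i j (p - 1) (fun=> 1) u.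

Arguments som : simpl never.

Lemma som_linear_l p c (x y : 'M[K]_n) u :
  som (c *: x + y) p u = c *: som x p u + som y p u.
Proof.
rewrite /som !scaler_sumr -big_split; apply: eq_bigr => i _ /=.
rewrite !scaler_sumr -big_split; apply: eq_bigr => j _ /=.
by rewrite !mxE !scalerA -scalerDl; congr (_ *: _); ring.
Qed.

Lemma so_mxE (x : 'M[K]_n) i j : so_mx x -> x i j = - x j i.
Proof. by move=> sx; have /matrixP/(_ j i) := sx; rewrite !mxE. Qed.

Lemma som_fderiv x p : so_mx x -> fderiv (som x p) p (fun=> x).
Proof.
move=> sx; split.
- apply: lin_scale; apply: lin_bigsum => i; apply: lin_bigsum => j.
  by apply: lin_scale; apply: Qop_linear.
- move=> k e u; rewrite /som (linZ (psi_linear _ _)) (lin_sum (psi_linear _ _)).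
  transitivity ((1 / 2) *: (\sum_i psi k e (\sum_j x i j *: Qop i j (p - 1) (fun=> 1) u) +
     ((\sum_i x i k *: psi i (e + p) u) - (\sum_j x k j *: psi j (e + p) u)))).
    congr (_ *: _); rewrite addrA.
    transitivity (\sum_i (psi k e (\sum_j x i j *: Qop i j (p - 1) (fun=> 1) u) +
      x i k *: psi i (e + p) u - (i == k)%:R *: \sum_j x i j *: psi j (e + p) u)).
      apply: eq_bigr => i _; rewrite (lin_sum (psi_linear _ _)).
      transitivity (\sum_j (psi k e (x i j *: Qop i j (p - 1) (fun=> 1) u) +
         (j == k)%:R *: (x i k *: psi i (e + p) u) - 
         (i == k)%:R *: (x i j *: psi j (e + p) u))).
        apply: eq_bigr => j _; rewrite Qop_psi (linZ (psi_linear _ _)).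
        rewrite (_ : p - 1 + 1 + e = e + p); last by ring.
        move: (psi k e (Qop _ _ _ _ _)) (psi i _ u) (psi j _ u) => A1 A2 A3.
        rewrite !mulr1 scalerBr scalerDr !scalerA [x i j * (i == k)%:R]mulrC.
        suff -> : x i j * (j == k)%:R = (j == k)%:R * x i k by [].
        by case: eqP => [->|]; rewrite ?mulr1 ?mul1r ?mulr0 ?mul0r.
      rewrite sumrB big_split /= scaler_sumr; congr (_ + _ - _).
      rewrite (bigD1 k) //= [X in _ + X]big1 ?addr0 ?eqxx ?scale1r // => j /negPf ->.
      by rewrite scale0r.
    rewrite sumrB big_split /=; congr (_ + _ - _).
    rewrite (bigD1 k) //= [X in _ + X]big1 ?addr0 ?eqxx ?scale1r // => j /negPf ->.
    by rewrite scale0r.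
  rewrite scalerDr; congr (_ + _).
  under [X in _ - X]eq_bigr => j _ do rewrite (so_mxE k j sx) scaleNr.
  rewrite sumrN opprK -mulr2n -scaler_nat scalerA.
  by rewrite mul1r mulVf ?scale1r // pnatr_eq0.
- move=> p0 u; rewrite /som fockZ fock_sum big1 ?mulr0 // => i _.
  by rewrite fock_sum big1 // => j _; rewrite fockZ Qop_coef_vac ?mulr0 //; lia.
move=> p0; rewrite /som big1 ?scaler0 // => i _.
by rewrite big1 // => j _; rewrite Qop_vac0 ?scaler0 //; lia.
Qed.

Lemma som_linear x p : so_mx x -> linear (som x p).
Proof. by move=> /som_fderiv - /(_ p)[]. Qed.

Lemma som_psi x p k e u : so_mx x ->
  som x p (psi k e u) = psi k e (som x p u) + \sum_i x i k *: psi i (e + p) u.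
Proof. by move=> /som_fderiv - /(_ p)[]. Qed.

Lemma som_vac x p : so_mx x -> 0 <= p -> som x p vac = 0.
Proof. by move=> /som_fderiv - /(_ p)[]. Qed.

Lemma som_som_coef x y p q : so_mx x -> so_mx y ->
  som x p (som y q vac) fset0 =
  if (0 < p) && (p + q == 0) then p%:~R * so_form x y else 0.
Proof.
(* All t contractions of the two bilinears have the same value, whence the factor p; the sums over
   indices give the trace, normalised so that the level is 1 for [so_form]. *)
move=> sx sy; have [Xl _ X1 _] := som_fderiv p sx.
case: (ltP 0 p) => [p0|p0] /=; last exact: X1.
case: (leP 0 q) => [q0|q0].
  by rewrite (som_vac sy q0) (lin0 Xl) fock0; case: eqP => //; lia.
have [t ->] : exists t : nat, q = - t%:Z by exists `|q|%N; lia.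
rewrite {2}/som (linZ Xl) fockZ (lin_sum Xl) fock_sum.
rewrite (_ : (p - t%:Z == 0) = (p == t%:Z)); last by lia.
transitivity (1 / 2 * ((p == t%:Z)%:R * \sum_(i < n) \sum_(j < n) t%:R * (x j i * y i j))).
  congr (_ * _); rewrite mulr_sumr; apply: eq_bigr => i _.
  rewrite (lin_sum Xl) fock_sum mulr_sumr; apply: eq_bigr => j _.
  rewrite (linZ Xl) fockZ (fderiv_Qop_vac_coef _ _ _ _ (som_fderiv p sx) p0).
  rewrite mulrCA; congr (_ * _).
  under eq_bigr do rewrite mul1r.
  by rewrite sumr_const card_ord -mulr_natr; ring.
case: eqP => [->|_]; last by rewrite mul0r mulr0.
have -> : so_form x y = \sum_(i < n) \sum_(j < n) x j i * y i j / 2.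
  rewrite /so_form /mxtrace mulr_suml exchange_big; apply: eq_bigr => j _.
  by rewrite mxE mulr_suml.
rewrite [true%:R * _]mul1r !mulr_sumr; apply: eq_bigr => i _.
rewrite !mulr_sumr; apply: eq_bigr => j _.
by rewrite /= -pmulrn; field.
Qed.

Lemma lie_mx_so (x y : 'M[K]_n) : so_mx x -> so_mx y -> so_mx (lie_mx x y).
Proof.
move=> sx sy; rewrite /so_mx /lie_mx linearB /= !trmx_mul sx sy.
by rewrite !mulmxN !mulNmx !opprK opprB.
Qed.

Lemma som_bracket x y p q u : so_mx x -> so_mx y ->
  som x p (som y q u) - som y q (som x p u) =
  som (lie_mx x y) (p + q) u
   + (if p + q == 0 then p%:~R * so_form x y else 0) *: u.
Proof.
move=> sx sy; rewrite (fderiv_comm u (som_fderiv p sx) (som_fderiv q sy)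
  (som_fderiv (p + q) (lie_mx_so sx sy))).
suff -> : som x p (som y q vac) fset0 - som y q (som x p vac) fset0 =
    if p + q == 0 then p%:~R * so_form x y else 0 by [].
have Ex := som_som_coef p q sx sy; have Ey := som_som_coef q p sy sx.
rewrite [X in X - _]Ex [X in _ - X]Ey [q + p]addrC.
have -> : so_form y x = so_form x y by rewrite /so_form mxtrace_mulC.
have [pq|] := eqVneq (p + q) 0; last by rewrite !andbF subrr.
have -> : q = - p by lia.
rewrite !andbT; case: (ltgtP 0 p) => p0.
- by rewrite (_ : 0 < - p = false) ?subr0 //; lia.
- by rewrite (_ : 0 < - p) ?sub0r ?rmorphN /= ?mulNr ?opprK //; lia.
- by rewrite -p0 ltxx mul0r subrr.
Qed.

(** * The representation of [\hat D^+] on fermions *)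

Lemma dplus_horner r (f : {poly K}) (x : K) :
  dplus r f -> f.[- 1 - r%:~R - x] = - f.[x].
Proof.
move=> [g [godd ->]]; rewrite !horner_comp !hornerE.
have := congr1 (horner^~ (x + (r + 1)%:~R / 2)) godd.
rewrite /= horner_comp !hornerE => <-; congr (g.[_]).
by rewrite rmorphD /=; field.
Qed.

Lemma poly_horner_ext (f g : {poly K}) : (forall x, f.[x] = g.[x]) -> f = g.
Proof.
move=> fg; apply/eqP; rewrite -subr_eq0; apply/eqP.
apply: (@roots_geq_poly_eq0 _ _ [seq (i%:R : K) | i : nat <- iota 0 (size (f - g))]).
- by apply/allP => x _; rewrite /root !hornerE fg subrr.
- by rewrite map_inj_uniq ?iota_uniq // => i j /eqP; rewrite eqr_nat => /eqP.
- by rewrite size_map size_iota.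
Qed.

(** Membership in \hat D^+ becomes a functional equation, oddness under the reflection in -(r+1)/2,
    which can be checked pointwise; [dplus_horner] is the converse. *)
Lemma dplusP r (f : {poly K}) :
  (forall x : K, f.[- 1 - r%:~R - x] = - f.[x]) -> dplus r f.
Proof.
move=> fx; exists (f \Po ('X - ((r + 1)%:~R / 2)%:P)); split; last first.
  by rewrite -comp_polyA comp_polyB comp_polyX comp_polyC addrK comp_polyXr.
apply: poly_horner_ext => x; rewrite !(hornerE, horner_comp) -fx.
by congr (f.[_]); rewrite rmorphD /=; field.
Qed.

End Currents.

(** * The polynomials of \hat D^+ and the basis of the W^n_k *)

Section DPlusPolynomials.
Variable K : numFieldType.
Implicit Types (f g : {poly K}) (r s k : int).

Lemma dplus_comb r c f g : dplus r f -> dplus r g -> dplus r (c *: f + g).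
Proof.
move=> df dg; apply: dplusP => x.
by rewrite !hornerE (dplus_horner _ df) (dplus_horner _ dg); ring.
Qed.

Lemma dplus_dbracket r s f g :
  dplus r f -> dplus s g -> dplus (r + s) (dbracket r s f g).
Proof.
move=> df dg; apply: dplusP => x; rewrite /dbracket !(hornerE, horner_comp).
have E1 y : f.[y] = - f.[- 1 - r%:~R - y] by rewrite (dplus_horner _ df) opprK.
have E2 y : g.[y] = - g.[- 1 - s%:~R - y] by rewrite (dplus_horner _ dg) opprK.
rewrite (E1 (_ + s%:~R)) (E2 (- 1 - (r + s)%:~R - x)) (E1 (- 1 - (r + s)%:~R - x)).
rewrite (E2 (_ + r%:~R)) rmorphD /=.
have -> : - 1 - r%:~R - (- 1 - (r%:~R + s%:~R) - x + s%:~R) = x by ring.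
have -> : - 1 - s%:~R - (- 1 - (r%:~R + s%:~R) - x) = x + r%:~R by ring.
have -> : - 1 - r%:~R - (- 1 - (r%:~R + s%:~R) - x) = x + s%:~R by ring.
have -> : - 1 - s%:~R - (- 1 - (r%:~R + s%:~R) - x + r%:~R) = x by ring.
by ring.
Qed.

(** Comparing leading coefficients in f(-1 - r - X) = -f(X) gives (-1)^(deg f) = -1: the degree is
    odd, so the size is even. *)
Lemma dplus_odd_size r f : dplus r f -> f != 0 -> ~~ odd (size f).
Proof.
move=> df f0; have E : f \Po ((- 1 - r%:~R)%:P - 'X) = - f.
  apply: poly_horner_ext => x.
  by rewrite !(hornerE, horner_comp) (dplus_horner _ df).
have sz : size ((- 1 - r%:~R)%:P - 'X : {poly K}) = 2.
  by rewrite -size_polyN opprB size_XsubC.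
have lc : lead_coef ((- 1 - r%:~R)%:P - 'X : {poly K}) = -1.
  by rewrite -[_ - _]opprB lead_coefN lead_coefXsubC.
have := congr1 lead_coef E; rewrite lead_coef_comp ?sz // lc lead_coefN => /eqP.
rewrite -signr_odd -[X in _ == - X]mulr1 -mulrN; case: (boolP (odd (size f))) => //.
rewrite -(prednK (n := size f)) ?size_poly_gt0 //= => /negPf ->.
rewrite expr0 (inj_eq (mulfI _)) ?lead_coef_eq0 //.
by rewrite -subr_eq0 opprK paddr_eq0 ?ler01 // oner_eq0.
Qed.

(** The leading term of an element of odd degree m is removed by a multiple of [p m], and the
    remainder stays in the space. It serves both for the [Wpoly] and for the odd powers of D +
    1/2. *)
Lemma dplus_span r (p : nat -> {poly K}) (P : {poly K} -> Prop) :
  (forall m, odd m -> dplus r (p m) /\ size (p m) = m.+1) ->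
  P 0 -> (forall c f g, dplus r f -> dplus r g -> P f -> P g -> P (c *: f + g)) ->
  (forall m, odd m -> P (p m)) -> forall f, dplus r f -> P f.
Proof.
move=> hp P0 Pl Pp f; move: {2}(size f) (leqnn (size f)) => N.
elim: N f => [|N IH] f fN df; first by move: fN; rewrite leqn0 size_poly_eq0 => /eqP ->.
have [->//|f0] := eqVneq f 0.
have fo := dplus_odd_size df f0; have sf : (0 < size f)%N by rewrite size_poly_gt0.
pose m := (size f).-1.
have fm : size f = m.+1 by rewrite prednK.
have om : odd m by move: fo; rewrite fm /= negbK.
have [dpm spm] := hp _ om.
have lp : lead_coef (p m) != 0 by rewrite lead_coef_eq0 -size_poly_gt0 spm.
pose c := lead_coef f / lead_coef (p m); pose g := f - c *: p m.
have fE : f = c *: p m + g by rewrite addrC subrK.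
have dg : dplus r g.
  by rewrite (_ : g = (- c) *: p m + f); [exact: dplus_comb|rewrite scaleNr addrC].
rewrite fE; apply: Pl => //; first exact: Pp.
apply: IH => //; rewrite -ltnS; apply: leq_trans fN; rewrite fm ltnS.
apply/leq_sizeP => i; rewrite leq_eqVlt => /orP[/eqP <-|mi].
  rewrite coefB coefZ /c -[f`_m]/(f`_(size f).-1) -lead_coefE.
  by rewrite [(p m)`_m](_ : _ = lead_coef (p m)) ?mulfVK ?subrr // lead_coefE spm.
by rewrite coefB coefZ !nth_default ?mulr0 ?subrr ?fm ?spm.
Qed.

Lemma Wpoly_horner m k x : (Wpoly K m k).[x] =
  - (1 / 2) * (\prod_(i < m) (x - i%:R)
    + (-1) ^+ m.+1 * \prod_(i < m) (x + (k + i.+1%:Z)%:~R)).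
Proof.
rewrite /Wpoly !hornerE !horner_prod; congr (_ * (_ + _ * _)).
  by apply: eq_bigr => i _; rewrite !hornerE.
by apply: eq_bigr => i _; rewrite !hornerE.
Qed.

Lemma Wpoly_dplus m k : odd m -> dplus k (Wpoly K m k).
Proof.
move=> om; apply: dplusP => x; rewrite !Wpoly_horner -signr_odd /= om /= expr0 !mul1r.
have sgn (G : 'I_m -> K) : \prod_i (- G i) = - \prod_i G i.
  by rewrite prodrN cardE size_enum_ord -signr_odd om expr1 mulN1r.
have -> : \prod_(i < m) (-1 - k%:~R - x - i%:R) =
    - \prod_(i < m) (x + (k + i.+1%:Z)%:~R) :> K.
  by rewrite -sgn; apply: eq_bigr => i _; rewrite rmorphD /= -pmulrn -natr1; ring.
have -> : \prod_(i < m) (-1 - k%:~R - x + (k + i.+1%:Z)%:~R) =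
    - \prod_(i < m) (x - i%:R) :> K.
  by rewrite -sgn; apply: eq_bigr => i _; rewrite rmorphD /= -pmulrn -natr1; ring.
by ring.
Qed.

Lemma Wpoly_size m k : odd m -> size (Wpoly K m k) = m.+1.
Proof.
move=> om; rewrite /Wpoly size_scale ?oppr_eq0 ?mulf_neq0 ?oner_eq0 ?invr_eq0 ?pnatr_eq0 //.
rewrite -signr_odd /= om /= expr0 scale1r.
set p1 := \prod_(i < m) _; set p2 := \prod_(i < m) _.
have m1 : p1 \is monic by apply: rpred_prod => i _; exact: monicXsubC.
have s1 : size p1 = m.+1 by rewrite size_prod_XsubC /index_enum -enumT size_enum_ord.
have p2E : p2 = \prod_(i < m) ('X - (- (k + i.+1%:Z)%:~R)%:P).
  by apply: eq_bigr => i _; rewrite polyCN opprK.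
have m2 : p2 \is monic by rewrite p2E; apply: rpred_prod => i _; exact: monicXsubC.
have s2 : size p2 = m.+1.
  by rewrite p2E size_prod_XsubC /index_enum -enumT size_enum_ord.
apply/eqP; rewrite eqn_leq (leq_trans (size_polyD _ _)) ?s1 ?s2 ?maxnn //=.
rewrite ltnNge; apply/negP => /leq_sizeP/(_ m (leqnn m))/eqP; rewrite coefD.
have -> : p1`_m = 1 by move/monicP: m1; rewrite lead_coefE s1.
have -> : p2`_m = 1 by move/monicP: m2; rewrite lead_coefE s2.
by rewrite (_ : 1 + 1 = 2%:R) // pnatr_eq0.
Qed.

Lemma Wpoly_span k (P : {poly K} -> Prop) :
  P 0 -> (forall c f g, dplus k f -> dplus k g -> P f -> P g -> P (c *: f + g)) ->
  (forall m, odd m -> P (Wpoly K m k)) -> forall f, dplus k f -> P f.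
Proof.
apply: dplus_span => m om; split; [exact: Wpoly_dplus|exact: Wpoly_size].
Qed.

(* [W^1_{-1} = - d/dt]. *)
Lemma Wpoly_translation m k :
  dbracket (-1) k (Wpoly K 1 (-1)) (Wpoly K m k) =
  - (m%:Z + k)%:~R *: Wpoly K m (k - 1).
Proof.
apply: poly_horner_ext => x; have w1 := Wpoly_horner 1 (-1); have w2 := Wpoly_horner m k.
have w3 := Wpoly_horner m (k - 1).
move: (Wpoly K 1 (-1)) (Wpoly K m k) (Wpoly K m (k - 1)) w1 w2 w3 => f g h w1 w2 w3.
rewrite /dbracket !(hornerE, horner_comp) !w1 !w2 !w3 !big_ord1 /=.
pose pa (y : K) := \prod_(i < m) (y - i%:R).
pose pb (l : int) (y : K) := \prod_(i < m) (y + (l + i.+1%:Z)%:~R).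
rewrite -!/(pa _) -!/(pb _ _).
(* Shifting a product of consecutive factors changes only its end factors: [Ea] records this for the
   falling product, [Eb1] and [Eb2] for the rising one. *)
have Ea : x * pa (x - 1) = pa x * (x - m%:R).
  transitivity (\prod_(i < m.+1) (x - i%:R)); last by rewrite big_ord_recr.
  rewrite big_ord_recl subr0.
  by congr (_ * _); apply: eq_bigr => i _; rewrite /= /bump /= natrD; ring.
have Eb1 : pb k (x - 1) = pb (k - 1) x.
  by apply: eq_bigr => i _; rewrite !rmorphD rmorphN /=; ring.
have Eb2 : pb k x * (x + k%:~R) = pb (k - 1) x * (x + k%:~R + m%:R).
  have E : \prod_(i < m.+1) (x + (k - 1 + i.+1%:Z)%:~R) = (x + k%:~R) * pb k x.
    rewrite big_ord_recl; congr (_ * _); first by rewrite subrK.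
    apply: eq_bigr => i _; congr (_ + _%:~R); rewrite /= /bump /=; lia.
  rewrite mulrC -E big_ord_recr; congr (_ * _).
  by rewrite (_ : k - 1 + _ = k + m%:Z) ?rmorphD ?addrA //=; lia.
set e := (-1) ^+ m.+1.
rewrite !rmorphD !rmorphN /= Eb1.
rewrite (_ : 1%:~R = 1) // -pmulrn.
transitivity (1 / 2 * ((x + k%:~R) * pa x - x * pa (x - 1) +
    e * (pb k x * (x + k%:~R) - x * pb (k - 1) x))); first by field.
by rewrite Ea Eb2; field.
Qed.

End DPlusPolynomials.

Section DPlusFock.
Variables (K : numFieldType) (n : nat).
Local Notation F := (fock K ('I_n * nat)%type).
Local Notation vac := (fvac K ('I_n * nat)%type).
Implicit Types (u v : F) (i j : 'I_n) (a b e p q r s k : int) (f g : {poly K}).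

(* t^k f(D) acts on each fermion field by [psi i e |-> f(e) psi i (e + k)]. *)
Definition dop k f u : F :=
  - (1 / 2) *: \sum_i Qop i i (k - 1) (fun a => f.[(- 1 - a)%:~R]) u.
Arguments dop : simpl never.

Lemma dop_fderiv k f : dplus k f -> fderiv (dop k f) k (fun e => (f.[e%:~R])%:M).
Proof.
move=> df; split.
- by apply: lin_scale; apply: lin_bigsum => i; apply: Qop_linear.
- move=> j e u; rewrite /dop (linZ (psi_linear _ _)) (lin_sum (psi_linear _ _)).
  transitivity (- (1 / 2) *: (\sum_i psi j e (Qop i i (k - 1) (fun a => f.[(-1 - a)%:~R]) u) +
     - (2%:R * f.[e%:~R]) *: psi j (e + k) u)).
    congr (_ *: _); rewrite [X in _ = _ + X](_ : _ =
       \sum_i (i == j)%:R *: (- (2%:R * f.[e%:~R]) *: psi i (e + k) u)); last first.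
      rewrite (bigD1 j) //= eqxx scale1r big1 ?addr0 // => i /negPf ->.
      by rewrite scale0r.
    rewrite -big_split; apply: eq_bigr => i _ /=; rewrite Qop_psi -addrA; congr (_ + _).
    rewrite (_ : k - 1 + 1 + e = e + k); last by ring.
    rewrite -scalerBl scalerA; congr (_ *: _).
    (* The contractions with the two factors contribute f(-1 - k - e) and -f(e). They coincide
       because f is odd about -(k+1)/2, and the total -2 f(e) explains the prefactor -1/2 of
       [dop]. *)
    have -> : -1 - (e + k) = -1 - k - e :> int by ring.
    have -> : (-1 - k - e)%:~R = -1 - k%:~R - e%:~R :> K by rewrite !rmorphD !rmorphN.
    rewrite (dplus_horner _ df) (_ : -1 - (-1 - e) = e); last by ring.
    by ring.
  rewrite scalerDr scalerA; congr (_ + _).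
  rewrite (bigD1 j) //= big1 ?addr0 => [|i /negPf ij].
    by rewrite mxE eqxx; congr (_ *: _); rewrite mulr1n; field.
  by rewrite mxE ij mulr0n scale0r.
- move=> k0 u; rewrite /dop fockZ fock_sum big1 ?mulr0 // => i _.
  by rewrite Qop_coef_vac //; lia.
move=> k0; rewrite /dop big1 ?scaler0 // => i _.
by rewrite Qop_vac0 //; lia.
Qed.

Lemma dop_linear k f : dplus k f -> linear (dop k f).
Proof. by case/dop_fderiv. Qed.

Lemma dop_psi k f j e u : dplus k f ->
  dop k f (psi j e u) = psi j e (dop k f u) + f.[e%:~R] *: psi j (e + k) u.
Proof.
case/dop_fderiv=> _ -> _ _; congr (_ + _).
rewrite (bigD1 j) //= big1 ?addr0 => [|i /negPf ij].
  by rewrite mxE eqxx mulr1n.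
by rewrite mxE ij mulr0n scale0r.
Qed.

Lemma dop_linear_l k c f g u : dop k (c *: f + g) u = c *: dop k f u + dop k g u.
Proof.
rewrite /dop !scaler_sumr -big_split; apply: eq_bigr => i _ /=.
rewrite scalerA [c * _]mulrC -scalerA -scalerDr; congr (_ *: _).
rewrite -Qop_scale -Qop_add; congr (Qop _ _ _ _ _); apply/funext => a.
by rewrite !hornerE.
Qed.

(** This coefficient is the origin of the central charge: each of the n fermions contributes 1/2, so
    n = 2l gives l. *)
Lemma dop_coef r s f g : dplus r f -> dplus s g ->
  dop r f (dop s g vac) fset0 =
  if (0 < r) && (r + s == 0) then n%:R / 2 * dcocycle_pos `|r|%N f g else 0.
Proof.
move=> df dg; have [Xl _ X1 _] := dop_fderiv df; have [_ _ _ Y0] := dop_fderiv dg.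
case: (ltP 0 r) => [r0|r0]; last exact: X1.
case: (leP 0 s) => [s0|s0].
  rewrite (Y0 s0) (lin0 Xl) fock0 [_ && _]/=; case: eqP => //; lia.
have [t sE] : exists t : nat, s = - t%:Z by exists `|s|%N; lia.
subst s; rewrite [_ && _]/= (_ : (r - t%:Z == 0) = (r == t%:Z)); last by lia.
rewrite {2}/dop (linZ Xl) fockZ (lin_sum Xl) fock_sum.
rewrite (eq_bigr (fun=> (r == t%:Z)%:R *
    \sum_(a < t) g.[(- 1 + a.+1%:Z)%:~R] * f.[- a.+1%:R])); last first.
  move=> i _; rewrite (fderiv_Qop_vac_coef _ _ _ _ (dop_fderiv df) r0).
  congr (_ * _); apply: eq_bigr => a _; rewrite mxE eqxx mulr1n opprK.
  by rewrite rmorphN.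
rewrite sumr_const card_ord; case: eqP => [->|_]; last by rewrite mul0r mul0rn mulr0.
rewrite [true%:R * _]mul1r -mulr_natr absz_nat /dcocycle_pos.
transitivity (n%:R / 2 * - \sum_(a < t) g.[(-1 + a.+1%:Z)%:~R] * f.[- a.+1%:R]).
  by field.
rewrite -sumrN; congr (_ * _); first by rewrite mul1r.
apply: eq_bigr => a _.
have -> : t%:R - a.+1%:R = - 1 - (- t%:Z)%:~R - (-1 + a.+1%:Z)%:~R :> K.
  by rewrite rmorphD !rmorphN /= -!pmulrn; ring.
by rewrite (dplus_horner _ dg); ring.
Qed.

Lemma dop_bracket r s f g u : dplus r f -> dplus s g ->
  dop r f (dop s g u) - dop s g (dop r f u) =
  dop (r + s) (dbracket r s f g) u + (dcocycle r s f g * (n%:R / 2)) *: u.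
Proof.
move=> df dg.
have hb : fderiv (dop (r + s) (dbracket r s f g)) (r + s)
    (fun e => (f.[(e + s)%:~R])%:M *m (g.[e%:~R])%:M -
              (g.[(e + r)%:~R])%:M *m (f.[e%:~R])%:M : 'M[K]_n).
  have := dop_fderiv (dplus_dbracket df dg); congr fderiv; apply/funext => e.
  rewrite -!scalar_mxM -rmorphB /=; congr (_%:M).
  by rewrite /dbracket !(hornerE, horner_comp) !rmorphD [f.[e%:~R] * _]mulrC.
rewrite (fderiv_comm u (dop_fderiv df) (dop_fderiv dg) hb); congr (_ + _ *: _).
rewrite !dop_coef // /dcocycle [s + r]addrC.
have [rs|] := eqVneq (r + s) 0; last by rewrite !andbF subrr mul0r.
rewrite !andbT [~~ _]/=.
case: r rs {df hb} => [[|r]|r] rs.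
- by rewrite (_ : s = 0) ?ltxx ?subrr ?/dcocycle_pos ?big_ord0 ?mul0r //; lia.
- rewrite (_ : 0 < s = false); last by lia.
  by rewrite subr0 mulrC.
rewrite (_ : 0 < s); last by lia.
rewrite sub0r (_ : `|s|%N = r.+1) ?mulrN ?mulNr 1?mulrC //; lia.
Qed.

End DPlusFock.
Arguments dop : simpl never.

(** * Irreducibility of the even Fock space under the currents *)

Section DoubleSums.
Local Open Scope fset_scope.
Local Open Scope ring_scope.
Variables (K : numFieldType) (V : lmodType K).
Implicit Types (f g : int -> int -> V).

Definition zboxed f := exists B : nat,
  forall r t : int, (B%:Z < `|r|) || (B%:Z < `|t|) -> f r t = 0.

Definition zsum2 f := zsum (fun r => zsum (f r)).

Lemma zboxed_row f r : zboxed f -> zfinite (f r).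
Proof.
move=> [B hB]; apply: (@zfiniteP _ _ _ (- B%:Z) (B%:Z + 1)) => t ht;
  apply: hB; lia.
Qed.

Lemma zboxed_sum f : zboxed f -> zfinite (fun r => zsum (f r)).
Proof.
move=> [B hB]; apply: (@zfiniteP _ _ _ (- B%:Z) (B%:Z + 1)) => r hr;
  apply: zsum0 => t; apply: hB; lia.
Qed.

Lemma zsum2_swap f : zboxed f -> zsum2 f = zsum2 (fun t r => f r t).
Proof.
move=> [B hB]; pose w := (- B%:Z, (B + B).+1).
have bw (a : int) : a < w.1 \/ w.1 + w.2%:Z <= a -> B%:Z < `|a| by rewrite /w /=; lia.
rewrite /zsum2 !(@zsumE _ _ w); first last.
- by move=> r /bw hr; apply: zsum0 => t; apply: hB; rewrite hr.
- by move=> t /bw ht; apply: zsum0 => r; apply: hB; rewrite ht orbT.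
transitivity (zwindow w (fun r => zwindow w (f r))).
  by apply: eq_bigr => i _; apply: zsumE => t /bw ht; apply: hB; rewrite ht orbT.
rewrite /zwindow exchange_big; apply: eq_bigr => i _ /=.
by rewrite (@zsumE _ _ w (f^~ (w.1 + i%:Z))) // => r /bw hr; apply: hB; rewrite hr.
Qed.

Lemma zboxed_bigsum (I : Type) (s : seq I) (f : I -> int -> int -> V) :
  (forall i, zboxed (f i)) -> zboxed (fun r t => \sum_(i <- s) f i r t).
Proof.
move=> fb; elim: s => [|i s [B hB]]; first by exists 0%N => r t _; rewrite big_nil.
have [B' hB'] := fb i; exists (B + B')%N => r t h.
by rewrite big_cons hB ?hB' ?addr0 //; lia.
Qed.

Lemma zsum2_sum (I : Type) (s : seq I) (f : I -> int -> int -> V) :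
  (forall i, zboxed (f i)) ->
  zsum2 (fun r t => \sum_(i <- s) f i r t) = \sum_(i <- s) zsum2 (f i).
Proof.
move=> fb; rewrite /zsum2 -zsum_sum => [|i]; last exact: zboxed_sum.
by apply: eq_zsum => r; rewrite zsum_sum // => i; apply: zboxed_row.
Qed.

Lemma zsum2D f g : zboxed f -> zboxed g ->
  zsum2 (fun r t => f r t + g r t) = zsum2 f + zsum2 g.
Proof.
move=> fb gb; rewrite /zsum2 -zsumD; try exact: zboxed_sum.
by apply: eq_zsum => r; rewrite zsumD //; apply: zboxed_row.
Qed.

Lemma int_const (h : int -> V) : (forall x, h (x + 1) = h x) -> forall x y, h x = h y.
Proof.
move=> hS; suff h0 x : h x = h 0 by move=> x y; rewrite !h0.
elim/int_rec: x => // m IH; rewrite -IH.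
  by rewrite -(hS m%:Z); congr h; lia.
by rewrite (_ : - m%:Z = - m.+1%:Z + 1) ?hS //; lia.
Qed.

End DoubleSums.

Section SpinModule.
Local Open Scope fset_scope.
Local Open Scope ring_scope.
Variables (K : numFieldType) (n : nat).
Local Notation F := (fock K ('I_n * nat)%type).
Implicit Types (u v : F) (i j k : 'I_n) (a b e p q r s t : int).

Lemma psi_psi_same j a v : psi j a (psi j a v) = 0.
Proof.
have E : psi j a (psi j a v) = - psi j a (psi j a v).
  by rewrite -psi_anti //; apply/andP => -[_]; lia.
apply/eqP; have /eqP := E; rewrite -subr_eq0 opprK -mulr2n -scaler_nat scaler_eq0.
by rewrite pnatr_eq0.
Qed.

(* Two orderings of \sum_p psi j p psi j (m - p), which is formally zero. *)
Lemma psi_pair_sum j r t v (L : nat) :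
  (forall s, L%:Z <= s -> psi j (s - t) v = 0 /\ psi j (s - 1 - r) v = 0) ->
  \sum_(s < L) psi j (- s%:Z - 2 - r) (psi j (s%:Z - t) v)
  - \sum_(s < L) psi j (- s%:Z - 1 - t) (psi j (s%:Z - 1 - r) v) =
  ((r + t == -1)%:R * - (r + 1)%:~R) *: v.
Proof.
move=> vL; pose m := - 2 - r - t; pose g p := psi j p (psi j (m - p) v).
pose c p x := if p <= x then g p else 0.
have [N hN] := psi_cutoff v.
have cf x : zfinite (c^~ x).
  apply: (@zfiniteP _ _ _ (m - N%:Z) (x + 1)) => p hp; rewrite /c.
    by case: ifP => // _; rewrite /g [psi j (m - p) v]hN ?psi0 //; lia.
  by rewrite (_ : p <= x = false) //; lia.
(* The divergent sum over p is truncated at p <= x; large negative p contribute nothing because psi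
   j (m - p) kills [v]. Both orderings turn out to be values of [G]. *)
pose G x := zsum (c^~ x).
have GS x : G (x + 1) = G x + g (x + 1).
  have s1 p : p != x + 1 -> (if p == x + 1 then g p else 0) = 0 by move/negPf ->.
  have -> : g (x + 1) = zsum (fun p => if p == x + 1 then g p else 0).
    by rewrite (zsum_single s1) eqxx.
  rewrite /G -zsumD //; last exact: zfinite_single s1.
  apply: eq_zsum => p; rewrite /c; case: eqP => [->|px].
    by rewrite lexx (_ : x + 1 <= x = false) ?add0r //; lia.
  by rewrite addr0 (_ : (p <= x + 1) = (p <= x)) //; lia.
pose d : K := (r + t == -1)%:R.
have gg x : g x + g (m - x) = d *: v.
  rewrite /g (psi_car j x) (_ : m - (m - x) = x); last by ring.
  rewrite subrK /= eqxx /= (_ : (x + (m - x) == -1) = (r + t == -1)) // /m; lia.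
(* By [gg], [h] does not change under x -> x + 1, so one zero suffices. It is found at the centre of
   p -> m - p: for m = 2y + 1 the two truncations agree at y, for m = 2y they differ by the square
   of a fermion mode. *)
pose h x := G x - G (m - 1 - x) - (d * (x + 1)%:~R) *: v.
have hS x : h (x + 1) = h x.
  rewrite /h GS (_ : G (m - 1 - x) = G (m - 1 - (x + 1)) + g (m - (x + 1))); last first.
    by rewrite (_ : m - 1 - x = m - 1 - (x + 1) + 1) ?GS; [congr (_ + g _)|]; ring.
  have := gg (x + 1); move: (g (x + 1)) (g (m - (x + 1))) => A A' /(canRL (addrK _)) ->.
  rewrite [(x + 1 + 1)%:~R]rmorphD /= mulrDr mulr1 scalerDl.
  move: (G x) (G (m - 1 - (x + 1))) (_ *: v) (d *: v) => X Y P Q.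
  by apply: fockP => S; rewrite !(fockD, fockN); ring.
have h0 : exists x, h x = 0.
  have [[y my]|[y my]] : (exists y, m = 2 * y + 1) \/ (exists y, m = 2 * y).
  - by have := divz_eq m 2; have := modz_ge0 m (d := 2) isT; have := ltz_mod m (d := 2) isT;
      case: (m %% 2)%Z => // -[|[|//]] _ _ E; [right|left]; exists (m %/ 2)%Z; lia.
  - exists y; rewrite /h (_ : m - 1 - y = y); last by rewrite my; ring.
    rewrite subrr sub0r /d; case: eqP => [rt|_]; last by rewrite mul0r scale0r oppr0.
    by rewrite (_ : y + 1 = 0) ?mulr0 ?scale0r ?oppr0 //; move: my; rewrite /m; lia.
  exists y; rewrite /h (_ : m - 1 - y = y - 1); last by rewrite my; ring.
  have -> : G y = G (y - 1) + g y by rewrite -{1}[y](subrK 1) GS subrK.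
  rewrite [X in X - _]addrAC subrr add0r.
  rewrite /g (_ : m - y = y) ?psi_psi_same; last by rewrite my; ring.
  by rewrite /d (_ : r + t == -1 = false) ?mul0r ?scale0r ?subr0 //; move: my; rewrite /m; lia.
have [x0 hx0] := h0; have hx : h (- 2 - r) = 0 by rewrite -hx0; apply: int_const.
have E1 : \sum_(s < L) psi j (- s%:Z - 2 - r) (psi j (s%:Z - t) v) = G (- 2 - r).
  rewrite /G (@zsumE _ _ (- 1 - r - L%:Z, L)) => [|p /= hp]; last first.
    rewrite /c; case: ifP => // pr; rewrite /g.
    have /vL[H _] : L%:Z <= m - p + t by rewrite /m; lia.
    by rewrite addrK in H; rewrite H psi0.
  rewrite /zwindow /= big_nat_rev /= big_mkord; apply: eq_bigr => s _.
  have sL := ltn_ord s; rewrite /c ifT; last by lia.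
  by rewrite /g /m; congr (psi _ _ (psi _ _ _)); lia.
have E2 : \sum_(s < L) psi j (- s%:Z - 1 - t) (psi j (s%:Z - 1 - r) v) = G (- 1 - t).
  rewrite /G (@zsumE _ _ (- t - L%:Z, L)) => [|p /= hp]; last first.
    rewrite /c; case: ifP => // pr; rewrite /g.
    have /vL[_ H] : L%:Z <= m - p + 1 + r by rewrite /m; lia.
    by rewrite (_ : _ - 1 - r = m - p) in H; [rewrite H psi0|ring].
  rewrite /zwindow /= big_nat_rev /= big_mkord; apply: eq_bigr => s _.
  have sL := ltn_ord s; rewrite /c ifT; last by lia.
  by rewrite /g /m; congr (psi _ _ (psi _ _ _)); lia.
rewrite E1 E2; have /eqP := hx; rewrite /h subr_eq0 => /eqP.
rewrite (_ : m - 1 - (- 2 - r) = - 1 - t); last by rewrite /m; ring.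
move=> ->; rewrite /d; congr (_ * _ *: _).
by rewrite -rmorphN /=; congr (_%:~R); ring.
Qed.

Lemma Qop_one i j b u : i != j ->
  Qop i j b (fun=> 1) u = zsum (fun r => psi i r (psi j (b - r) u)).
Proof. by move=> ij; apply: eq_zsum => r; rewrite scale1r nord_neq. Qed.

Lemma Qop_one_refl i j b u : i != j ->
  Qop i j b (fun=> 1) u = zsum (fun t => psi i (b - t) (psi j t u)).
Proof.
move=> ij; rewrite Qop_one // -(zsum_refl b).
  by apply: eq_zsum => t; rewrite opprB addrCA subrr addr0.
apply: eq_zfinite (nord_finite i j b (fun=> 1) u) => r.
by rewrite scale1r nord_neq.
Qed.

Lemma Qop_one_finite i j b u : i != j ->
  zfinite (fun t => psi i (b - t) (psi j t u)).
Proof.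
move=> ij; apply: eq_zfinite (zfinite_refl b (nord_finite i j b (fun=> 1) u)) => r.
by rewrite scale1r nord_neq // opprB addrCA subrr addr0.
Qed.

Lemma psi_anti_neq i j a b u : i != j -> psi i a (psi j b u) = - psi j b (psi i a u).
Proof. by move=> /negPf ij; rewrite psi_anti // ij. Qed.

Lemma psi_psi_linear i j a b : linear (fun u => psi i a (psi j b u)).
Proof. exact: lin_comp (psi_linear _ _) (psi_linear _ _). Qed.

(* The normally ordered product of the currents [ij] and [jk]: its quartic part
   vanishes, because the j-th fermion field has normally ordered square 0. *)
Lemma current_product i j k u : i != j -> j != k -> i != k -> exists L : nat,
  Qop i k (-1) (fun r => - (r + 1)%:~R) u =
  \sum_(s < L) Qop i j (- s%:Z - 2) (fun=> 1) (Qop j k s%:Z (fun=> 1) u) +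
  \sum_(s < L) Qop j k (- s%:Z - 1) (fun=> 1) (Qop i j (s%:Z - 1) (fun=> 1) u).
Proof.
move=> ij jk ik; have [N hN] := psi_cutoff u; exists (N + N)%N.
have ji : j != i by rewrite eq_sym.
have kj : k != j by rewrite eq_sym.
(* [A s] and [B s] expand the two kinds of products of currents over the modes r of psi_i and t of
   psi_k, with the two psi_j brought side by side. For fixed r and t the sum over s is
   [psi_pair_sum], which leaves only r + t = -1. For r, t < N, the bound N + N on s makes all
   omitted terms vanish. *)
pose A (s : nat) r t :=
  psi i r (psi j (- s%:Z - 2 - r) (psi j (s%:Z - t) (psi k t u))).
pose B (s : nat) r t :=
  - psi i r (psi j (- s%:Z - 1 - t) (psi j (s%:Z - 1 - r) (psi k t u))).
have ppp0 r a b t : N%:Z <= r -> psi i r (psi j a (psi j b (psi k t u))) = 0.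
  move=> hr; do 3!(rewrite [psi i r _]psi_anti_neq // ?(linN (psi_linear _ _))).
  by rewrite hN // !psi0 !oppr0.
have jk0 b t : N%:Z <= b -> psi j b (psi k t u) = 0.
  by move=> hb; rewrite psi_anti_neq // hN // psi0 oppr0.
have jjk0 a b t : N%:Z <= a -> a + b != -1 -> psi j a (psi j b (psi k t u)) = 0.
  move=> ha ab; rewrite psi_anti ?(negPf ab) ?andbF //.
  by rewrite jk0 // psi0 oppr0.
have bA (s : nat) : zboxed (A s).
  exists (N + N + s + 5)%N => r t hrt; rewrite /A.
  have [hr|hr] := leP N%:Z r; first exact: ppp0.
  have [ht|ht] := leP N%:Z t; first by rewrite hN // !psi0.
  have [st|st] := leP N%:Z (s%:Z - t); first by rewrite jk0 // !psi0.
  by rewrite jjk0 ?psi0 //; lia.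
have bB (s : nat) : zboxed (B s).
  exists (N + N + s + 5)%N => r t hrt; rewrite /B.
  have [hr|hr] := leP N%:Z r; first by rewrite ppp0 // oppr0.
  have [ht|ht] := leP N%:Z t; first by rewrite hN // !psi0 oppr0.
  have [st|st] := leP N%:Z (s%:Z - 1 - r); first by rewrite jk0 // !psi0 oppr0.
  by rewrite jjk0 ?psi0 ?oppr0 //; lia.
transitivity (zsum2 (fun r t => \sum_(s < N + N) A s r t + \sum_(s < N + N) B s r t)).
  rewrite /Qop /zsum2; apply: eq_zsum => r.
  have T t : \sum_(s < N + N) A s r t + \sum_(s < N + N) B s r t =
      ((r + t == -1)%:R * - (r + 1)%:~R) *: psi i r (psi k t u).
    have [hr|hr] := leP N%:Z r.
      rewrite [psi i r (psi k t u)]psi_anti_neq // hN // psi0 oppr0 scaler0.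
      by rewrite !big1 ?addr0 // => s _; rewrite /A /B ppp0 ?oppr0.
    have [ht|ht] := leP N%:Z t.
      by rewrite hN // psi0 scaler0 !big1 ?addr0 // => s _; rewrite /A /B hN ?psi0 ?oppr0.
    rewrite -(linZ (psi_linear i r)) -(@psi_pair_sum j r t _ (N + N)); last first.
      by move=> s hs; rewrite !jk0 //; lia.
    by rewrite (linB (psi_linear _ _)) !(lin_sum (psi_linear _ _)) -sumrN.
  rewrite (zsum_single (a0 := -1 - r)) ?T => [|t rt].
    by rewrite subrKC eqxx mul1r nord_neq.
  rewrite T (_ : r + t == -1 = false) ?mul0r ?scale0r //; lia.
rewrite zsum2D; try exact: zboxed_bigsum.
rewrite !zsum2_sum //; congr (_ + _); apply: eq_bigr => s _.
  rewrite Qop_one // /zsum2; apply: eq_zsum => r.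
  rewrite Qop_one_refl // (zsum_lin (psi_psi_linear _ _ _ _)) //.
  exact: Qop_one_finite.
rewrite zsum2_swap // Qop_one_refl // /zsum2; apply: eq_zsum => t.
rewrite Qop_one // (zsum_lin (psi_psi_linear _ _ _ _)); last first.
  apply: eq_zfinite (nord_finite i j (s%:Z - 1) (fun=> 1) u) => r.
  by rewrite scale1r nord_neq.
apply: eq_zsum => r; rewrite /B.
rewrite (psi_anti_neq _ _ (psi j _ u) (_ : k != i)) 1?eq_sym //.
rewrite (linN (psi_linear _ _)) (psi_anti_neq _ _ _ ji) opprK.
rewrite (psi_anti_neq _ _ u kj) !(linN (psi_linear _ _)).
by rewrite -(linN (psi_linear _ _)).
Qed.

(** Contracting the middle index multiplies the coefficient functions. Together with the linear
    coefficient supplied by [current_product], commutators therefore reach every polynomial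
    coefficient. *)
Lemma Qop_Qop i j k b (c d : int -> K) u : i != j -> j != k -> i != k ->
  Qop i j (-1) c (Qop j k b d u) - Qop j k b d (Qop i j (-1) c u) =
  Qop i k b (fun a => c a * d a) u.
Proof.
move=> ij jk ik; rewrite {2}/Qop (zsum_lin (Qop_linear _ _ _ _)); last exact: nord_finite.
rewrite {3}/Qop -zsumB; last exact: nord_finite; last first.
  by apply: zfinite_lin (nord_finite _ _ _ _ _); apply: Qop_linear.
apply: eq_zsum => a; rewrite (linZ (Qop_linear _ _ _ _)) -scalerBr mulrC -scalerA.
congr (_ *: _); rewrite !nord_neq // !Qop_psi eqxx (negPf ij) (negPf jk) (negPf ik).
rewrite !mul0r !scale0r !addr0 !subr0 addrC addKr mul1r.
by rewrite (_ : -1 + 1 + a = a) //; ring.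
Qed.

End SpinModule.

Section SpinIrreducible.
Local Open Scope fset_scope.
Local Open Scope ring_scope.
Variables (K : numFieldType) (n : nat).
Hypothesis n_gt2 : (2 < n)%N.
Local Notation F := (fock K ('I_n * nat)%type).
Local Notation vac := (fvac K ('I_n * nat)%type).
Implicit Types (u v : F) (i j k : 'I_n) (a b e p q r s t : int).

Definition fparity (eps : bool) u : Prop := forall S, u S != 0 -> odd #|` S| = eps.

Lemma fparity_subspace eps : is_subspace (fparity eps).
Proof.
split=> [S|c u v hu hv S]; first by rewrite fock0 eqxx.
rewrite fockD fockZ; have [uS|uS _] := eqVneq (u S) 0; last exact: hu.
by rewrite uS mulr0 add0r; apply: hv.
Qed.

Lemma fparity_psi eps i a u : fparity eps u -> fparity (~~ eps) (psi i a u).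
Proof.
case: a => m hu S; rewrite /psi.
  rewrite annE; case: ifP => [|hS]; first by rewrite eqxx.
  rewrite mulf_eq0 negb_or => /andP[_ /hu].
  by rewrite cardfsU1 hS /= => <-; rewrite negbK.
rewrite creE; case: ifP => [hS|]; last by rewrite eqxx.
rewrite mulf_eq0 negb_or => /andP[_ /hu].
by rewrite [#|` S|](cardfsD1 (i, m)) hS /= => ->.
Qed.

Lemma fparity_vac : fparity false vac.
Proof.
by move=> S; rewrite fketE; have [->|] := eqVneq S fset0; rewrite ?cardfs0 ?eqxx.
Qed.

Lemma fparity_nord eps i a j b u : fparity eps u -> fparity eps (nord i a j b u).
Proof.
move=> hu; have E i1 j1 a1 b1 : fparity eps (psi i1 a1 (psi j1 b1 u)).
  by rewrite -[eps]negbK; do 2!apply: fparity_psi.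
by rewrite /nord; case: ifP => _; [|apply: (subN (fparity_subspace _))]; exact: E.
Qed.

Lemma fparity_Qop eps i j b c u : fparity eps u -> fparity eps (Qop i j b c u).
Proof.
move=> hu; have sp := fparity_subspace eps.
by apply: (zsum_subspace sp) => a; apply: (subZ sp); apply: fparity_nord.
Qed.

Lemma fparity_som eps x p u : fparity eps u -> fparity eps (som x p u).
Proof.
move=> hu; have sp := fparity_subspace eps; apply: (subZ sp).
apply: (sub_sum sp) => i _; apply: (sub_sum sp) => j _; apply: (subZ sp).
exact: fparity_Qop.
Qed.

Lemma so_mx_delta i j : so_mx (delta_mx i j - delta_mx j i : 'M[K]_n).
Proof. by rewrite /so_mx linearB /= !trmx_delta opprB. Qed.

Lemma Qop_one_anti i j b u : Qop j i b (fun=> 1) u = - Qop i j b (fun=> 1) u.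
Proof.
rewrite /Qop -(zsum_refl b); last exact: nord_finite.
rewrite [RHS](zsum_lin (f := -%R)); first last.
- exact: nord_finite.
- exact: lin_opp (@lin_id _ _).
by apply: eq_zsum => a; rewrite !scale1r nord_anti opprB addrCA subrr addr0.
Qed.

Lemma som_delta i j p u :
  som (delta_mx i j - delta_mx j i) p u = Qop i j (p - 1) (fun=> 1) u.
Proof.
have E (i0 j0 : 'I_n) : \sum_k \sum_l (delta_mx i0 j0 : 'M[K]_n) k l *:
    Qop k l (p - 1) (fun=> 1) u = Qop i0 j0 (p - 1) (fun=> 1) u.
  rewrite (bigD1 i0) //= [X in _ + X]big1 ?addr0 => [|k /negPf ki].
    rewrite (bigD1 j0) //= big1 ?addr0 => [|l /negPf lj].
      by rewrite mxE !eqxx scale1r.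
    by rewrite mxE lj andbF scale0r.
  by rewrite big1 // => l _; rewrite mxE ki scale0r.
rewrite /som (eq_bigr (fun k => \sum_l (delta_mx i j : 'M[K]_n) k l *:
    Qop k l (p - 1) (fun=> 1) u - \sum_l (delta_mx j i : 'M[K]_n) k l *:
    Qop k l (p - 1) (fun=> 1) u)) => [|k _]; last first.
  by rewrite -sumrB; apply: eq_bigr => l _; rewrite -scalerBl; congr (_ *: _); rewrite !mxE.
rewrite sumrB !E [Qop j i _ _ _]Qop_one_anti opprK -mulr2n -scaler_nat scalerA.
by rewrite mul1r mulVf ?scale1r // pnatr_eq0.
Qed.

Lemma third_index i j : exists k, (i != k) && (j != k).
Proof.
have /card_gt0P[k] : (0 < #|~: [set i; j]|)%N.
  have := cardsC [set i; j]; rewrite card_ord cards2 => E.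
  by move: E n_gt2; case: (i != j) => /=; lia.
by rewrite !inE negb_or => /andP[ki kj]; exists k; rewrite ![_ == k]eq_sym ki kj.
Qed.

Section Stable.
Local Open Scope fset_scope.
Local Open Scope ring_scope.
Variable P : set F.
Hypothesis P_sub : is_subspace P.
Hypothesis P_stable : forall x p u, so_mx x -> P u -> P (som x p u).

Lemma stable_current i j b u : P u -> P (Qop i j b (fun=> 1) u).
Proof.
move=> Pu; have := P_stable (b + 1) (so_mx_delta i j) Pu.
by rewrite som_delta addrK.
Qed.

Lemma stable_Qop (f : {poly K}) : forall i k b u, i != k -> P u ->
  P (Qop i k b (fun a => f.[a%:~R]) u).
Proof.
have deg1 i k u : i != k -> P u -> P (Qop i k (-1) (fun r => - (r + 1)%:~R) u).
  move=> ik Pu; have [j /andP[ij kj]] := third_index i k.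
  rewrite eq_sym in kj; have [L ->] := current_product u ij kj ik.
  by apply: subD => //; apply: sub_sum => // s _; do 2!apply: stable_current.
elim/poly_ind: f => [|f c IH] i k b u ik Pu.
  rewrite (_ : Qop _ _ _ _ _ = 0); first exact: sub0.
  by apply: zsum0 => a; rewrite horner0 scale0r.
have [j /andP[ij kj]] := third_index i k; have jk : j != k by rewrite eq_sym.
(* The term a f(a) is rewritten through -(a + 1) f(a), the product of f with the coefficient of
   [current_product], so that [Qop_Qop] exhibits it as a commutator of stable operators. *)
have -> : (fun a : int => (f * 'X + c%:P).[a%:~R]) =
   (fun a : int => -1 * (- (a + 1)%:~R * f.[a%:~R]) + (-1 * f.[a%:~R] + c * 1)) :> (int -> K).
  by apply/funext => a; rewrite !hornerE rmorphD /=; ring.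
rewrite Qop_add Qop_add !Qop_scale.
apply: subD => //; last first.
  by apply: subD => //; apply: subZ => //; [exact: IH|exact: stable_current].
apply: subZ => //; rewrite -(Qop_Qop b _ _ u ij jk ik).
apply: subB => //; first by apply: deg1 => //; apply: IH.
by apply: IH => //; apply: deg1.
Qed.

(** Stability holds for every polynomial weighting of the sum over modes, so [zsum_interpolation]
    extracts each single bilinear. *)
Lemma stable_psi_neq i k a b u : i != k -> P u -> P (psi i a (psi k b u)).
Proof.
move=> ik Pu; have := @zsum_interpolation _ _ P
  (fun a' => nord i a' k (a + b - a') u) P_sub.
rewrite (_ : psi _ _ _ = nord i a k (a + b - a) u); last first.
  by rewrite nord_neq // addrAC subrr add0r.
apply=> [|f]; last exact: stable_Qop.
by apply: eq_zfinite (nord_finite i k (a + b) (fun=> 1) u) => a'; rewrite scale1r.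
Qed.

Lemma stable_psi i k a b u : P u -> P (psi i a (psi k b u)).
Proof.
move=> Pu; have [<-|ik] := eqVneq i k; last exact: stable_psi_neq.
have [j /andP[ij _]] := third_index i i; have ji : j != i by rewrite eq_sym.
(* The identity is inserted as the anticommutator of psi j 0 and psi j (-1), for an auxiliary index
   j; the products then group into pairs with distinct indices. *)
have <- : psi i a (psi j 0 (psi j (-1) (psi i b u))) +
          psi i a (psi j (-1) (psi j 0 (psi i b u))) = psi i a (psi i b u).
  rewrite -(linD (psi_linear i a)) (psi_car j 0) eqxx /= scale1r.
  by rewrite subrK.
by apply: subD => //; do 2!apply: stable_psi_neq => //.
Qed.

Lemma stable_even : P vac -> forall u, fparity false u -> P u.
Proof.
move=> Pv u hu; apply: (fock_even_ind P_sub) => // [[i a] [j b] v Pw|S /hu -> //].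
exact: (stable_psi i j (Negz a) (Negz b)).
Qed.

(** Two annihilators taken from a nonempty set in the support keep the vector nonzero and lower the
    maximal number of fermions by 2. Even parity guarantees two modes to remove, and the descent
    ends at a multiple of the vacuum. *)
Lemma stable_vac u : P u -> fparity false u -> u <> 0 -> P vac.
Proof.
have [s hs] := fock_support u.
have : forall S, u S != 0 -> (#|` S| <= \max_(S0 <- s) #|` S0|)%N.
  by move=> S /hs Ss; apply: leq_bigmax_seq.
move: (\max_(S0 <- s) _) => m {s hs}; elim/ltn_ind: m u => m IH u um Pu hu u0.
have [S uS S0] : exists2 S, u S != 0 & forall S', u S' != 0 -> S' != fset0 -> S != fset0.
  have [[S [uS S0]]|no] := pselect (exists S, u S != 0 /\ S != fset0).
    by exists S.
  have [S uS] : exists S, u S != 0.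
    apply: contrapT => nu; apply: u0; apply: fockP => S; rewrite fock0.
    by apply/eqP; apply: contrapT => /negP uS; apply: nu; exists S.
  by exists S => // S' uS' S'0; case: no; exists S'.
have [SE|/fset0Pn[h hS]] := eqVneq S fset0.
  have uE : u = u fset0 *: vac.
    apply: fockP => S'; rewrite fockZ fketE.
    have [->|S'0] := eqVneq S' fset0; first by rewrite mulr1.
    rewrite mulr0; apply/eqP; apply: contraT => uS'.
    by have := S0 _ uS' S'0; rewrite SE eqxx.
  by move: Pu; rewrite uE; apply: subZ_inv => //; rewrite -SE.
have E1 := cardfsD1 h S; rewrite hS /= add1n in E1.
have /fset0Pn[h' h'S] : S `\ h != fset0.
  by rewrite -cardfs_gt0; move: (hu _ uS); rewrite E1 /=; case: #|` _|.
have E2 := cardfsD1 h' (S `\ h); rewrite h'S /= add1n in E2.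
pose u' := psi h'.1 h'.2%:Z (psi h.1 h.2%:Z u).
have u'E S' : u' S' = if h' \in S' then 0 else fsign K h' S' *
   (if h \in h' |` S' then 0 else fsign K h (h' |` S') * u (h |` (h' |` S'))).
  by rewrite /u' /psi annE annE -!surjective_pairing.
apply: (IH (m - 2)%N _ u').
- by have := um _ uS; rewrite E1 E2; lia.
- move=> S'; rewrite u'E; case: ifP => [|h'S']; first by rewrite eqxx.
  case: ifP => [|hS']; first by rewrite mulr0 eqxx.
  rewrite mulrA mulf_eq0 negb_or => /andP[_ /um].
  by rewrite cardfsU1 hS' cardfsU1 h'S' /=; lia.
- exact: stable_psi.
- by apply: (@fparity_psi true); apply: (@fparity_psi false).
move=> /(congr1 (fun v : F => v (S `\ h `\ h'))); rewrite u'E fock0.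
rewrite in_fsetD1 eqxx /= fsetD1K // in_fsetD1 eqxx /= fsetD1K // => /eqP.
by rewrite mulrA mulf_eq0 (negPf uS) orbF mulf_eq0 !signr_eq0.
Qed.

End Stable.
End SpinIrreducible.

(** * The Casimir operator of so(n) modulo raising operators *)

Section Casimir.
Local Open Scope fset_scope.
Local Open Scope ring_scope.
Variables (K : numFieldType) (n : nat).
Local Notation F := (fock K ('I_n * nat)%type).
Implicit Types (u v : F) (i j : 'I_n) (a b m : nat).

Local Notation c i a := (@psi K n i (Negz a)).
Local Notation d i a := (@psi K n i (Posz a)).

Definition so_inv u : Prop := forall i j, Qop i j (-1) (fun=> 1) u = 0.

Lemma so_invP u : so_inv u <-> forall x, so_mx x -> som x 0 u = 0.
Proof.
split=> [hu x _|hu i j].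
  rewrite /som big1 ?scaler0 // => i _; rewrite big1 // => j _.
  by rewrite sub0r hu scaler0.
by have := hu _ (so_mx_delta K i j); rewrite som_delta sub0r.
Qed.

Definition qop (a b : int) u : F := \sum_i nord i a i b u.

Lemma qop_linear (a b : int) : linear (qop a b).
Proof. by apply: lin_bigsum => i; apply: nord_linear. Qed.

Lemma qop_anti (a b : int) u : qop a b u = - qop b a u.
Proof. by rewrite -sumrN; apply: eq_bigr => i _; apply: nord_anti. Qed.

(** In the skew duality between O(n) and so(2N), the [eop] with a, b < N are the generators of
    gl(N), moving a fermion from mode b to mode a; [lap] contracts two annihilators over the
    index. *)
Definition eop a b u : F := \sum_i c i a (d i b u).
Definition lap a b u : F := \sum_i d i a (d i b u).

Lemma eopE a b u : eop a b u = qop (Negz a) b u. Proof. by []. Qed.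

Lemma lapE a b u : lap a b u = qop a b u.
Proof.
apply: eq_bigr => i _; rewrite /nord (_ : a%:Z < 0 = false) // psi_anti //.
by apply/andP => -[_]; lia.
Qed.

Lemma c_lin i a : linear (c i a). Proof. exact: psi_linear. Qed.
Lemma d_lin i a : linear (d i a). Proof. exact: psi_linear. Qed.
Lemma eop_lin a b : linear (eop a b). Proof. by move=> x u v; rewrite !eopE qop_linear. Qed.

Lemma dc i a j b u :
  d i a (c j b u) = ((i == j) && (a == b))%:R *: u - c j b (d i a u).
Proof. by rewrite psi_car (_ : (a%:Z + Negz b == -1) = (a == b)) //; lia. Qed.

Lemma dd i a j b u : d i a (d j b u) = - d j b (d i a u).
Proof. by rewrite psi_anti //; apply/andP => -[_]; lia. Qed.

Lemma cc i a j b u : c i a (c j b u) = - c j b (c i a u).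
Proof. by rewrite psi_anti //; apply/andP => -[_]; lia. Qed.

Lemma eop_c a b i m u : eop a b (c i m u) = c i m (eop a b u) + (b == m)%:R *: c i a u.
Proof.
rewrite /eop (lin_sum (c_lin i m)).
transitivity (\sum_j (c i m (c j a (d j b u)) + (j == i)%:R *: ((b == m)%:R *: c j a u))).
  apply: eq_bigr => j _; rewrite dc (linB (c_lin _ _)) (linZ (c_lin _ _)) addrC cc opprK.
  by rewrite scalerA -natrM mulnb.
rewrite big_split /=; congr (_ + _); rewrite (bigD1 i) //= eqxx scale1r big1 ?addr0 //.
by move=> j /negPf ->; rewrite scale0r.
Qed.

Lemma eop_d a b i m u : eop a b (d i m u) = d i m (eop a b u) - (a == m)%:R *: d i b u.
Proof.
rewrite /eop (lin_sum (d_lin i m)).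
transitivity (\sum_j (d i m (c j a (d j b u)) - (j == i)%:R *: ((a == m)%:R *: d j b u))).
  apply: eq_bigr => j _; rewrite [in RHS]dc dd (linN (c_lin _ _)).
  rewrite addrAC scalerA -natrM mulnb [i == j]eq_sym [m == a]eq_sym subrr sub0r.
  by [].
rewrite sumrB; congr (_ - _); rewrite (bigD1 i) //= eqxx scale1r big1 ?addr0 //.
by move=> j /negPf ->; rewrite scale0r.
Qed.

Lemma eop_eop a b u : a != b -> 
  eop a b (eop b a u) = eop b a (eop a b u) + (eop a a u - eop b b u).
Proof.
move=> ab; rewrite {2}/eop (lin_sum (eop_lin _ _)).
transitivity (\sum_i (c i b (d i a (eop a b u)) + c i a (d i a u) - c i b (d i b u))).
  apply: eq_bigr => i _; rewrite eop_c eop_d !eqxx !scale1r (linB (c_lin _ _)).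
  by rewrite addrAC.
by rewrite sumrB big_split /= addrA.
Qed.

(** Split by the sign of the mode, the generator of so(n) with indices i, j is E_ij - E_ji, where
    E_ij is the sum over a of c_(i,a) d_(j,a). The cutoff of [u] makes the sum finite. *)
Lemma so_inv_eop u N i j : so_inv u ->
  (forall i a, (N <= a)%N -> d i a u = 0) ->
  \sum_(a < N) c i a (d j a u) = \sum_(a < N) c j a (d i a u).
Proof.
move=> /(_ i j) + uN; rewrite /Qop (@zsumE _ _ (- N%:Z, (N + N)%N)) => [|a /= ha]; last first.
  rewrite scale1r /nord; case: a ha => a ha; first by rewrite uN ?psi0 ?oppr0 //; lia.
  by rewrite ?ifT // (_ : -1 - Negz a = a%:Z) ?uN ?psi0 //; lia.
rewrite /zwindow /= (big_cat_nat (n := N)) ?leq_addr //=.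
have sh (G : nat -> F) : \sum_(N <= i < N + N) G i = \sum_(0 <= i < N) G (i + N)%N.
  by rewrite -{1}[N]add0n big_addn addnK.
rewrite sh big_nat_rev /= !big_mkord => /eqP; rewrite addr_eq0 => /eqP E.
transitivity (\sum_(a < N) (1 *: nord i (- N%:Z + (0 + N - a.+1)%N%:Z) j (-1 - (- N%:Z + (0 + N - a.+1)%N%:Z)) u)).
  apply: eq_bigr => a _; have aN := ltn_ord a; rewrite scale1r.
  have -> : - N%:Z + (0 + N - a.+1)%N%:Z = Negz a by lia.
  by have -> : -1 - Negz a = a%:Z by lia.
rewrite E -sumrN; apply: eq_bigr => a _; rewrite scale1r.
rewrite (_ : - N%:Z + (a + N)%N%:Z = a%:Z); last by lia.
have -> : -1 - a%:Z = Negz a by lia.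
by rewrite /nord opprK.
Qed.

Lemma sum4 (I J : finType) (G : I -> I -> J -> J -> F) :
  \sum_i \sum_j \sum_a \sum_b G i j a b = \sum_a \sum_b \sum_i \sum_j G i j a b.
Proof.
have E (i : I) : \sum_j \sum_a \sum_b G i j a b = \sum_a \sum_b \sum_j G i j a b.
  by rewrite exchange_big; apply: eq_bigr => a _; rewrite exchange_big.
under eq_bigr do rewrite E.
by rewrite exchange_big; apply: eq_bigr => a _; rewrite exchange_big.
Qed.

Section Cutoff.
Local Open Scope fset_scope.
Local Open Scope ring_scope.
Variables (N : nat) (u : F).

Definition quart : F := \sum_(i < n) \sum_(j < n) \sum_(a < N) \sum_(b < N)
  c i a (c j b (d j a (d i b u))).
Definition number : F := \sum_(a < N) eop a a u.

Lemma casimir_same : \sum_(i < n) \sum_(j < n) \sum_(a < N) c i a (d j a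
    (\sum_(b < N) c i b (d j b u))) =
  number - \sum_(a < N) \sum_(b < N) \sum_(i < n) c i a (c i b (lap a b u)).
Proof.
pose G i j (a b : 'I_N) := (j == i)%:R *: ((a == b)%:R *: c i a (d j b u)).
transitivity (\sum_(i < n) \sum_(j < n) \sum_(a < N) \sum_(b < N)
    (G i j a b - c i a (c i b (d j a (d j b u))))).
  apply: eq_bigr => i _; apply: eq_bigr => j _; apply: eq_bigr => a _.
  rewrite (lin_sum (psi_psi_linear _ _ _ _)); apply: eq_bigr => b _.
  rewrite dc (linB (c_lin _ _)) (linZ (c_lin _ _)) /G scalerA -natrM mulnb.
  by rewrite (inj_eq val_inj).
rewrite sum4.
transitivity (\sum_(a < N) \sum_(b < N) (\sum_i \sum_j G i j a b -
    \sum_(i < n) c i a (c i b (lap a b u)))).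
  apply: eq_bigr => a _; apply: eq_bigr => b _; rewrite -sumrB; apply: eq_bigr => i _.
  rewrite sumrB; congr (_ - _).
  by rewrite /lap (lin_sum (psi_psi_linear _ _ _ _)).
under eq_bigr do rewrite sumrB.
rewrite sumrB; congr (_ - _).
apply: eq_bigr => a _; rewrite (bigD1 a) //= [X in _ + X]big1 ?addr0 => [|b ba]; last first.
  by rewrite big1 // => i _; rewrite big1 // => j _; rewrite /G [a == b]eq_sym (negPf ba) scale0r scaler0.
apply: eq_bigr => i _; rewrite (bigD1 i) //= [X in _ + X]big1 ?addr0 => [|j ji].
  by rewrite /G !eqxx !scale1r.
by rewrite /G (negPf ji) scale0r.
Qed.

Lemma casimir_swap : \sum_(i < n) \sum_(j < n) \sum_(a < N) c i a (d j a
    (\sum_(b < N) c j b (d i b u))) = n%:R *: number - quart.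
Proof.
transitivity (\sum_(i < n) \sum_(j < n) \sum_(a < N) (c i a (d i a u) -
    \sum_(b < N) c i a (c j b (d j a (d i b u))))).
  apply: eq_bigr => i _; apply: eq_bigr => j _; apply: eq_bigr => a _.
  rewrite (lin_sum (psi_psi_linear _ _ _ _)).
  transitivity (\sum_(b < N) ((a == b)%:R *: c i a (d i b u) -
      c i a (c j b (d j a (d i b u))))).
    apply: eq_bigr => b _; rewrite dc eqxx /= (linB (c_lin _ _)) (linZ (c_lin _ _)).
    by rewrite (inj_eq val_inj).
  rewrite sumrB; congr (_ - _); rewrite (bigD1 a) //= eqxx scale1r big1 ?addr0 // => b ba.
  by rewrite eq_sym (negPf ba) scale0r.
rewrite (eq_bigr (fun i => n%:R *: \sum_(a < N) c i a (d i a u) -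
    \sum_(j < n) \sum_(a < N) \sum_(b < N) c i a (c j b (d j a (d i b u))))) => [|i _].
  by rewrite sumrB -scaler_sumr exchange_big.
under eq_bigr do rewrite sumrB.
rewrite sumrB; congr (_ - _).
by rewrite sumr_const card_ord scaler_nat.
Qed.

Lemma casimir_gl : \sum_(a < N) \sum_(b < N) eop a b (eop b a u) =
  N%:R *: number + quart.
Proof.
transitivity (\sum_(a < N) \sum_(b < N) (eop a a u +
    \sum_(i < n) \sum_(j < n) c i a (c j b (d j a (d i b u))))).
  apply: eq_bigr => a _; apply: eq_bigr => b _.
  rewrite {1}/eop.
  transitivity (\sum_(i < n) (c i a (d i a u) +
      \sum_(j < n) c i a (c j b (d j a (d i b u))))); last by rewrite big_split.
  apply: eq_bigr => i _; rewrite /eop (lin_sum (psi_psi_linear _ _ _ _)).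
  transitivity (\sum_(j < n) ((i == j)%:R *: c i a (d j a u) +
      c i a (c j b (d j a (d i b u))))).
    apply: eq_bigr => j _; rewrite dc eqxx andbT (linB (c_lin _ _)) (linZ (c_lin _ _)).
    by rewrite [d i b (d j a u)]dd !(linN (c_lin _ _)) opprK.
  rewrite big_split /=; congr (_ + _); rewrite (bigD1 i) //= eqxx scale1r big1 ?addr0 //.
  by move=> j ji; rewrite eq_sym (negPf ji) scale0r.
under eq_bigr do rewrite big_split /=.
rewrite big_split /= -sum4.
congr (_ + _); rewrite /number scaler_sumr.
by apply: eq_bigr => a _; rewrite sumr_const card_ord scaler_nat.
Qed.

End Cutoff.

(** Invariance gives E_ij u = E_ji u; applying E_ij and summing equates [casimir_same] with
    [casimir_swap]. Eliminating [quart] by means of [casimir_gl] trades the Casimir element of so(n)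
    for that of gl(N). *)
Lemma casimir_identity N u : so_inv u -> (forall i a, (N <= a)%N -> d i a u = 0) ->
  \sum_(a < N) \sum_(b < N) eop a b (eop b a u) =
  (n%:R + N%:R - 1) *: number N u +
  \sum_(a < N) \sum_(b < N) \sum_(i < n) c i a (c i b (lap a b u)).
Proof.
move=> ui uN; rewrite casimir_gl.
have := casimir_swap N u.
rewrite (eq_bigr (fun i => \sum_(j < n) \sum_(a < N) c i a (d j a
    (\sum_(b < N) c i b (d j b u))))) => [|i _]; last first.
  apply: eq_bigr => j _; apply: eq_bigr => a _.
  by rewrite (so_inv_eop j i ui uN).
rewrite casimir_same => E.
apply: fockP => S; have := congr1 (fun v : F => v S) E.
rewrite !(fockD, fockN, fockZ) => E'.
set A := (\sum_(a < N) _ : F) S in E' *; set B := quart _ _ _ in E' *.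
have -> : B = n%:R * number N u S - (number N u S - A) by rewrite E'; ring.
by ring.
Qed.

End Casimir.

Section CasimirModulo.
Local Open Scope fset_scope.
Local Open Scope ring_scope.
Variables (K : numFieldType) (n : nat).
Local Notation F := (fock K ('I_n * nat)%type).
Local Notation vac := (fvac K ('I_n * nat)%type).
Implicit Types (u v : F) (i j : 'I_n) (a b m : nat) (S : {fset ('I_n * nat)}).

Definition occupation S a : nat := \sum_(i < n) ((i, a) \in S).

Lemma occupation_le S a : (occupation S a <= n)%N.
Proof.
rewrite -[X in (_ <= X)%N](card_ord n) -sum1_card.
by apply: leq_sum => i _; case: (_ \in _).
Qed.

Lemma eop_diag a u S : eop a a u S = (occupation S a)%:R * u S.
Proof.
rewrite /eop fock_sum natr_sum mulr_suml; apply: eq_bigr => i _.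
rewrite /psi creE; case: ifP => hS; last by rewrite mul0r.
by rewrite annE in_fsetD1 eqxx /= fsetD1K // fsignD // ltnn !mul1r mulrA fsign2 mul1r.
Qed.

Definition dfull : {fset ('I_n * nat)} := [fset (i, 0%N) | i in 'I_n].
Definition fdet : F := fket K dfull.

Lemma in_dfull i a : ((i, a) \in dfull) = (a == 0%N).
Proof.
apply/imfsetP/eqP => [[j _ [_ ->]]//|->].
by exists i.
Qed.

Definition cas_eigen N S : K :=
  \sum_(a < N) (occupation S a)%:R * ((occupation S a)%:R - (n + 2 * a)%:R).

(** An occupation number is at most n, so every summand of [cas_eigen] is nonpositive; it vanishes
    only for an empty mode, or for a full mode with a = 0. *)
Lemma cas_eigen_eq0 N S : (forall i a, (i, a) \in S -> (a < N)%N) ->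
  cas_eigen N S = 0 -> S = fset0 \/ S = dfull.
Proof.
move=> SN /eqP; rewrite /cas_eigen -oppr_eq0 -sumrN psumr_eq0 => [|a _]; last first.
  rewrite -mulrN opprB mulr_ge0 ?ler0n // subr_ge0 ler_nat.
  by apply: leq_trans (occupation_le _ _) (leq_addr _ _).
move=> /allP z0.
have occ a : (occupation S a == 0)%N || ((occupation S a == n) && (a == 0))%N.
  have [aN|Na] := ltnP a N; last first.
    rewrite /occupation big1 // => i _; case: (boolP (_ \in _)) => // /SN.
    by rewrite ltnNge Na.
  have := z0 (Ordinal aN); rewrite mem_index_enum => /(_ isT) /=.
  rewrite oppr_eq0 mulf_eq0 pnatr_eq0 subr_eq0 eqr_nat => /orP[->//|/eqP E].
  have := occupation_le S a; rewrite E => H.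
  have a0 : a = 0%N by lia.
  by rewrite a0 muln0 addn0 eqxx orbT.
have occ0 a : occupation S a = 0%N -> forall i, (i, a) \notin S.
  move=> /eqP; rewrite sum_nat_eq0 => /forallP h i.
  by have := h i; case: (_ \in _).
have [o0|o0] := eqVneq (occupation S 0) 0%N; [left|right].
  apply/fsetP => -[i a]; rewrite in_fset0; apply/negbTE/occ0.
  have /orP[/eqP//|/andP[_ /eqP ->]] := occ a; exact: o0.
apply/fsetP => -[i a]; rewrite in_dfull; have [->|a0] := eqVneq a 0%N; last first.
  by apply/negbTE/occ0; have := occ a; rewrite (negPf a0) andbF orbF => /eqP.
have := occ 0%N; rewrite (negPf o0) /= andbT => /eqP on.
apply: contraT => iS; have : (occupation S 0 < n)%N.
  rewrite /occupation (bigD1 i) //= (negPf iS) add0n.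
  apply: leq_ltn_trans (_ : (#|predC1 i| < n)%N).
    by rewrite -sum1_card; apply: leq_sum => j _; case: (_ \in _).
  by rewrite cardC1 card_ord; have := ltn_ord i; lia.
by rewrite on ltnn.
Qed.

Section Modulo.
Local Open Scope fset_scope.
Local Open Scope ring_scope.
Variable P : set F.
Hypothesis P_sub : is_subspace P.
Hypothesis P_qop : forall (a b : int) u, P u -> P (qop a b u).

Lemma P_eop a b u : P u -> P (eop a b u).
Proof. by rewrite eopE; exact: P_qop. Qed.

Definition cas_op N u : F :=
  \sum_(a < N) (eop a a (eop a a u) - (n + 2 * a)%:R *: eop a a u).

Lemma cas_op_diag N u S : cas_op N u S = cas_eigen N S * u S.
Proof.
rewrite /cas_op fock_sum mulr_suml; apply: eq_bigr => a _.
by rewrite fockD fockN fockZ !eop_diag; ring.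
Qed.

Lemma cas_op_stable N u : P u -> P (cas_op N u).
Proof.
move=> Pu; apply: sub_sum => // a _.
have PE v : P v -> P (eop a a v) by exact: P_eop.
by apply: (subB P_sub); [exact: PE (PE _ Pu)|apply: (subZ P_sub); exact: PE].
Qed.

Lemma sum_ltn N a : (\sum_(b < N) (a < b)%N = N - a.+1)%N.
Proof.
by elim: N => [|N IH]; [rewrite big_ord0|rewrite big_ord_recr /= IH; case: ltnP; lia].
Qed.

Lemma sum_gtn N a : (a < N)%N -> (\sum_(b < N) (b < a)%N = a)%N.
Proof.
move=> aN; have H M : (\sum_(b < M) (b < a)%N = minn M a)%N.
  by elim: M => [|M IH]; [rewrite big_ord0 min0n|rewrite big_ord_recr /= IH; case: ltnP; lia].
by rewrite H; lia.
Qed.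

(* The Casimir operator of so(n), which kills [u], is a function of the
   occupation numbers modulo the images of raising operators. *)
Lemma cas_op_mod N u : so_inv u -> (forall i a, (N <= a)%N -> psi i a%:Z u = 0) ->
  (forall a b : int, 0 <= a + b -> P (qop a b u)) -> P (cas_op N u).
Proof.
move=> ui uN Pr.
have E := casimir_identity ui uN.
pose R1 := \sum_(a < N) \sum_(b < N) \sum_(i < n)
  psi i (Negz a) (psi i (Negz b) (lap a b u)).
have PR1 : P R1.
  apply: sub_sum => // a _; apply: sub_sum => // b _.
  have -> : \sum_(i < n) psi i (Negz a) (psi i (Negz b) (lap a b u)) =
      qop (Negz a) (Negz b) (lap a b u) by [].
  by apply: P_qop; rewrite lapE; apply: Pr.
have Pup a b : (a < b)%N -> P (eop a b u).
  by move=> ab; rewrite eopE; apply: Pr; lia.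
pose x a := eop a a u.
(* Each product is reordered so that the factor acting first on [u] moves a fermion to a lower mode;
   its value on [u] lies in [P]. For a < b the exchange costs the difference x a - x b. *)
pose R2 := \sum_(a < N) \sum_(b < N) (eop a b (eop b a u) -
   ((a == b)%:R *: eop a a (x a) + (a < b)%N%:R *: (x a - x b))).
have PR2 : P R2.
  apply: sub_sum => // a _; apply: sub_sum => // b _; rewrite -(inj_eq val_inj).
  case: (ltngtP a b) => [ab|ba|->].
  - rewrite scale0r scale1r add0r eop_eop ?addrK; last by rewrite neq_ltn ab.
    by apply: P_eop; apply: Pup.
  - by rewrite !scale0r addr0 subr0; apply: P_eop; apply: Pup.
  - by rewrite scale1r scale0r addr0 subrr; apply: sub0.
have S1 : \sum_(a < N) \sum_(b < N) (a == b :> 'I_N)%:R *: eop a a (x a) =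
    \sum_(a < N) eop a a (x a).
  apply: eq_bigr => a _; rewrite (bigD1 a) //= eqxx scale1r big1 ?addr0 // => b ba.
  by rewrite eq_sym (negPf ba) scale0r.
(* The index a is below N - 1 - a of the indices and above a of them, so [x a] gets the coefficient
   N - 1 - 2a. Its complement in the factor n + N - 1 of [casimir_identity] is n + 2a. *)
have S2 : \sum_(a < N) \sum_(b < N) (a < b)%N%:R *: (x a - x b) =
    \sum_(a < N) (n%:R + N%:R - 1) *: eop a a u - \sum_(a < N) (n + 2 * a)%:R *: eop a a u.
  transitivity (\sum_(a < N) ((N%:R - 1 - (2 * a)%:R) *: x a)); last first.
    rewrite -sumrB; apply: eq_bigr => a _; rewrite -scalerBl /x.
    by congr (_ *: _); rewrite natrD; ring.
  rewrite (eq_bigr (fun a : 'I_N => (\sum_(b < N) (a < b)%N)%:R *: x a -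
     \sum_(b < N) (a < b)%N%:R *: x b)) => [|a _]; last first.
    by rewrite natr_sum scaler_suml -sumrB; apply: eq_bigr => b _; rewrite scalerBr.
  rewrite sumrB [X in _ - X]exchange_big /= -sumrB; apply: eq_bigr => a _.
  rewrite -scaler_suml -natr_sum -scalerBl sum_ltn sum_gtn //; congr (_ *: _).
  by have aN := ltn_ord a; rewrite natrB // -natr1 natrM; ring.
have E2 : R2 = \sum_(a < N) \sum_(b < N) eop a b (eop b a u) -
   (\sum_(a < N) eop a a (x a) +
     (\sum_(a < N) (n%:R + N%:R - 1) *: eop a a u - \sum_(a < N) (n + 2 * a)%:R *: eop a a u)).
  rewrite -S1 -S2 -big_split -sumrB; apply: eq_bigr => a _ /=.
  by rewrite -big_split -sumrB.
rewrite (_ : cas_op N u = R1 - R2); first exact: subB.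
rewrite E2 E -/R1 /number /cas_op sumrB scaler_sumr !opprB.
by rewrite [RHS]addrC opprD addrA subrK -addrA addrAC subrr add0r.
Qed.

(** Let the product of the operators [cas_op] - z, over the nonzero eigenvalues z occurring in [u],
    act on [u]. Modulo [P], where [cas_op] gives 0, the result is a nonzero multiple of [u];
    computed on basis vectors, it retains only the eigenvalue 0, that is, the vacuum and [fdet]. *)
Lemma casimir_mod u : (0 < n)%N -> so_inv u ->
  (forall a b : int, 0 <= a + b -> P (qop a b u)) ->
  P (u - u fset0 *: vac - u dfull *: fdet).
Proof.
move=> n0 ui Pr; have [N hN] := psi_cutoff u.
have uN i a : (N <= a)%N -> psi i a%:Z u = 0 by move=> Na; apply: hN; lia.
have suppN S : u S != 0 -> forall i a, (i, a) \in S -> (a < N)%N.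
  move=> uS i a iaS; rewrite ltnNge; apply/negP => /(uN i) /(congr1 (fun v : F => v (S `\ (i, a)))).
  rewrite /psi annE in_fsetD1 eqxx /= fsetD1K // fock0 => /eqP.
  by rewrite mulf_eq0 (negPf uS) signr_eq0.
have PZ : P (cas_op N u) by apply: cas_op_mod.
have [s hs] := fock_support u.
pose zs := [seq cas_eigen N S0 | S0 <- s & cas_eigen N S0 != 0].
pose shift z v : F := cas_op N v - z *: v.
have shiftE z v S : shift z v S = (cas_eigen N S - z) * v S.
  by rewrite /shift fockD fockN fockZ cas_op_diag mulrBl.
pose w := foldr shift u zs.
have wE S : w S = (\prod_(z <- zs) (cas_eigen N S - z)) * u S.
  rewrite /w; elim: (zs) => [|z zs' IH] /=; first by rewrite big_nil mul1r.
  by rewrite shiftE IH big_cons mulrA.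
pose cst : K := \prod_(z <- zs) (- z).
have cst0 : cst != 0.
  rewrite prodf_seq_neq0; apply/allP => z /mapP[S]; rewrite mem_filter => /andP[z0 _] ->.
  by rewrite oppr_eq0.
have Pw : P (w - cst *: u).
  rewrite /w /cst; elim: (zs) => [|z zs' IH] /=.
    by rewrite big_nil scale1r subrr; apply: sub0.
  rewrite big_cons; move: (foldr _ _ _) (\prod_(_ <- _) _) IH => v r IH.
  have -> : shift z v - (- z * r) *: u =
      cas_op N (v - r *: u) - z *: (v - r *: u) + r *: cas_op N u.
    apply: fockP => S; rewrite !(fockD, fockN, fockZ, shiftE, cas_op_diag); ring.
  apply: subD => //; last exact: subZ.
  by apply: subB => //; [exact: cas_op_stable|exact: subZ].
apply: (subZ_inv P_sub cst0); rewrite -(opprK (cst *: _)); apply: (subN P_sub).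
have -> : - (cst *: (u - u fset0 *: vac - u dfull *: fdet)) = w - cst *: u; last by [].
have dfull0 : dfull != fset0.
  by apply/fset0Pn; exists (Ordinal n0, 0%N); rewrite in_dfull.
have eig0 : cas_eigen N fset0 = 0.
  rewrite /cas_eigen big1 // => a _; rewrite (_ : occupation fset0 a = 0%N) ?mul0r //.
  by rewrite /occupation big1.
have eigd : u dfull != 0 -> cas_eigen N dfull = 0.
  move=> ud; rewrite /cas_eigen big1 // => a _; rewrite /occupation.
  rewrite (eq_bigr (fun=> (a == 0%N :> nat) : nat)) => [|i _]; last by rewrite in_dfull.
  rewrite sum_nat_const card_ord; case: eqP => [->|_]; last by rewrite muln0 mul0r.
  by rewrite muln1 muln0 addn0 subrr mulr0.
apply: fockP => S; rewrite fockN fockZ !(fockD, fockN) !fockZ wE /fdet /fvac !fketE.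
have [->|S0] := eqVneq S fset0.
  rewrite eq_sym (negPf dfull0) mulr0 mulr1 subr0 subrr mulr0 oppr0 eig0.
  by under eq_bigr do rewrite sub0r; rewrite -/cst subrr.
have [->|Sd] := eqVneq S dfull.
  rewrite mulr0 mulr1 subr0 subrr mulr0 oppr0.
  have [->|/eigd ->] := eqVneq (u dfull) 0; first by rewrite !mulr0 subrr.
  by under eq_bigr do rewrite sub0r; rewrite -/cst subrr.
rewrite !mulr0 !subr0 (_ : \prod_(_ <- _) _ * _ = 0) ?sub0r //.
have [->|uS] := eqVneq (u S) 0; first by rewrite mulr0.
have z0 : cas_eigen N S != 0.
  apply/eqP => /(cas_eigen_eq0 (suppN _ uS))[] E; first by rewrite E eqxx in S0.
  by rewrite E eqxx in Sd.
apply/eqP; rewrite mulf_eq0 prodf_seq_eq0; apply/orP; left; apply/hasP.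
exists (cas_eigen N S); last by rewrite /= subrr eqxx.
by apply/mapP; exists S => //; rewrite mem_filter z0 hs.
Qed.

End Modulo.
End CasimirModulo.

(** * Invariants as modules over [\hat D^+] *)

Section HoweDuality.
Local Open Scope fset_scope.
Local Open Scope ring_scope.
Variables (K : numFieldType) (n : nat).
Local Notation F := (fock K ('I_n * nat)%type).
Local Notation vac := (fvac K ('I_n * nat)%type).
Local Notation fdet := (fdet K n).
Local Notation dfull := (dfull n).
Implicit Types (u v : F) (i j : 'I_n) (a b k : int) (S : {fset ('I_n * nat)}).
Implicit Types (f : {poly K}).

Lemma qop_finite k u : zfinite (fun a => qop a (k - a) u).
Proof.
apply: zfinite_sum => i.
by apply: eq_zfinite (nord_finite i i k (fun=> 1) u) => a; rewrite scale1r.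
Qed.

Lemma dopE k f u :
  dop k f u = - (1 / 2) *: zsum (fun a => f.[(- 1 - a)%:~R] *: qop a (k - 1 - a) u).
Proof.
rewrite /dop /Qop -zsum_sum => [|i]; last exact: nord_finite.
by congr (_ *: _); apply: eq_zsum => a; rewrite /qop scaler_sumr.
Qed.

(* The elements t^k f(D) of \hat D^+ act as arbitrary finite combinations of the
   [qop a b] = \sum_i :psi i a psi i b: with a + b = k - 1, by interpolation. *)
Lemma qop_of_dop (P : set F) k u : is_subspace P ->
  (forall f, dplus k f -> P (dop k f u)) ->
  forall a b, a + b = k - 1 -> P (qop a b u).
Proof.
move=> Ps Pf a0 b0 ab.
have [E|ab0] := eqVneq a0 b0.
  suff -> : qop a0 b0 u = 0 by exact: sub0.
  have := qop_anti a0 b0 u; rewrite -E => /eqP.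
  rewrite -subr_eq0 opprK -mulr2n -scaler_nat scaler_eq0 pnatr_eq0 /=.
  by move/eqP.
have [w bw] := qop_finite (k - 1) u.
pose t a := qop a (k - 1 - a) u.
pose r := [seq c <- [seq w.1 + m%:Z | m <- iota 0 w.2] | (c != a0) && (c != b0)].
(* Interpolation among odd polynomials: [Y] is odd about -(k+1)/2 and equals k - 1 - 2a at -1 - a,
   while each factor of the product is even and vanishes at c and its mirror image k - 1 - c. Only
   [a0] and its mirror [b0] survive, and their terms add up, since f and [qop] both change sign. *)
pose Y : {poly K} := 2%:R *: 'X + (1 + k%:~R)%:P.
pose f : {poly K} := Y * \prod_(c <- r) (Y ^+ 2 - ((k - 1 - 2 * c)%:~R ^+ 2)%:P).
have fx (x : K) : f.[x] = (2%:R * x + (1 + k%:~R)) *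
    \prod_(c <- r) ((2%:R * x + (1 + k%:~R)) ^+ 2 - (k - 1 - 2 * c)%:~R ^+ 2).
  rewrite /f hornerM horner_prod; congr (_ * _); first by rewrite !hornerE.
  by apply: eq_bigr => c _; rewrite !hornerE.
have df : dplus k f.
  apply: dplusP => x; rewrite !fx -mulNr; congr (_ * _); first by ring.
  by apply: eq_bigr => c _; ring.
have fa a : f.[(-1 - a)%:~R] = (k - 1 - 2 * a)%:~R *
    \prod_(c <- r) ((k - 1 - 2 * a)%:~R ^+ 2 - (k - 1 - 2 * c)%:~R ^+ 2).
  rewrite fx (_ : 2%:R * (-1 - a)%:~R + (1 + k%:~R) = (k - 1 - 2 * a)%:~R) //.
  by rewrite !(rmorphD, rmorphN, rmorphM) /=; ring.
have f0 a : a != a0 -> a != b0 -> f.[(-1 - a)%:~R] *: t a = 0.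
  move=> aa0 ab0'; case: (boolP (w.1 <= a < w.1 + w.2%:Z)) => [wa|wa]; last first.
    by rewrite /t bw ?scaler0 //; lia.
  rewrite fa (_ : \prod_(_ <- _) _ = 0) ?mulr0 ?scale0r //.
  apply/eqP; rewrite prodf_seq_eq0; apply/hasP; exists a; last by rewrite /= subrr eqxx.
  rewrite mem_filter aa0 ab0' /=; apply/mapP; exists `|a - w.1|%N; last by lia.
  by rewrite mem_iota; lia.
have fa0 : f.[(-1 - a0)%:~R] != 0.
  rewrite fa mulf_neq0 //; first by rewrite intr_eq0; lia.
  rewrite prodf_seq_neq0; apply/allP => c; rewrite mem_filter => /andP[/andP[ca cb] _] /=.
  rewrite subr_sqr mulf_neq0 // -?rmorphB -?rmorphD /= intr_eq0; lia.
have fb0 : f.[(-1 - b0)%:~R] = - f.[(-1 - a0)%:~R].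
  rewrite -(dplus_horner _ df); congr (f.[_]).
  have -> : b0 = k - 1 - a0 by lia.
  by rewrite !(rmorphD, rmorphN) /=; ring.
have := Pf _ df; rewrite dopE.
have sa a : a != a0 -> (if a == a0 then f.[(-1 - a)%:~R] *: t a else 0) = 0.
  by move/negPf ->.
have sb a : a != b0 -> (if a == b0 then f.[(-1 - a)%:~R] *: t a else 0) = 0.
  by move/negPf ->.
rewrite (@eq_zsum _ _ _ (fun a => (if a == a0 then f.[(-1 - a)%:~R] *: t a else 0) +
  (if a == b0 then f.[(-1 - a)%:~R] *: t a else 0))) => [|a]; last first.
  have [->|aa0] := eqVneq a a0; first by rewrite (negPf ab0) addr0.
  have [->|ab0'] := eqVneq a b0; first by rewrite add0r.
  by rewrite addr0 f0.
rewrite zsumD; [|exact: zfinite_single sa|exact: zfinite_single sb].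
rewrite (zsum_single sa) (zsum_single sb) !eqxx fb0.
have -> : t b0 = - t a0.
  have E1 : k - 1 - a0 = b0 by lia.
  have E2 : k - 1 - b0 = a0 by lia.
  by rewrite /t E1 E2 [LHS]qop_anti.
rewrite [X in _ + X](_ : _ = f.[(-1 - a0)%:~R] *: t a0); last first.
  by rewrite scaleNr scalerN opprK.
rewrite -mulr2n -scaler_nat !scalerA => /(subZ_inv Ps).
rewrite /t (_ : k - 1 - a0 = b0); last by lia.
by apply; rewrite !mulf_neq0 ?oppr_eq0 ?mulf_neq0 ?invr_eq0 ?oner_eq0 ?pnatr_eq0.
Qed.

(** Twice the conformal weight, a fermion in mode m having weight m + 1/2. Operators of positive
    degree lower it, which makes the inductions below terminate. *)
Definition energy S : nat := \sum_(h <- S) (2 * h.2).+1.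

Definition Ele (E : int) u : Prop := forall S, u S != 0 -> (energy S)%:Z <= E.

Lemma Ele_subspace E : is_subspace (Ele E).
Proof.
split=> [S|c u v hu hv S]; first by rewrite fock0 eqxx.
rewrite fockD fockZ; have [uS|uS _] := eqVneq (u S) 0; last exact: hu.
by rewrite uS mulr0 add0r; apply: hv.
Qed.

Lemma Ele_psi E i a u : Ele E u -> Ele (E - (2 * a + 1)) (psi i a u).
Proof.
case: a => m hu S; rewrite /psi.
  rewrite annE; case: ifP => [|hS]; first by rewrite eqxx.
  rewrite mulf_eq0 negb_or => /andP[_ /hu].
  rewrite /energy big_fsetU1 ?hS // -[(i, m).2]/m.
  by move: (\sum_(_ <- S) _)%N => e /=; lia.
rewrite creE; case: ifP => [hS|]; last by rewrite eqxx.
rewrite mulf_eq0 negb_or => /andP[_ /hu].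
have -> : energy S = ((2 * m).+1 + energy (S `\ (i, m)))%N.
  by rewrite /energy (big_fsetD1 (i, m)).
by move: (energy (S `\ (i, m))) => e; lia.
Qed.

Lemma Ele_dop E k f u : Ele E u -> Ele (E - 2 * k) (dop k f u).
Proof.
move=> hu; have Es := Ele_subspace (E - 2 * k).
apply: (subZ Es); apply: (sub_sum Es) => i _; apply: (zsum_subspace Es) => a.
apply: (subZ Es); rewrite /nord; case: ifP => _.
  rewrite (_ : E - 2 * k = E - (2 * (k - 1 - a) + 1) - (2 * a + 1)); last by ring.
  by do 2!apply: Ele_psi.
apply: (subN Es).
rewrite (_ : E - 2 * k = E - (2 * a + 1) - (2 * (k - 1 - a) + 1)); last by ring.
by do 2!apply: Ele_psi.
Qed.

Lemma Ele_exists u : exists m : nat, Ele m%:Z u.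
Proof.
have [s hs] := fock_support u; exists (\max_(S <- s) energy S) => S /hs Ss.
by rewrite lez_nat; apply: leq_bigmax_seq.
Qed.

Lemma Ele_neg E u : E < 0 -> Ele E u -> u = 0.
Proof.
move=> E0 hu; apply: fockP => S; rewrite fock0; apply/eqP; apply: contraT => /hu.
lia.
Qed.

Variable i0 : 'I_n.
Hypothesis n_even : ~~ odd n.

(* The parity of the number of fermions of index [i0]: it detects the
   determinant of O(n), on so(n)-invariants. *)
Definition iparity (eps : bool) u : Prop :=
  forall S, u S != 0 -> odd (\sum_(h <- S) (h.1 == i0)) = eps.

Lemma iparity_subspace eps : is_subspace (iparity eps).
Proof.
split=> [S|c u v hu hv S]; first by rewrite fock0 eqxx.
rewrite fockD fockZ; have [uS|uS _] := eqVneq (u S) 0; last exact: hu.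
by rewrite uS mulr0 add0r; apply: hv.
Qed.

Lemma iparity_psi eps i a u :
  iparity eps u -> iparity (eps (+) (i == i0)) (psi i a u).
Proof.
case: a => m hu S; rewrite /psi.
  rewrite annE; case: ifP => [|hS]; first by rewrite eqxx.
  rewrite mulf_eq0 negb_or => /andP[_ /hu].
  rewrite big_fsetU1 ?hS //= oddD => <-.
  by rewrite oddb addbC addbA addbb.
rewrite creE; case: ifP => [hS|]; last by rewrite eqxx.
rewrite mulf_eq0 negb_or => /andP[_ /hu].
by rewrite [\sum_(_ <- S) _](big_fsetD1 (i, m)) //= oddD oddb => ->; rewrite addbC.
Qed.

Lemma iparity_nord eps i a j b u :
  iparity eps u -> iparity (eps (+) (i == i0) (+) (j == i0)) (nord i a j b u).
Proof.
move=> hu; rewrite /nord; case: ifP => _.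
  by rewrite addbAC; do 2!apply: iparity_psi.
by apply: (subN (iparity_subspace _)); do 2!apply: iparity_psi.
Qed.

Lemma iparity_Qop eps i j b c u :
  iparity eps u -> iparity (eps (+) (i == i0) (+) (j == i0)) (Qop i j b c u).
Proof.
move=> hu; apply: (zsum_subspace (iparity_subspace _)) => a.
by apply: (subZ (iparity_subspace _)); apply: iparity_nord.
Qed.

Lemma iparity_dop eps k f u : iparity eps u -> iparity eps (dop k f u).
Proof.
move=> hu; apply: (subZ (iparity_subspace _)).
apply: (sub_sum (iparity_subspace _)) => i _.
by have := @iparity_Qop eps i i (k - 1) (fun a => f.[(-1 - a)%:~R]) u hu; rewrite -addbA addbb addbF.
Qed.

Lemma iparity_disjoint eps u v :
  iparity eps u -> iparity (~~ eps) v -> u + v = 0 -> u = 0 /\ v = 0.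
Proof.
move=> hu hv uv; have vE : v = - u by apply/eqP; rewrite -addr_eq0 addrC uv.
have u0 : u = 0.
  apply: fockP => S; rewrite fock0; apply/eqP; apply: contraT => uS.
  have := hu _ uS; rewrite (hv S); first by case: (eps).
  by rewrite vE fockN oppr_eq0.
by rewrite vE u0 oppr0.
Qed.

Definition ipart_fun (eps : bool) u S : K :=
  if odd (\sum_(h <- S) (h.1 == i0)) == eps then u S else 0.

Lemma ipart_finite eps u : ipart_fun eps u \in @fock_finite K ('I_n * nat)%type.
Proof.
have [s hs] := fock_support u; apply/asboolP; exists s => S; rewrite /ipart_fun.
by case: ifP => [_ /hs|]; rewrite ?eqxx.
Qed.

Definition ipart eps u : F := Fock (ipart_finite eps u).

Lemma ipartE eps u S : ipart eps u S =
  if odd (\sum_(h <- S) (h.1 == i0)) == eps then u S else 0.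
Proof. by []. Qed.

Lemma ipart_parity eps u : iparity eps (ipart eps u).
Proof. by move=> S; rewrite ipartE; case: ifP => [/eqP//|_]; rewrite eqxx. Qed.

Lemma ipart_sum u : u = ipart false u + ipart true u.
Proof.
apply: fockP => S; rewrite fockD !ipartE.
by case: (odd _); rewrite /= ?addr0 ?add0r.
Qed.

(* The so(n)-invariants of the even part of the Fock space on which O(n) acts
   trivially ([eps = false]) or by the determinant ([eps = true]). *)
Definition inv_module (eps : bool) u : Prop :=
  [/\ fparity false u, so_inv u & iparity eps u].

Lemma so_inv_subspace : is_subspace (@so_inv K n).
Proof.
split=> [i j|c u v hu hv i j]; first by rewrite (lin0 (Qop_linear _ _ _ _)).
by rewrite Qop_linear hu hv scaler0 addr0.
Qed.

Lemma inv_module_subspace eps : is_subspace (inv_module eps).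
Proof.
have s1 := fparity_subspace K n false; have s2 := so_inv_subspace.
have s3 := iparity_subspace eps.
split=> [|c u v [u1 u2 u3] [v1 v2 v3]]; split.
- exact: sub0 s1.
- exact: sub0 s2.
- exact: sub0 s3.
- exact: s1.2.
- exact: s2.2.
- exact: s3.2.
Qed.

Lemma fderiv_zero k : fderiv (fun _ : F => 0) k (fun=> 0 : 'M[K]_n).
Proof.
split; first exact: lin_zero.
- move=> j e u; rewrite psi0 add0r big1 // => i _.
  by rewrite mxE scale0r.
- by move=> _ u; rewrite fock0.
- by [].
Qed.

(** One action is a constant matrix on the indices, the other a scalar on each mode, so the
    commutator is a number. It is 0 because [som x 0] kills the vacuum and never produces a vacuum
    component. *)
Lemma som_dop x k f u : so_mx x -> dplus k f -> som x 0 (dop k f u) = dop k f (som x 0 u).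
Proof.
move=> sx df.
have hZ : fderiv (fun _ : F => 0) (0 + k)
    (fun e => x *m (f.[e%:~R])%:M - (f.[(e + 0)%:~R])%:M *m x).
  have := fderiv_zero (0 + k); congr fderiv; apply/funext => e.
  by rewrite addr0 scalar_mxC subrr.
apply/eqP; rewrite -subr_eq0.
rewrite (fderiv_comm u (som_fderiv 0 sx) (dop_fderiv n df) hZ) add0r.
have [_ _ X1 X0] := som_fderiv 0 sx.
by rewrite X1 // X0 // (lin0 (@dop_linear K n _ _ df)) fock0 subrr scale0r.
Qed.

Lemma inv_module_dop eps k f u :
  dplus k f -> inv_module eps u -> inv_module eps (dop k f u).
Proof.
move=> df [u1 u2 u3]; split; last exact: iparity_dop.
- have s1 := fparity_subspace K n false.
  apply: (subZ s1); apply: (sub_sum s1) => i _; exact: fparity_Qop.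
- apply/so_invP => x sx; rewrite som_dop //.
  by have /so_invP -> // := u2; rewrite (lin0 (@dop_linear K n _ _ df)).
Qed.

(** The generator of so(n) with indices i, j changes [iparity] by a fixed amount, so its values on
    the two parity components of [u] cannot cancel. *)
Lemma inv_module_decomp u : fparity false u -> so_inv u ->
  exists u0 u1, [/\ inv_module false u0, inv_module true u1 & u = u0 + u1].
Proof.
move=> hu ui; exists (ipart false u), (ipart true u).
have hp eps : fparity false (ipart eps u).
  by move=> S; rewrite ipartE; case: ifP => [_ /hu|]; rewrite ?eqxx.
have hs i j : Qop i j (-1) (fun=> 1) (ipart false u) = 0 /\
    Qop i j (-1) (fun=> 1) (ipart true u) = 0.
  apply: (@iparity_disjoint (false (+) (i == i0) (+) (j == i0))).
  - by apply: iparity_Qop; apply: ipart_parity.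
  - rewrite (_ : ~~ _ = true (+) (i == i0) (+) (j == i0)); last by do 2!case: (_ == i0).
    by apply: iparity_Qop; apply: ipart_parity.
  - by rewrite -(linD (Qop_linear _ _ _ _)) -ipart_sum; apply: ui.
split; last exact: ipart_sum.
- by split=> // [i j|]; [have [] := hs i j|exact: ipart_parity].
- by split=> // [i j|]; [have [] := hs i j|exact: ipart_parity].
Qed.

Lemma inv_module_disjoint u : inv_module false u -> inv_module true u -> u = 0.
Proof.
move=> [_ _ u0] [_ _ u1]; apply: fockP => S; rewrite fock0.
by apply/eqP; apply: contraT => uS; have := u0 _ uS; rewrite (u1 _ uS).
Qed.

Definition inv_hw (eps : bool) : F := if eps then fdet else vac.

Lemma inv_vac : inv_module false vac.
Proof.
split; first exact: fparity_vac.
- by move=> i j; apply: Qop_vac0.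
- move=> S; rewrite fketE; have [->|] := eqVneq S fset0; last by rewrite eqxx.
  by rewrite big_nil.
Qed.

Lemma fdet_neq0 : fdet <> 0.
Proof.
by move=> /(congr1 (fun u : F => u dfull))/eqP; rewrite fketE eqxx fock0 oner_eq0.
Qed.

Lemma psi_fdet0 i a : 0 < a -> psi i a fdet = 0.
Proof.
case: a => // -[//|m] _; apply: fockP => S; rewrite /psi annE fock0.
case: ifP => // hS; rewrite fketE; case: eqP => [E|]; last by rewrite mulr0.
by have := fset1U1 (i, m.+1) S; rewrite E in_dfull.
Qed.

Lemma psi_fdetN1 i : psi i (-1) fdet = 0.
Proof.
rewrite -[-1]/(Negz 0); apply: fockP => S; rewrite /psi creE fock0; case: ifP => // hS.
rewrite fketE; case: eqP => [E|]; last by rewrite mulr0.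
have : (i, 0%N) \notin S `\ (i, 0%N) by rewrite in_fsetD1 eqxx.
by rewrite E in_dfull.
Qed.

Lemma fdet_so_inv : so_inv fdet.
Proof.
move=> i j; have [->|ij] := eqVneq i j.
  have := Qop_one_anti j j (-1) fdet => /eqP.
  by rewrite -subr_eq0 opprK -mulr2n -scaler_nat scaler_eq0 pnatr_eq0 => /eqP.
apply: zsum0 => a; rewrite scale1r nord_neq //.
have [a0|a0] := ltP 0 a; first by rewrite psi_anti_neq // psi_fdet0 // psi0 oppr0.
have [->|a1] := eqVneq a 0; first by rewrite subr0 psi_fdetN1 psi0.
have [->|a2] := eqVneq a (-1).
  by rewrite psi_anti_neq // psi_fdetN1 psi0 oppr0.
by rewrite psi_fdet0 ?psi0 //; lia.
Qed.

Lemma dfull_sum (G : 'I_n -> nat) : (\sum_(h <- dfull) G h.1 = \sum_(i < n) G i)%N.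
Proof.
rewrite /dfull big_imfset /=; last by move=> i j _ _ [].
by rewrite big_enum.
Qed.

Lemma inv_det : inv_module true fdet.
Proof.
split; [|exact: fdet_so_inv|] => S; rewrite fketE;
  (have [->|_] := eqVneq S dfull; last by rewrite eqxx) => _.
- by rewrite -sum1_size (dfull_sum (fun=> 1%N)) sum1_card card_ord; apply: negbTE.
- rewrite (dfull_sum (fun i => (i == i0) : nat)) (bigD1 i0) //= eqxx.
  by rewrite big1 // => i /negPf ->.
Qed.

Lemma inv_hwP eps : inv_module eps (inv_hw eps).
Proof. by case: eps; [exact: inv_det|exact: inv_vac]. Qed.

(** It is used twice: with P = 0 it classifies the singular vectors, and with P a submodule it puts
    a vector in P as soon as its images under positive degrees lie there. The parity [eps] selects
    one of the two candidates of [casimir_mod]. *)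
Lemma inv_singular (P : set F) eps u : is_subspace P ->
  (forall k f v, dplus k f -> P v -> P (dop k f v)) ->
  inv_module eps u ->
  (forall k f, 0 < k -> dplus k f -> P (dop k f u)) ->
  exists c, P (u - c *: inv_hw eps).
Proof.
move=> Ps Pd [u1 u2 u3] Pr; have n0 : (0 < n)%N by case: (i0) => m; case: (n).
have := casimir_mod Ps _ n0 u2.
have Pq a b v : P v -> P (qop a b v).
  by move=> Pv; apply: (qop_of_dop (k := a + b + 1) Ps) => [f df|]; [exact: Pd|rewrite addrK].
move=> /(_ Pq); have Pr' a b : 0 <= a + b -> P (qop a b u).
  move=> ab; apply: (qop_of_dop (k := a + b + 1) Ps) => [f df|]; last by rewrite addrK.
  by apply: Pr => //; lia.
move=> /(_ Pr'); case: eps u3 => u3.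
  have -> : u fset0 = 0.
    by apply/eqP; apply: contraT => /u3; rewrite big_nil.
  by rewrite scale0r subr0 => Pu; exists (u dfull).
have -> : u dfull = 0.
  apply/eqP; apply: contraT => /u3.
  rewrite (dfull_sum (fun i => (i == i0) : nat)) (bigD1 i0) //= eqxx.
  by rewrite big1 // => i /negPf ->.
by rewrite scale0r subr0 => Pu; exists (u fset0).
Qed.

(** Two inductions on the energy. A nonzero vector of P is raised until it is singular, so P
    contains the highest weight vector; then every vector lies in P, since its images under positive
    degrees do by induction. *)
Theorem inv_module_irreducible eps (P : set F) : is_subspace P ->
  (forall k f v, dplus k f -> P v -> P (dop k f v)) ->
  (forall u, P u -> inv_module eps u) ->
  (forall u, P u -> u = 0) \/ (forall u, inv_module eps u -> P u).
Proof.
move=> Ps Pd PM.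
have Phw u : P u -> u <> 0 -> P (inv_hw eps).
  have [m] := Ele_exists u; elim/ltn_ind: m u => m IH u um Pu u0.
  have [[k [f [k0 df H]]]|H] :=
    pselect (exists k f, [/\ 0 < k, dplus k f & dop k f u <> 0]).
    have um' := @Ele_dop _ k f _ um; have [mk|mk] := ltP (m%:Z - 2 * k) 0.
      by case: H; apply: Ele_neg mk um'.
    apply: (IH `|(m%:Z - 2 * k)%R|%N _ (dop k f u)); first by lia.
    - by rewrite gez0_abs.
    - exact: Pd.
    - exact: H.
  pose Z : set F := fun v => v = 0.
  have Zs : is_subspace Z by split=> // c v w -> ->; rewrite scaler0 addr0.
  have [|||c] := @inv_singular Z eps u Zs.
  - by move=> k f v df ->; apply: lin0 (@dop_linear K n _ _ df).
  - exact: PM.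
  - move=> k f k0 df; apply: contrapT => nz; apply: H; exists k, f; split=> //.
  move=> /eqP; rewrite subr_eq0 => /eqP uE.
  move: Pu; rewrite uE; apply: subZ_inv => //.
  by apply/eqP => c0; apply: u0; rewrite uE c0 scale0r.
have [[u [Pu u0]]|no] := pselect (exists u, P u /\ u <> 0); last first.
  by left=> u Pu; apply: contrapT => u0; apply: no; exists u.
right=> v; have Ph := Phw _ Pu u0; have [m] := Ele_exists v.
elim/ltn_ind: m v => m IH v vm vM.
have [|c Pc] := @inv_singular P eps v Ps Pd vM.
  move=> k f k0 df; have vm' := @Ele_dop _ k f _ vm.
  have [mk|mk] := ltP (m%:Z - 2 * k) 0; first by rewrite (Ele_neg mk vm'); apply: sub0.
  apply: (IH `|(m%:Z - 2 * k)%R|%N _ (dop k f v)); first by lia.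
  - by rewrite gez0_abs.
  - exact: inv_module_dop.
by rewrite -(subrK (c *: inv_hw eps) v); apply: subD => //; apply: subZ.
Qed.

(** Each of the n factors psi i (-1) of [fdet] contributes f(-1); the vacuum has weight 0. *)
Definition inv_weight (eps : bool) k f : K :=
  if eps && (k == 0) then n%:R * f.[-1] else 0.

Lemma dop_inv_hw eps k f : dplus k f -> 0 <= k ->
  dop k f (inv_hw eps) = inv_weight eps k f *: inv_hw eps.
Proof.
move=> df k0; rewrite /inv_weight; case: eps => /=; last first.
  by rewrite scale0r; have [_ _ _ ->] := dop_fderiv n df.
have d00 i : psi i 0 (psi i 0 fdet) = 0 by exact: psi_psi_same.
have [k1|k1] := eqVneq k 0; last first.
  rewrite scale0r /dop big1 ?scaler0 // => i _; apply: zsum0 => a; rewrite /nord.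
  case: ltP => a0; first by rewrite [X in psi i a X]psi_fdet0 ?psi0 ?scaler0 //; lia.
  have [->|a1] := eqVneq a 0; last first.
    by rewrite [X in psi _ _ X]psi_fdet0 ?psi0 ?oppr0 ?scaler0 //; lia.
  have [->|k2] := eqVneq k 1; first by rewrite (_ : 1 - 1 - 0 = 0) // d00 !oppr0 scaler0.
  rewrite psi_anti; last by apply/andP => -[_]; lia.
  by rewrite [X in psi _ _ X]psi_fdet0 ?psi0 ?oppr0 ?scaler0 //; lia.
subst k; rewrite dopE.
pose t a := f.[(-1 - a)%:~R] *: qop a (0 - 1 - a) fdet.
have num : qop (-1) 0 fdet = n%:R *: fdet.
  rewrite -[-1]/(Negz 0) -[0 : int]/(Posz 0) -(@eopE K n 0 0); apply: fockP => S.
  rewrite eop_diag fockZ fketE; have [->|_] := eqVneq S dfull; last by rewrite !mulr0.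
  congr (_%:R * _); rewrite /occupation (eq_bigr (fun=> 1%N)) ?sum1_card ?card_ord //.
  by move=> i _; rewrite in_dfull.
have t0 a : a != -1 -> a != 0 -> t a = 0.
  move=> a1 a0; rewrite /t /qop big1 ?scaler0 // => i _; rewrite /nord.
  case: ltP => ha; first by rewrite [X in psi i a X]psi_fdet0 ?psi0 //; lia.
  by rewrite [X in psi _ _ X]psi_fdet0 ?psi0 ?oppr0 //; lia.
have sa a : a != -1 -> (if a == -1 then t a else 0) = 0 by move/negPf ->.
have sb a : a != 0 -> (if a == 0 then t a else 0) = 0 by move/negPf ->.
rewrite (@eq_zsum _ _ _ (fun a => (if a == -1 then t a else 0) +
  (if a == 0 then t a else 0))) => [|a]; last first.
  have [->|a1] := eqVneq a (-1); first by rewrite (_ : (-1 == 0 :> int) = false) ?addr0.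
  have [->|a0] := eqVneq a 0; first by rewrite [RHS]add0r.
  by rewrite [RHS]addr0 -/(t a) t0.
rewrite zsumD; [|exact: zfinite_single sa|exact: zfinite_single sb].
rewrite (zsum_single sa) (zsum_single sb) !eqxx /t.
rewrite (_ : 0 - 1 - -1 = 0) // (_ : 0 - 1 - 0 = -1) // [qop 0 _ _]qop_anti num.
have -> : f.[(-1 - 0)%:~R] = f.[-1] by rewrite subr0 rmorphN.
have -> : f.[(-1 - -1)%:~R] = - f.[-1].
  rewrite -(dplus_horner _ df); congr (f.[_]).
  by rewrite rmorphB rmorphN /=; ring.
by apply: fockP => S; rewrite !(fockD, fockN, fockZ); field.
Qed.

End HoweDuality.

(** * Product, commutator and locality formulas from the Borcherds identity *)

Section VertexAlgebraFacts.
Variables (K : numFieldType) (V M : lmodType K) (vac : V) (Y : V -> int -> V -> V)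
  (YM : V -> int -> M -> M).
Hypothesis act : va_action vac Y YM.
Implicit Types (a b : V) (u : M) (m n k : int).

Lemma va_linear_l n u : linear (fun a => YM a n u).
Proof. by case: act. Qed.

Lemma va_linear a n : linear (YM a n).
Proof. by case: act. Qed.

Lemma va_vacuum n u : YM vac n u = if n == -1 then u else 0.
Proof. by case: act. Qed.

Lemma binz0 (j : nat) : binz K 0 j = (j == 0%N)%:R.
Proof.
rewrite /binz; case: j => [|j]; first by rewrite big_ord0 divr1.
by rewrite big_ord_recl subrr mul0r mul0r.
Qed.

Lemma binz1 m : binz K m 1 = m%:~R.
Proof. by rewrite /binz big_ord1 subr0 divr1. Qed.

Lemma binz_nat (n j : nat) : binz K n j = 'C(n, j)%:R.
Proof.
have f0 (i : nat) : i`!%:R != 0 :> K by rewrite pnatr_eq0 -lt0n fact_gt0.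
apply: (mulIf (f0 j)); rewrite /binz mulfVK // -natrM bin_ffact.
elim: j => [|j IH]; first by rewrite big_ord0 ffactn0.
rewrite big_ord_recr /= IH ffactnSr natrM -pmulrn.
have [jn|nj] := leqP j n; first by rewrite natrB.
by rewrite ffact_small // !mul0r.
Qed.

Lemma va_product a b u n k : exists N0 : nat, forall N : nat, (N0 <= N)%N ->
  YM (Y a n b) k u = \sum_(j < N) ((-1) ^+ j * binz K n j) *:
    (YM a (n - j%:Z) (YM b (k + j%:Z) u) - (-1) ^ n *: YM b (n + k - j%:Z) (YM a j%:Z u)).
Proof.
case: act => _ _ _ _ /(_ a b u 0 n k)[N0 H]; exists N0.+1 => N NN.
have := H N (ltnW NN); rewrite (bigD1 (Ordinal (leq_ltn_trans (leq0n _) NN))) //=.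
rewrite binz0 scale1r addr0 subr0 add0r big1 ?addr0 => [->|j j0].
  by apply: eq_bigr => j _; rewrite !add0r.
by rewrite binz0 (_ : (j : nat) == 0%N = false) ?scale0r //; apply/negbTE.
Qed.

Lemma va_commutator a b u m k : exists N0 : nat, forall N : nat, (N0 <= N)%N ->
  YM a m (YM b k u) - YM b k (YM a m u) =
  \sum_(j < N) binz K m j *: YM (Y a j%:Z b) (m + k - j%:Z) u.
Proof.
case: act => _ _ _ _ /(_ a b u m 0 k)[N0 H]; exists N0.+1 => N NN.
have := H N (ltnW NN); rewrite [RHS](bigD1 (Ordinal (leq_ltn_trans (leq0n _) NN))) //=.
rewrite binz0 expr0z mulr1 !scale1r !(addr0, subr0, add0r) [X in _ = _ + X]big1 ?addr0 => [<-|j j0].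
  by apply: eq_bigr => j _; rewrite add0r.
by rewrite binz0 (_ : (j : nat) == 0%N = false) ?mulr0 ?scale0r //; apply/negbTE.
Qed.

Hypothesis trunc : forall a b, exists N : int, forall n, N <= n -> Y a n b = 0.

(** For n beyond the truncation of [Y a n b], the left side of the Borcherds identity vanishes. The
    binomials C(n, j) vanish for j > n, so the other side is a sum whose length depends neither on
    the vector nor on the modes. *)
Lemma va_locality a b : exists N1 : nat, forall n : nat, (N1 <= n)%N -> forall u m k,
  \sum_(j < n.+1) ((-1) ^+ j * 'C(n, j)%:R) *:
    (YM a (m + n%:Z - j%:Z) (YM b (k + j%:Z) u)
     - (-1) ^+ n *: YM b (n%:Z + k - j%:Z) (YM a (m + j%:Z) u)) = 0.
Proof.
have [N hN] := trunc a b; exists `|N|%N => n Nn u m k.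
case: act => _ _ _ _ /(_ a b u m n%:Z k)[N0 H].
have := H (n.+1 + N0)%N (leq_addl _ _); rewrite big1 => [|j _]; last first.
  rewrite hN; last by lia.
  by rewrite (lin0 (va_linear_l _ _)) scaler0.
rewrite -(big_mkord xpredT (fun j : nat => ((-1) ^+ j * binz K n j) *:
    (YM a (m + n%:Z - j%:Z) (YM b (k + j%:Z) u)
     - (-1) ^ n *: YM b (n%:Z + k - j%:Z) (YM a (m + j%:Z) u)))).
rewrite (big_cat_nat (n := n.+1)) ?leq_addr //= [X in _ = _ + X]big_nat.
rewrite [X in _ = _ + X]big1 ?addr0 => [E|j /andP[nj _]].
  rewrite [RHS]E big_mkord; apply: eq_bigr => j _.
  by rewrite binz_nat.
by rewrite binz_nat bin_small // mulr0 scale0r.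
Qed.

End VertexAlgebraFacts.

Lemma va_trunc (K : numFieldType) (V : vertexAlgebra K) (a b : V) :
  exists N : int, forall n, N <= n -> va_Y a n b = 0.
Proof. by have [_ _ H _ _] := va_actionP V; exact: H. Qed.

(** * The Casimir element of so(n) on the adjoint representation *)

Section CasimirSo.
Variables (K : numFieldType) (n : nat).
Implicit Types (x : 'M[K]_n) (i j k : 'I_n).

Definition so_elt i j : 'M[K]_n := delta_mx i j - delta_mx j i.

Lemma so_elt_so i j : so_mx (so_elt i j).
Proof. by rewrite /so_mx linearB /= !trmx_delta opprB. Qed.

Lemma lie_so_elt x i j : so_mx x ->
  lie_mx x (so_elt i j) = \sum_k (x k i *: so_elt k j + x k j *: so_elt i k).
Proof.
move=> sx; have sxE a b : x a b = - x b a.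
  by have /matrixP/(_ b a) := sx; rewrite !mxE.
have L a b : x *m delta_mx a b = \sum_k x k a *: delta_mx k b.
  apply/matrixP => p q; rewrite !mxE summxE (bigD1 a) //= big1 => [|r ra].
    rewrite mxE eqxx addr0 (bigD1 p) //= big1 => [|r rp].
      by rewrite !mxE eqxx addr0.
    by rewrite !mxE eq_sym (negPf rp) mulr0.
  by rewrite mxE (negPf ra) mulr0.
have R a b : delta_mx a b *m x = - \sum_k x k b *: delta_mx a k.
  apply/matrixP => p q; rewrite !mxE summxE (bigD1 b) //= big1 => [|r rb].
    rewrite mxE eqxx andbT addr0 (bigD1 q) //= big1 => [|r rq].
      by rewrite !mxE eqxx andbT addr0 (sxE b) mulrN mulrC.
    by rewrite !mxE [q == r]eq_sym (negPf rq) andbF mulr0.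
  by rewrite mxE (negPf rb) andbF mul0r.
rewrite /lie_mx /so_elt mulmxBr mulmxBl !L !R.
rewrite !opprD !opprK -!sumrN -!big_split /=; apply: eq_bigr => k _.
by rewrite !scalerBr; apply/matrixP => p q; rewrite !mxE; ring.
Qed.

Lemma delta_mul_delta (A : 'M[K]_n) i j k (l : 'I_n) :
  delta_mx i j *m A *m delta_mx k l = A j k *: delta_mx i l.
Proof.
have E p r : (delta_mx i j *m A) p r = (p == i)%:R * A j r.
  rewrite mxE (bigD1 j) //= big1 => [|c cj]; first by rewrite mxE eqxx andbT addr0.
  by rewrite mxE (negPf cj) andbF mul0r.
apply/matrixP => p q; rewrite !mxE (bigD1 k) //= big1 => [|c ck].
  by rewrite E !mxE eqxx /= addr0 -mulnb natrM; ring.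
by rewrite [X in _ * X]mxE (negPf ck) mulr0.
Qed.

Lemma so_elt_conj (A : 'M[K]_n) :
  \sum_i \sum_j so_elt i j *m A *m so_elt i j = 2%:R *: (A^T - (\tr A)%:M).
Proof.
have E i j : so_elt i j *m A *m so_elt i j =
    (A j i *: delta_mx i j - A j j *: delta_mx i i) +
    (A i j *: delta_mx j i - A i i *: delta_mx j j).
  rewrite /so_elt mulmxBl mulmxBr !mulmxBl !delta_mul_delta.
  by rewrite opprB [LHS]addrACA [RHS]addrACA; congr (_ + _); rewrite addrC.
have S1 : \sum_i \sum_j (A j i *: delta_mx i j - A j j *: delta_mx i i) =
    A^T - (\tr A)%:M.
  rewrite (eq_bigr (fun i => \sum_j A j i *: delta_mx i j -
      \sum_j A j j *: delta_mx i i)) => [|i _]; last by rewrite sumrB.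
  rewrite sumrB; congr (_ - _).
    rewrite [RHS]matrix_sum_delta; apply: eq_bigr => i _; apply: eq_bigr => j _.
    by rewrite mxE.
  apply/matrixP => p q; rewrite summxE mxE (bigD1 p) //= [X in _ + X]big1 => [|i ip].
    rewrite addr0 -scaler_suml !mxE eqxx /= /mxtrace.
    by rewrite mulr_natr eq_sym.
  by rewrite -scaler_suml !mxE eq_sym (negPf ip) mulr0.
under eq_bigr do under eq_bigr do rewrite E.
under eq_bigr do rewrite big_split /=.
by rewrite big_split /= [X in _ + X]exchange_big /= S1 scaler_nat mulr2n.
Qed.

(** The term with the form contributes -4, the level, and the double bracket -4(n - 2), the Casimir
    scalar of the adjoint representation; together -4(1 + h) with h = n - 2 the dual Coxeter
    number. *)
Lemma casimir_so x : so_mx x ->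
  \sum_i \sum_j ((2%:R * so_form x (so_elt i j)) *: so_elt i j
    + lie_mx (lie_mx x (so_elt i j)) (so_elt i j)) = (4%:R - 4%:R * n%:R) *: x.
Proof.
move=> sx; have sxE a b : x a b = - x b a.
  by have /matrixP/(_ b a) := sx; rewrite !mxE.
have tr0 : \tr x = 0.
  have : \tr x = - \tr x by rewrite -{1}mxtrace_tr sx raddfN.
  move/eqP; rewrite -subr_eq0 opprK -mulr2n mulrn_eq0 /=.
  by move/eqP.
have form i j : so_form x (so_elt i j) = - x i j.
  have tr a b : \tr (x *m delta_mx a b) = x b a.
    rewrite /mxtrace (bigD1 b) //= [X in _ + X]big1 ?addr0 => [|p pb].
      rewrite mxE (bigD1 a) //= [X in _ + X]big1 ?addr0 => [|q qa].
        by rewrite mxE !eqxx mulr1.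
      by rewrite mxE (negPf qa) mulr0.
    by rewrite mxE big1 // => q _; rewrite mxE (negPf pb) andbF mulr0.
  rewrite /so_form /so_elt mulmxBr linearB /= !tr (sxE j i).
  by field.
transitivity ((- 2%:R) *: \sum_i \sum_j x i j *: so_elt i j +
    (x *m (\sum_i \sum_j so_elt i j *m 1%:M *m so_elt i j) -
     2%:R *: (\sum_i \sum_j so_elt i j *m x *m so_elt i j) +
     (\sum_i \sum_j so_elt i j *m 1%:M *m so_elt i j) *m x)).
  rewrite !scaler_sumr mulmx_sumr mulmx_suml -sumrB -!big_split /=.
  apply: eq_bigr => i _; rewrite !scaler_sumr mulmx_sumr mulmx_suml -sumrB -!big_split /=.
  apply: eq_bigr => j _; rewrite form scalerA mulrN -mulNr; congr (_ + _).
  rewrite /lie_mx (mulmxBl (x *m _) (_ *m x)) (mulmxBr _ (x *m _) (_ *m x)) !mulmx1 !mulmxA scaler_nat mulr2n.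
  by rewrite opprB opprD !addrA [RHS]addrAC.
rewrite !so_elt_conj tr0 trmx1 mxtrace1 sx raddf0 subr0.
have -> : \sum_i \sum_j x i j *: so_elt i j = 2%:R *: x.
  transitivity (\sum_i \sum_j x i j *: (delta_mx i j : 'M[K]_n) -
      \sum_i \sum_j x i j *: (delta_mx j i : 'M[K]_n)).
    rewrite -sumrB; apply: eq_bigr => i _; rewrite -sumrB; apply: eq_bigr => j _.
    by rewrite scalerBr.
  rewrite -matrix_sum_delta exchange_big /=.
  rewrite (eq_bigr (fun j => - \sum_i x j i *: (delta_mx j i : 'M[K]_n))) => [|j _].
    by rewrite sumrN -matrix_sum_delta opprK scaler_nat mulr2n.
  by rewrite -sumrN; apply: eq_bigr => i _; rewrite sxE scaleNr.
rewrite -scalemxAr -scalemxAl mulmxBr mulmxBl mulmx1 mul1mx mul_mx_scalar mul_scalar_mx.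
by apply/matrixP => p q; rewrite !mxE; ring.
Qed.

End CasimirSo.

Lemma som0 (K : numFieldType) (n : nat) p (u : fock K ('I_n * nat)%type) :
  som 0 p u = 0.
Proof.
rewrite /som big1 ?scaler0 // => i _; rewrite big1 // => j _.
by rewrite mxE scale0r.
Qed.

(** * The basic vertex algebra as a module over the affine algebra *)

Section BasicVertexAlgebra.
Variables (K : numFieldType) (n : nat) (B : vertexAlgebra K) (rho : so_affine_rep n B).
Hypothesis B_P : is_basic_va rho.
Hypothesis n_gt2 : (2 < n)%N.
Local Notation F := (fock K ('I_n * nat)%type).
Local Notation vac := (va_vac B).
Implicit Types (u v w : B) (x y : 'M[K]_n) (p q : int) (i j : 'I_n).

Lemma rho_lin x p : so_mx x -> linear (rho x p).
Proof. exact: sact_linear. Qed.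

Lemma rhoK_lin : linear (sactK rho).
Proof. exact: sactK_linear. Qed.

Lemma rho_vac x p : so_mx x -> 0 <= p -> rho x p vac = 0.
Proof. by case: B_P => _ [_ H _] _; exact: H. Qed.

Lemma rhoK_vac : sactK rho vac = vac.
Proof. by case: B_P => _ [_ _ H] _. Qed.

Lemma va_Y_rho x p u : so_mx x -> va_Y (rho x (-1) vac) p u = rho x p u.
Proof. by case: B_P => _ _ H sx; apply: H. Qed.

Lemma so_mx0 : so_mx (0 : 'M[K]_n).
Proof. by rewrite /so_mx trmx0 oppr0. Qed.

Lemma so_mx_comb c x y : so_mx x -> so_mx y -> so_mx (c *: x + y).
Proof. by move=> sx sy; rewrite /so_mx linearP /= sx sy scalerN opprD. Qed.

Lemma so_mxZ c x : so_mx x -> so_mx (c *: x).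
Proof. by move=> sx; rewrite -[c *: x]addr0; apply: so_mx_comb => //; exact: so_mx0. Qed.

Lemma so_mxD x y : so_mx x -> so_mx y -> so_mx (x + y).
Proof. by move=> sx; rewrite -[x]scale1r; apply: so_mx_comb. Qed.

Lemma so_mx_sum (I : Type) (r : seq I) (G : I -> 'M[K]_n) :
  (forall l, so_mx (G l)) -> so_mx (\sum_(l <- r) G l).
Proof. by move=> sG; elim/big_ind: _ => //; [exact: so_mx0|exact: so_mxD]. Qed.

Lemma rho0 p u : rho 0 p u = 0.
Proof.
have := sact_linear_l rho p 1 u so_mx0 so_mx0.
rewrite scaler0 add0r scale1r => /eqP; rewrite -subr_eq0 opprD addrA subrr sub0r oppr_eq0.
by move/eqP.
Qed.

Lemma rhoZ c x p u : so_mx x -> rho (c *: x) p u = c *: rho x p u.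
Proof.
move=> sx; have := sact_linear_l rho p c u sx so_mx0.
by rewrite !addr0 rho0 addr0.
Qed.

Lemma rhoD x y p u : so_mx x -> so_mx y -> rho (x + y) p u = rho x p u + rho y p u.
Proof.
by move=> sx sy; have := sact_linear_l rho p 1 u sx sy; rewrite !scale1r.
Qed.

Lemma rho_sum (I : Type) (r : seq I) (G : I -> 'M[K]_n) p u :
  (forall l, so_mx (G l)) -> rho (\sum_(l <- r) G l) p u = \sum_(l <- r) rho (G l) p u.
Proof.
move=> sG; elim: r => [|i r IH]; first by rewrite !big_nil rho0.
by rewrite !big_cons rhoD ?IH //; exact: so_mx_sum.
Qed.

Lemma rhoK_id u : sactK rho u = u.
Proof.
have [[_ irr] [vac0 _ _] _] := B_P.
have [||H|->//] := irr [set u | sactK rho u = u]%classic.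
- split; first exact: lin0 rhoK_lin.
  by move=> c v w /= Hv Hw; rewrite rhoK_lin Hv Hw.
- move=> g v [[x [m [sx ->]]]|->] /= Hv; last by rewrite Hv.
  by rewrite sactK_central // Hv.
by case: vac0; apply: H; exact: rhoK_vac.
Qed.

Lemma rho_bracket x y p q u : so_mx x -> so_mx y ->
  rho x p (rho y q u) = rho y q (rho x p u) + (rho (lie_mx x y) (p + q) u
    + (if p + q == 0 then p%:~R * so_form x y else 0) *: u).
Proof.
by move=> sx sy; rewrite -{4}[u]rhoK_id -sact_bracket // addrC subrK.
Qed.

Lemma B_ind (Q : set B) : is_subspace Q -> Q vac ->
  (forall x p u, so_mx x -> Q u -> Q (rho x p u)) -> forall u, Q u.
Proof.
move=> Qs Qv Qr; have [[_ irr] [vac0 _ _] _] := B_P.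
have [|H|//] := irr Q Qs.
- by move=> g v [[x [m [sx ->]]]|->] Qv'; [exact: Qr|rewrite rhoK_id].
by case: vac0; apply: H.
Qed.

(** * The conformal grading *)

Definition omega : B := \sum_i \sum_j rho (so_elt K i j) (-1) (rho (so_elt K i j) (-1) vac).

Lemma lie_so x y : so_mx x -> so_mx y -> so_mx (lie_mx x y).
Proof. exact: lie_mx_so. Qed.

(** Commuting [x] through [omega] leaves sums weighted by entries of [x]; exchanging two summation
    indices changes their sign, because [x] is antisymmetric, and they cancel in pairs. *)
Lemma rho_omega0 x : so_mx x -> rho x 0 omega = 0.
Proof.
move=> sx; rewrite /omega (lin_sum (rho_lin 0 sx)).
have sX i j := so_elt_so K i j.
pose be i j k l := rho (so_elt K i j) (-1) (rho (so_elt K k l) (-1) vac).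
have sxE a b : x a b = - x b a by have /matrixP/(_ b a) := sx; rewrite !mxE.
transitivity (\sum_i \sum_j \sum_k
   ((x k i *: be i j k j + x k j *: be i j i k) + (x k i *: be k j i j + x k j *: be i k i j))).
  apply: eq_bigr => i _; rewrite (lin_sum (rho_lin 0 sx)); apply: eq_bigr => j _.
  have sXX k : so_mx (x k i *: so_elt K k j + x k j *: so_elt K i k).
    by apply: so_mx_comb => //; apply: so_mxZ.
  rewrite rho_bracket // [rho x 0 (rho _ _ vac)]rho_bracket // rho_vac // (lin0 (rho_lin _ (sX i j))).
  rewrite !scale0r !addr0 !add0r (lie_so_elt i j sx) !(rho_sum _ _ _ sXX).
  rewrite (lin_sum (rho_lin _ (sX i j))) -big_split; apply: eq_bigr => k _ /=.
  have s1 := so_mxZ (x k i) (sX k j); have s2 := so_mxZ (x k j) (sX i k).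
  rewrite !(fun p u => @rhoD _ _ p u s1 s2).
  rewrite !(fun p u => @rhoZ (x k i) _ p u (sX k j)).
  rewrite !(fun p u => @rhoZ (x k j) _ p u (sX i k)).
  by rewrite (linD (rho_lin _ (sX i j))) !(linZ (rho_lin _ (sX i j))).
have E1 : \sum_i \sum_j \sum_k x k i *: be k j i j = - \sum_i \sum_j \sum_k x k i *: be i j k j.
  rewrite -sumrN; under [RHS]eq_bigr do rewrite -sumrN.
  rewrite exchange_big [RHS]exchange_big; apply: eq_bigr => j _ /=.
  rewrite exchange_big; apply: eq_bigr => i _ /=.
  by rewrite -sumrN; apply: eq_bigr => k _; rewrite (sxE i k) scaleNr.
have E2 : \sum_i \sum_j \sum_k x k j *: be i k i j = - \sum_i \sum_j \sum_k x k j *: be i j i k.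
  rewrite -sumrN; apply: eq_bigr => i _; rewrite exchange_big -sumrN; apply: eq_bigr => j _.
  by rewrite -sumrN; apply: eq_bigr => k _; rewrite (sxE j k) scaleNr.
have split3 (G H : 'I_n -> 'I_n -> 'I_n -> B) : \sum_i \sum_j \sum_k (G i j k + H i j k) =
    \sum_i \sum_j \sum_k G i j k + \sum_i \sum_j \sum_k H i j k.
  rewrite -big_split; apply: eq_bigr => i _; rewrite -big_split; apply: eq_bigr => j _.
  by rewrite -big_split.
by rewrite !split3 E1 E2 addrACA !subrr addr0.
Qed.

Lemma so_form_lie x y : so_form (lie_mx x y) y = 0.
Proof.
rewrite /so_form /lie_mx mulmxBl linearB /= -[y *m x *m y]mulmxA [\tr (y *m _)]mxtrace_mulC.
by rewrite subrr mul0r.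
Qed.

Lemma rho_omega1 x : so_mx x ->
  rho x 1 omega = (4%:R - 4%:R * n%:R) *: rho x (-1) vac.
Proof.
move=> sx; rewrite -rhoZ // -casimir_so // /omega (lin_sum (rho_lin 1 sx)).
have sX i j := so_elt_so K i j.
have s1 i j : so_mx ((2%:R * so_form x (so_elt K i j)) *: so_elt K i j
    + lie_mx (lie_mx x (so_elt K i j)) (so_elt K i j)).
  by apply: so_mx_comb => //; do 2!apply: lie_so => //.
rewrite rho_sum => [|i]; last exact: so_mx_sum.
apply: eq_bigr => i _; rewrite (lin_sum (rho_lin 1 sx)) rho_sum //.
apply: eq_bigr => j _; have sl := lie_so sx (sX i j).
rewrite rho_bracket // [rho x 1 (rho _ _ vac)]rho_bracket // rho_vac //.
rewrite (lin0 (rho_lin _ (sX i j))) add0r.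
rewrite (_ : 1 + -1 = 0 :> int) // eqxx mul1r rho_vac // add0r.
rewrite [rho (lie_mx x _) 0 _]rho_bracket // rho_vac // (lin0 (rho_lin _ (sX i j))).
rewrite (_ : 0 + -1 == 0 :> int = false) // scale0r addr0 !add0r.
rewrite (@rhoD _ _ (-1) vac (so_mxZ _ (sX i j)) (lie_so sl (sX i j))).
rewrite (@rhoZ _ _ (-1) vac (sX i j)) (linZ (rho_lin _ (sX i j))).
by rewrite mulrDl mul1r scalerDl -!addrA; congr (_ + _); rewrite addrC.
Qed.

Lemma rho_omega_ge2 x (s : nat) : so_mx x -> (2 <= s)%N -> rho x s omega = 0.
Proof.
move=> sx s2; have sX i j := so_elt_so K i j.
rewrite /omega (lin_sum (rho_lin _ sx)) big1 // => i _.
rewrite (lin_sum (rho_lin _ sx)) big1 // => j _; have sl := lie_so sx (sX i j).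
rewrite rho_bracket // [rho x s (rho _ _ vac)]rho_bracket // rho_vac //.
rewrite (lin0 (rho_lin _ (sX i j))) add0r.
rewrite (_ : s%:Z + -1 == 0 = false) ?scale0r ?addr0; last by lia.
rewrite rho_vac //; last by lia.
rewrite (lin0 (rho_lin _ (sX i j))) add0r.
rewrite rho_bracket // rho_vac //; last by lia.
rewrite (lin0 (rho_lin _ (sX i j))) add0r so_form_lie mulr0 if_same scale0r addr0.
by rewrite rho_vac //; [exact: lie_so|lia].
Qed.

(** The operator L_0 of the Sugawara construction; [omega] is 4 - 4n times the conformal vector, by
    [casimir_so]. *)
Definition Bgrade u : B := (4%:R - 4%:R * n%:R)^-1 *: va_Y omega 1 u.

Lemma Bgrade_lin : linear Bgrade.
Proof. exact: lin_scale (va_linear (va_actionP B) _ _). Qed.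

Lemma casimir_neq0 : 4%:R - 4%:R * n%:R != 0 :> K.
Proof.
by rewrite -natrM subr_eq0 eqr_nat; move: n_gt2; lia.
Qed.

(** In the commutator formula for a current and [omega], only the product of order 1 survives, by
    [rho_omega0] and [rho_omega_ge2]; its binomial factor is p. *)
Lemma Bgrade_rho x p u : so_mx x ->
  Bgrade (rho x p u) = rho x p (Bgrade u) - p%:~R *: rho x p u.
Proof.
move=> sx; rewrite /Bgrade (linZ (rho_lin p sx)).
have [N0 /(_ (N0.+2)%N)] := va_commutator (va_actionP B) (rho x (-1) vac) omega u p 1.
rewrite leqW ?leqW // => /(_ isT).
rewrite !va_Y_rho // => E.
have {E} E : rho x p (va_Y omega 1 u) - va_Y omega 1 (rho x p u) =
    (p%:~R * (4%:R - 4%:R * n%:R)) *: rho x p u.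
  rewrite E big_ord_recl big_ord_recl big1 ?addr0 => [|j _]; last first.
    rewrite va_Y_rho // rho_omega_ge2 // (lin0 (va_linear_l (va_actionP B) _ _)).
    by rewrite scaler0.
  rewrite !va_Y_rho // rho_omega0 // (lin0 (va_linear_l (va_actionP B) _ _)) scaler0 add0r.
  rewrite (_ : lift _ _ = 1%N :> nat) // rho_omega1 // binz1.
  rewrite (linZ (va_linear_l (va_actionP B) _ _)) va_Y_rho // scalerA.
  by congr (_ *: rho _ _ _); rewrite addrK.
have -> : va_Y omega 1 (rho x p u) = rho x p (va_Y omega 1 u) -
    (p%:~R * (4%:R - 4%:R * n%:R)) *: rho x p u by rewrite -E opprB addrC subrK.
rewrite scalerBr; congr (_ - _); rewrite scalerA; congr (_ *: _).
by field; exact: casimir_neq0.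
Qed.

Lemma Bgrade_vac : Bgrade vac = 0.
Proof. by rewrite /Bgrade (va_creation omega).2 ?scaler0. Qed.

(** * The boson-fermion identification *)

Definition Fgrade : F -> F := dop 0 (Wpoly K 1 0).

(** [Fgrade] is W^1_0 = -(D + 1/2). Its commutator multiplies [psi i e] by -e - 1/2, the conformal
    weight of the mode, so it plays the role of L_0 on the fermions. *)
Lemma Fgrade_som x p (u : F) : so_mx x ->
  Fgrade (som x p u) = som x p (Fgrade u) - p%:~R *: som x p u.
Proof.
move=> sx; have dW := @Wpoly_dplus K 1 0 isT.
have fW := dop_fderiv n dW; have fx := som_fderiv p sx.
have Wx (e : int) : (Wpoly K 1 0).[e%:~R] = - e%:~R - 1 / 2.
  by rewrite Wpoly_horner !big_ord1 /=; field.
have sx' : so_mx ((- p%:~R) *: x) by exact: so_mxZ.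
have hZ : fderiv (som ((- p%:~R) *: x) p) (0 + p)
   (fun e => ((Wpoly K 1 0).[(e + p)%:~R])%:M *m x - x *m ((Wpoly K 1 0).[e%:~R])%:M).
  rewrite add0r; have := som_fderiv p sx'; congr fderiv; apply/funext => e.
  rewrite mul_scalar_mx mul_mx_scalar -scalerBl !Wx rmorphD /=; congr (_ *: _).
  by ring.
have E := fderiv_comm u fW fx hZ.
have [_ _ W1 W0] := fW; have [Xl _ _ _] := fx.
move: E; rewrite W1 // W0 // (lin0 Xl) fock0 subrr scale0r addr0 => E.
rewrite /Fgrade -(subrK (som x p (dop 0 (Wpoly K 1 0) u)) (dop 0 _ (som x p u))) E.
rewrite addrC; congr (_ + _).
by have := som_linear_l p (- p%:~R) x 0 u; rewrite addr0 => ->; rewrite som0 addr0 scaleNr.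
Qed.

(** [hw_iso] is applied to the even part of the Fock space, irreducible by [stable_vac] and
    [stable_even]. The label [None] stands for the central element, which acts by the identity on
    both sides. *)
Theorem basic_fermions : exists Phi : B -> F,
  [/\ linear Phi, injective Phi, forall u, fparity false (Phi u),
      forall v : F, fparity false v -> exists u, Phi u = v
    & Phi vac = fvac K ('I_n * nat)%type /\
      forall x p u, so_mx x -> Phi (rho x p u) = som x p (Phi u)].
Proof.
pose I := option ('M[K]_n * int).
pose ok (i : I) : Prop := if i is Some (x, p) then so_mx x else True.
pose deg (i : I) : int := if i is Some (x, p) then p else 0.
pose A1 (i : I) : B -> B := if i is Some (x, p) then rho x p else sactK rho.
pose A2 (i : I) : F -> F := if i is Some (x, p) then som x p else id.
have [[_ irr] [vac0 _ _] _] := B_P.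
have fv0 : fvac K ('I_n * nat)%type <> 0 by exact: fvac_neq0.
have [|||||||||||||||||f [fl fi fP fs [fv fA]]] := @hw_iso K B F I ok deg A1 A2 Bgrade Fgrade 0 vac
  (fvac K _) (fparity false).
- by move=> [[x p]|] //= sx; [exact: rho_lin|exact: rhoK_lin].
- by move=> [[x p]|] //= sx; exact: som_linear.
- exact: Bgrade_lin.
- exact: @dop_linear K n _ _ (@Wpoly_dplus K 1 0 isT).
- move=> [[x p]|] [[y q]|] //= sx sy.
  + exists (Some (lie_mx x y, p + q)), (if p + q == 0 then p%:~R * so_form x y else 0), None.
    split=> //=; first exact: lie_so.
      by move=> u; rewrite rhoK_id rho_bracket.
    by move=> u; rewrite -som_bracket // addrC subrK.
  + exists (Some (0, 0)), 0, None; split=> //=; first exact: so_mx0.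
      by move=> u; rewrite !rhoK_id rho0 scale0r !addr0.
    by move=> u; rewrite som0 scale0r !addr0.
  + exists (Some (0, 0)), 0, None; split=> //=; first exact: so_mx0.
      by move=> u; rewrite !rhoK_id rho0 scale0r !addr0.
    by move=> u; rewrite som0 scale0r !addr0.
  + exists (Some (0, 0)), 0, None; split=> //=; first exact: so_mx0.
      by move=> u; rewrite rho0 scale0r !addr0.
    by move=> u; rewrite som0 scale0r !addr0.
- move=> [[x p]|] //= sx p0; last by exists 1; rewrite rhoK_vac !scale1r.
  by exists 0; rewrite rho_vac // som_vac // !scale0r.
- by move=> [[x p]|] u //= sx _; exact: Bgrade_rho.
- by move=> [[x p]|] u //= sx _; exact: Fgrade_som.
- by rewrite Bgrade_vac scale0r.
- rewrite scale0r; have [_ _ _ W0] := dop_fderiv n (@Wpoly_dplus K 1 0 isT).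
  exact: W0.
- exact: vac0.
- exact: fv0.
- move=> Q Qs Qst; apply: irr => // g u [[x [p [sx ->]]]|->] Qu.
    exact: (Qst (Some (x, p))).
  exact: (Qst None).
- exact: fparity_subspace.
- by move=> [[x p]|] u //= sx hu; exact: fparity_som.
- exact: fparity_vac.
- move=> Q Qs Qst QP.
  have Qsom x p (u : F) : so_mx x -> Q u -> Q (som x p u) by move=> sx; exact: (Qst (Some (x, p))).
  have [[u [Qu u0]]|no] := pselect (exists u : F, Q u /\ u <> 0); last first.
    by left=> u Qu; apply: contrapT => u0; apply: no; exists u.
  right; apply: (stable_even n_gt2 Qs Qsom).
  exact: (stable_vac n_gt2 Qs Qsom Qu (QP _ Qu) u0).
exists f; split=> //; split=> // x p u sx.
exact: (fA (Some (x, p))).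
Qed.

End BasicVertexAlgebra.

(** * Finite differences and mutual locality of the W fields and the currents *)

Section FiniteDifferences.
Variable K : numFieldType.
Implicit Types (H : {poly K}).

Lemma size_difference H N : (size H <= N.+1)%N -> (size (H - (H \Po ('X + 1%:P)))%R <= N)%N.
Proof.
have sX : size ('X + 1%:P : {poly K}) = 2 by rewrite size_XaddC.
have [->|H0] := eqVneq H 0; first by rewrite comp_poly0 subrr size_poly0.
have sc : size (H \Po ('X + 1%:P)) = size H by rewrite size_comp_poly2 ?sX.
move=> HN; apply/leq_sizeP => i Ni; rewrite coefB.
have [Hi|iH] := leqP (size H) i; first by rewrite !nth_default ?subrr ?sc.
have iE : i = (size H).-1 by lia.
have := @lead_coef_comp _ H ('X + 1%:P).
rewrite sX lead_coefXaddC expr1n mulr1 => /(_ isT).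
by rewrite !lead_coefE sc -iE => ->; rewrite subrr.
Qed.

(** The difference H - H(X + 1) has smaller size, and Pascal's rule splits the alternating sum into
    that of this difference. *)
Lemma finite_difference N H : (size H <= N)%N ->
  \sum_(j < N.+1) (-1) ^+ j * 'C(N, j)%:R * H.[j%:R] = 0.
Proof.
elim: N H => [|N IH] H HN.
  by move: HN; rewrite leqn0 size_poly_eq0 => /eqP ->; rewrite big_ord1 horner0 mulr0.
rewrite -[RHS](IH _ (size_difference HN)).
pose G (j : nat) : K := (-1) ^+ j * 'C(N, j)%:R * H.[j%:R].
pose G' (j : nat) : K := (-1) ^+ j * 'C(N, j)%:R * H.[j.+1%:R].
transitivity (\sum_(j < N.+1) G j - \sum_(j < N.+1) G' j); last first.
  rewrite -sumrB; apply: eq_bigr => j _; rewrite hornerD hornerN horner_comp !hornerE natr1.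
  by rewrite /G /G'; ring.
rewrite [\sum_(j < N.+1) G j]big_ord_recl [LHS]big_ord_recl /= [X in _ + X = _](eq_bigr (fun j : 'I_N.+1 =>
    (if (j.+1 <= N)%N then G j.+1 else 0) - G' j)) => [|j _].
  rewrite sumrB addrA; congr (_ + _ - _).
    by rewrite /G !bin0.
  rewrite big_ord_recr /= ltnn addr0; apply: eq_bigr => j _.
  by rewrite ltn_ord.
rewrite /bump /= add1n binS natrD /G /G'.
have [jN|Nj] := ltnP j N; first by rewrite exprS; ring.
by rewrite bin_small ?add0r ?sub0r // exprS; ring.
Qed.

End FiniteDifferences.

Section Locality.
Variables (K : numFieldType) (n : nat).
Local Notation F := (fock K ('I_n * nat)%type).
Local Notation fvac := (fvac K ('I_n * nat)%type).
Implicit Types (u v : F) (x : 'M[K]_n) (k m p q r : int) (f : {poly K}) (d : nat).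

(* The coefficient of z^(-q-1) of the field W^d(z). *)
Definition Wop d q u : F := dop (q - d%:Z) (Wpoly K d (q - d%:Z)) u.

Lemma Wop_lin d q : odd d -> linear (Wop d q).
Proof. by move=> od; apply: dop_linear; apply: Wpoly_dplus. Qed.

Lemma Wop_psi d q i e u : odd d -> Wop d q (psi i e u) =
  psi i e (Wop d q u) + (Wpoly K d (q - d%:Z)).[e%:~R] *: psi i (e + (q - d%:Z)) u.
Proof. by move=> od; apply: dop_psi; apply: Wpoly_dplus. Qed.

Lemma dop_vac k f : dplus k f -> 0 <= k -> dop k f fvac = 0.
Proof. by move=> /(dop_fderiv n)[]. Qed.

(** For negative k = q - d, only the values of the polynomial at s = 0, ..., -k - 1 enter. As -k <=
    d, both products in [Wpoly] contain a zero factor there. *)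
Lemma Wop_vac d q : odd d -> 0 <= q -> Wop d q fvac = 0.
Proof.
move=> od q0; rewrite /Wop; set k := q - d%:Z.
have [k0|k0] := leP 0 k; first by apply: dop_vac => //; apply: Wpoly_dplus.
have [t tE] : exists t : nat, k = - t%:Z by exists `|k|%N; lia.
rewrite /dop big1 ?scaler0 // => i _; rewrite tE Qop_vac big1 // => s _.
have st := ltn_ord s; rewrite (_ : -1 - - s.+1%:Z = s%:Z); last by lia.
rewrite Wpoly_horner -signr_odd /= od /= expr0 mul1r.
have sd : (s < d)%N by move: tE; rewrite /k; lia.
rewrite (bigD1 (Ordinal sd)) //= subrr mul0r add0r.
have td : (t - s.+1 < d)%N by move: tE; rewrite /k; lia.
rewrite (bigD1 (Ordinal td)) //= (_ : s%:~R + _ = 0) ?mul0r ?mulr0 ?scale0r //.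
rewrite -rmorphD /= (_ : s%:Z + _ = 0) //; lia.
Qed.

(** The contraction pairs [x] with a scalar matrix and so involves only its diagonal entries, which
    are 0. *)
Lemma som_dop_coef x p k f : so_mx x -> dplus k f -> som x p (dop k f fvac) fset0 = 0.
Proof.
move=> sx df; have fx := som_fderiv p sx; have [Xl _ X1 _] := fx.
have [p0|p0] := leP p 0; first exact: X1.
have [k0|k0] := leP 0 k; first by rewrite dop_vac // (lin0 Xl) fock0.
have [t ->] : exists t : nat, k = - t%:Z by exists `|k|%N; lia.
rewrite /dop (linZ Xl) fockZ (lin_sum Xl) fock_sum big1 ?mulr0 // => i _.
rewrite (fderiv_Qop_vac_coef _ _ _ _ fx p0) big1 ?mulr0 // => a _.
have : x i i = - x i i by exact: so_mxE.
move/eqP; rewrite -subr_eq0 opprK -mulr2n mulrn_eq0 /= => /eqP ->.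
by rewrite mulr0.
Qed.

Lemma dop_som_coef x p k f : so_mx x -> dplus k f -> dop k f (som x p fvac) fset0 = 0.
Proof.
move=> sx df; have fd := dop_fderiv n df; have [Xl _ X1 _] := fd.
have [k0|k0] := leP k 0; first exact: X1.
have [p0|p0] := leP 0 p; first by rewrite som_vac // (lin0 Xl) fock0.
have [t ->] : exists t : nat, p = - t%:Z by exists `|p|%N; lia.
rewrite /som (linZ Xl) fockZ (lin_sum Xl) fock_sum big1 ?mulr0 // => i _.
rewrite (lin_sum Xl) fock_sum big1 // => j _; rewrite (linZ Xl) fockZ.
rewrite (fderiv_Qop_vac_coef _ _ _ _ fd k0).
have [->|ij] := eqVneq i j.
  have : x j j = - x j j by exact: so_mxE.
  move/eqP; rewrite -subr_eq0 opprK -mulr2n mulrn_eq0 /= => /eqP ->.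
  by rewrite mul0r.
by rewrite big1 ?mulr0 // => a _; rewrite mxE eq_sym (negPf ij) mulr0n mulr0.
Qed.

(* The coefficients of [[W_(m+N-j), x_(k+j)]] are polynomials in j of degree at
   most [d], hence are killed by N-th differences. *)
Lemma Wop_local d x N m k u : odd d -> so_mx x -> (d < N)%N ->
  \sum_(j < N.+1) ((-1) ^+ j * 'C(N, j)%:R) *:
    (Wop d (m + N%:Z - j%:Z) (som x (k + j%:Z) u)
     - (-1) ^+ N *: som x (N%:Z + k - j%:Z) (Wop d (m + j%:Z) u)) = 0.
Proof.
move=> od sx dN; pose c (j : nat) : K := (-1) ^+ j * 'C(N, j)%:R.
pose comm (j : nat) v := Wop d (m + N%:Z - j%:Z) (som x (k + j%:Z) v) -
  som x (k + j%:Z) (Wop d (m + N%:Z - j%:Z) v).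
pose D v : F := \sum_(j < N.+1) c j *: comm j v.
transitivity (D u).
  rewrite /D; under eq_bigr do rewrite scalerBr.
  under [RHS]eq_bigr do rewrite scalerBr.
  rewrite !sumrB; congr (_ - _).
  (* Reversing [j] gives the second sum the same modes as the first, and the sign (-1)^(N-j) (-1)^N
     is (-1)^j; what remains is a sum of commutators. *)
  rewrite (reindex_inj rev_ord_inj) /=; apply: eq_bigr => j _.
  have jN : (j <= N)%N by rewrite -ltnS.
  rewrite subSS scalerA.
  have -> : (-1) ^+ (N - j) * 'C(N, N - j)%:R * (-1) ^+ N = (-1) ^+ j * 'C(N, j)%:R :> K.
    rewrite bin_sub // mulrAC -exprD -[X in X * _]signr_odd.
    by rewrite oddD oddB // addbAC addbb addFb signr_odd.
  have -> : N%:Z + k - (N - j)%N%:Z = k + j%:Z by lia.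
  by have -> : m + (N - j)%N%:Z = m + N%:Z - j%:Z by lia.
have Wl q := @Wop_lin d q od; have Sl p := som_linear p sx.
have cl (j : nat) : linear (comm j) by apply: lin_sub; apply: lin_comp.
have Dl : linear D by apply: lin_bigsum => j; apply: lin_scale; exact: cl.
have Dpsi i e v : D (psi i e v) = psi i e (D v).
  pose h (j : nat) : K := (Wpoly K d (m + N%:Z - j%:Z - d%:Z)).[(e + (k + j%:Z))%:~R] -
    (Wpoly K d (m + N%:Z - j%:Z - d%:Z)).[e%:~R].
  have commE (j : nat) : comm j (psi i e v) = psi i e (comm j v) +
      h j *: \sum_l x l i *: psi l (e + k + m + N%:Z - d%:Z) v.
    rewrite /comm som_psi // (linD (Wl _)) !Wop_psi // (linD (Sl _)) som_psi //.
    rewrite (lin_sum (Wl _)) (linZ (Sl _) _ (psi i (e + _) v)) som_psi //.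
    rewrite (linB (psi_linear _ _)).
    rewrite (eq_bigr (fun l => x l i *: psi l (e + (k + j%:Z)) (Wop d (m + N%:Z - j%:Z) v) +
      (Wpoly K d (m + N%:Z - j%:Z - d%:Z)).[(e + (k + j%:Z))%:~R] *:
        (x l i *: psi l (e + k + m + N%:Z - d%:Z) v))) => [|l _]; last first.
      rewrite (linZ (Wl _)) Wop_psi // scalerDr; congr (_ + _).
      rewrite !scalerA mulrC; congr (_ *: psi _ _ _); ring.
    rewrite big_split /= -scaler_sumr.
    have -> : e + (m + N%:Z - j%:Z - d%:Z) + (k + j%:Z) = e + k + m + N%:Z - d%:Z by ring.
    rewrite /h scalerBl; apply: fockP => S; rewrite !(fockD, fockN, fockZ); ring.
  rewrite /D (lin_sum (psi_linear _ _)).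
  under eq_bigr do rewrite commE scalerDr scalerA.
  rewrite big_split /= -scaler_suml.
  rewrite [X in _ + X *: _](_ : _ = 0) ?scale0r ?addr0.
    by apply: eq_bigr => j _; rewrite (linZ (psi_linear _ _)).
  (* In [h j] the products [k1] and [k2] do not involve j, the shifts of mode and argument
     cancelling in [k1]; [p1] and [p2] have degree at most d in j. Since d < N, [finite_difference]
     applies. *)
  pose p1 : {poly K} := \prod_(i0 < d) ('X - (- (e + k - i0%:Z)%:~R)%:P).
  pose p2 : {poly K} := \prod_(i0 < d) ((e + m + N%:Z - d%:Z + i0.+1%:Z)%:~R%:P - 'X).
  pose k1 : K := \prod_(i0 < d) (e + k + m + N%:Z - d%:Z + i0.+1%:Z)%:~R.
  pose k2 : K := \prod_(i0 < d) (e - i0%:Z)%:~R.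
  pose H : {poly K} := - (1 / 2) *: (p1 + k1%:P - (k2%:P + p2)).
  have sp (g : 'I_d -> {poly K}) : (forall i0, size (g i0) = 2) ->
      (size (\prod_i0 g i0)%R <= d.+1)%N.
    move=> sg; apply: leq_trans (size_prod_leq _ _) _.
    rewrite (eq_bigr (fun=> 2%N)) => [|i0 _]; last exact: sg.
    by rewrite sum_nat_const cardT size_enum_ord; lia.
  have sp1 : (size p1 <= d.+1)%N by apply: sp => i0; exact: size_XsubC.
  have sp2 : (size p2 <= d.+1)%N.
    by apply: sp => i0; rewrite -opprB size_polyN size_XsubC.
  have sC (a : K) : (size a%:P <= d.+1)%N by apply: leq_trans (size_polyC_leq1 _) _.
  have sH : (size H <= N)%N.
    apply: leq_trans (size_scale_leq _ _) _; apply: leq_trans dN.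
    rewrite (leq_trans (size_polyD _ _)) // geq_max size_polyN.
    by rewrite !(leq_trans (size_polyD _ _)) // geq_max ?sp1 ?sp2 ?sC.
  rewrite -[RHS](finite_difference sH); apply: eq_bigr => j _; congr (_ * _).
  rewrite /h /H !Wpoly_horner -signr_odd /= od /= expr0 !mul1r.
  rewrite !hornerE /p1 /p2 !horner_prod -mulrBr; congr (_ * (_ + _ - (_ + _))).
  - by apply: eq_bigr => i0 _; rewrite !hornerE !(rmorphD, rmorphN) /= -!pmulrn; ring.
  - by apply: eq_bigr => i0 _; rewrite !(rmorphD, rmorphN) /= -!pmulrn; ring.
  - by apply: eq_bigr => i0 _; rewrite !(rmorphD, rmorphN) /= -!pmulrn; ring.
  - by apply: eq_bigr => i0 _; rewrite !hornerE !(rmorphD, rmorphN) /= -!pmulrn; ring.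
rewrite (psi_comm_scalar Dl Dpsi) /D fock_sum big1 ?scale0r // => j _.
rewrite fockZ /comm fockD fockN dop_som_coef ?som_dop_coef ?subrr ?mulr0 //.
- exact: Wpoly_dplus.
- exact: Wpoly_dplus.
Qed.

End Locality.

(** * The W fields as vertex operators of the basic vertex algebra *)

Section StateField.
Variables (K : numFieldType) (n : nat) (B : vertexAlgebra K) (rho : so_affine_rep n B).
Hypothesis B_P : is_basic_va rho.
Local Notation F := (fock K ('I_n * nat)%type).
Local Notation fvac := (fvac K ('I_n * nat)%type).
Local Notation vac := (va_vac B).
Variable Phi : B -> F.
Hypothesis Phi_lin : linear Phi.
Hypothesis Phi_vac : Phi vac = fvac.
Hypothesis Phi_rho : forall x p u, so_mx x -> Phi (rho x p u) = som x p (Phi u).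
Implicit Types (u v w : B) (x y : 'M[K]_n) (p q : int) (d : nat).

Lemma va_T_rho x p u : so_mx x ->
  va_T (rho x p u) = rho x p (va_T u) - p%:~R *: rho x (p - 1) u.
Proof.
move=> sx; have := va_T_covariant (rho x (-1) vac) u p; rewrite !(va_Y_rho B_P) //.
by move=> E; rewrite -E addrC subrK.
Qed.

Lemma Wpoly1N1 (e : K) : (Wpoly K 1 (0 - 1)).[e] = - e.
Proof. by rewrite Wpoly_horner !big_ord1 /= addr0 !subr0 expr2 mulrNN !mulr1 mul1r; field. Qed.

Lemma translation_som x p (u : F) : so_mx x ->
  Wop 1 0 (som x p u) = som x p (Wop 1 0 u) - p%:~R *: som x (p - 1) u.
Proof.
move=> sx; have dW := @Wpoly_dplus K 1 (0 - 1) isT.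
have fW := dop_fderiv n dW; have fx := som_fderiv p sx.
have sx' : so_mx ((- p%:~R) *: x) by exact: so_mxZ.
have hZ : fderiv (som ((- p%:~R) *: x) (p - 1)) (0 - 1 + p)
   (fun e => ((Wpoly K 1 (0 - 1)).[(e + p)%:~R])%:M *m x
       - x *m ((Wpoly K 1 (0 - 1)).[e%:~R])%:M).
  rewrite (_ : 0 - 1 + p = p - 1); last by ring.
  have := som_fderiv (p - 1) sx'; congr fderiv; apply/funext => e.
  rewrite mul_scalar_mx mul_mx_scalar -scalerBl !Wpoly1N1 rmorphD /=; congr (_ *: _).
  by ring.
have E := fderiv_comm u fW fx hZ.
have [_ _ W1 _] := fW; have [Xl _ _ _] := fx.
have W0 : dop (0 - 1) (Wpoly K 1 (0 - 1)) fvac = 0 by exact: (@Wop_vac K n 1 0).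
move: E; rewrite W1 // W0 // (lin0 Xl) fock0 subrr scale0r addr0 => E.
rewrite -[LHS](subrK (som x p (Wop 1 0 u))) {1}/Wop E.
rewrite addrC; congr (_ + _).
by have := som_linear_l (p - 1) (- p%:~R) x 0 u; rewrite addr0 => ->; rewrite som0 addr0 scaleNr.
Qed.

(** Both translations kill the vacuum and have the same commutators with the currents, which
    generate [B] from the vacuum. *)
Lemma Phi_T u : Phi (va_T u) = Wop 1 0 (Phi u).
Proof.
have Wl := @Wop_lin K n 1 0 isT.
move: u; apply: (B_ind B_P (Q := fun u => Phi (va_T u) = Wop 1 0 (Phi u))).
- split; first by rewrite (lin0 (va_T_linear (v := B))) !(lin0 Phi_lin) (lin0 Wl).
  by move=> c u v Hu Hv; rewrite (va_T_linear (v := B)) !Phi_lin Wl Hu Hv.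
- by rewrite va_T_vac (lin0 Phi_lin) Phi_vac Wop_vac.
- move=> x p u sx IH; rewrite va_T_rho // (linB Phi_lin) (linZ Phi_lin) !Phi_rho //.
  by rewrite IH translation_som.
Qed.

Lemma translation_Wop d q (u : F) : odd d -> q < 0 ->
  Wop 1 0 (Wop d q u) = Wop d q (Wop 1 0 u) - q%:~R *: Wop d (q - 1) u.
Proof.
move=> od q0; have dW := @Wpoly_dplus K 1 (-1) isT.
have dd := @Wpoly_dplus K d (q - d%:Z) od.
have := dop_bracket (n := n) u dW dd; rewrite Wpoly_translation.
rewrite /dcocycle (_ : -1 + (q - d%:Z) != 0); last by lia.
rewrite mul0r scale0r addr0 (_ : d%:Z + (q - d%:Z) = q); last by ring.
rewrite (_ : -1 + (q - d%:Z) = q - 1 - d%:Z); last by ring.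
rewrite (_ : q - d%:Z - 1 = q - 1 - d%:Z); last by ring.
have dopZ (c : K) (f : {poly K}) k (v : F) : dop k (c *: f) v = c *: dop k f v.
  have := dop_linear_l k c f 0 v; rewrite addr0 => ->.
  have := dop_linear_l k 1 0 0 v; rewrite scaler0 addr0 scale1r => /eqP.
  by rewrite -subr_eq0 opprD addrA subrr sub0r oppr_eq0 => /eqP ->; rewrite addr0.
rewrite (dopZ (- q%:~R) (Wpoly K d (q - 1 - d%:Z))).
move=> E; rewrite /Wop (_ : 0 - 1%:Z = -1) //.
by rewrite -[LHS](subrK (dop (q - d%:Z) (Wpoly K d (q - d%:Z)) (dop (-1) (Wpoly K 1 (-1)) u))) E
  addrC scaleNr.
Qed.

(** Translation covariance yields the mode -t - 2 on the vacuum from the mode -t - 1, after division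
    by t + 1. [Wop] obeys the same recursion, so agreement at -1 propagates. *)
Lemma Phi_state d w : odd d -> Phi w = Wop d (-1) fvac ->
  forall q, Phi (va_Y w q vac) = Wop d q fvac.
Proof.
move=> od wE q; have [q0|q0] := leP 0 q.
  by rewrite (va_creation w).2 // (lin0 Phi_lin) Wop_vac.
have [t ->] : exists t : nat, q = - t.+1%:Z by exists `|q|.-1; lia.
elim: t => [|t IH] {q q0}; first by rewrite (va_creation w).1.
have := va_T_covariant w vac (- t.+1%:Z); rewrite va_T_vac.
rewrite (lin0 (va_linear (va_actionP B) _ _)) subr0 => /(congr1 Phi).
have E0 : Wop 1 0 fvac = 0 by exact: Wop_vac.
rewrite Phi_T IH [X in X = _]translation_Wop // E0 (lin0 (Wop_lin _ od)) sub0r.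
rewrite (linN Phi_lin) (linZ Phi_lin) => /oppr_inj /eqP.
rewrite -subr_eq0 -scalerBr scaler_eq0 intr_eq0 /= subr_eq0 => /eqP.
by have -> : - t.+1%:Z - 1 = - t.+2%:Z by lia.
Qed.

(* Goddard's uniqueness argument. *)
Theorem Phi_field d w : odd d -> Phi w = Wop d (-1) fvac ->
  forall q u, Phi (va_Y w q u) = Wop d q (Phi u).
Proof.
move=> od wE q u; have Yl := va_linear (va_actionP B) w.
have Wl q' := @Wop_lin K n d q' od.
pose Q u := forall q, Phi (va_Y w q u) = Wop d q (Phi u).
suff : Q u by apply.
move: u; apply: (B_ind B_P (Q := Q)).
- split=> [q'|c u v Hu Hv q'].
    by rewrite (lin0 (Yl _)) !(lin0 Phi_lin) (lin0 (Wl _)).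
  by rewrite Yl !Phi_lin Wl Hu Hv.
- by move=> q'; rewrite Phi_vac; apply: Phi_state.
move=> x p u sx Qu; pose a := rho x (-1) vac.
have [N1 loc] := va_locality (va_actionP B) (@va_trunc K B) w a.
(* One order of locality for both sides: at least N1 for the vertex algebra, and above d for
   [Wop_local]. *)
pose N := (N1 + d.+1)%N.
(* The discrepancy on [rho x p' u]. Subtracting the two locality relations expresses it through
   discrepancies with larger p'; these vanish once p' is large enough for x t^p' to kill [u], so a
   descending induction on p' gives 0. *)
pose D p' q' := Phi (va_Y w q' (rho x p' u)) - Wop d q' (som x p' (Phi u)).
have Drec p' q' : D p' q' = - \sum_(j < N) ((-1) ^+ j.+1 * 'C(N, j.+1)%:R) *:
    D (p' + j.+1%:Z) (q' - j.+1%:Z).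
  have := loc N (leq_addr _ _) u (q' - N%:Z) p'.
  move/(congr1 Phi); rewrite (lin_sum Phi_lin) (lin0 Phi_lin) => E1.
  have E2 : \sum_(j < N.+1) ((-1) ^+ j * 'C(N, j)%:R) *:
     (Wop d (q' - N%:Z + N%:Z - j%:Z) (som x (p' + j%:Z) (Phi u))
     - (-1) ^+ N *: som x (N%:Z + p' - j%:Z) (Wop d (q' - N%:Z + j%:Z) (Phi u))) = 0.
    by apply: Wop_local => //; rewrite /N; lia.
  have : \sum_(j < N.+1) ((-1) ^+ j * 'C(N, j)%:R) *: D (p' + j%:Z) (q' - j%:Z) = 0.
    rewrite -[RHS](subrr (0 : F)) -[X in _ = X - _]E1 -[X in _ = _ - X]E2 -sumrB; apply: eq_bigr => j _.
    rewrite (linZ Phi_lin) -scalerBr; congr (_ *: _).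
    rewrite (linB Phi_lin) (linZ Phi_lin) !(va_Y_rho B_P) // !Phi_rho // Qu.
    by rewrite subrK /D opprB addrA subrK.
  rewrite big_ord_recl /= bin0 expr0 mulr1 scale1r !addr0 ?subr0.
  by move/eqP; rewrite addr_eq0 => /eqP.
have [P0 hP0] : exists P0 : int, forall p', P0 <= p' -> rho x p' u = 0.
  have [_ _ H _ _] := va_actionP B; have [P0 hP] := H a u.
  by exists P0 => p' hp; rewrite -(va_Y_rho B_P) //; apply: hP.
have Dbig p' q' : P0 <= p' -> D p' q' = 0.
  move=> hp; rewrite /D -Phi_rho // hP0 // (lin0 (Yl _)) !(lin0 Phi_lin).
  by rewrite (lin0 (Wl _)) subrr.
have Dzero (t : nat) : forall p' q', P0 - t%:Z <= p' -> D p' q' = 0.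
  elim: t => [|t IH] p' q' hp; first by apply: Dbig; lia.
  rewrite Drec big1 ?oppr0 // => j _; rewrite IH ?scaler0 //; lia.
move=> q'; rewrite Phi_rho //; apply/eqP; rewrite -subr_eq0; apply/eqP.
by apply: (Dzero `|(P0 - p)%R|%N); lia.
Qed.

End StateField.

(** * The vertex algebra of invariants inside the Fock space *)

Section InvariantModel.
Variables (K : numFieldType) (n : nat) (W : vertexAlgebra K).
Hypothesis W_P : is_so_invariants_va n W.
Hypothesis n_gt2 : (2 < n)%N.
Local Notation F := (fock K ('I_n * nat)%type).
Local Notation fvac := (fvac K ('I_n * nat)%type).

(** The last clause tests a single state: by [Phi_field], an invariant sent to the state of W^d(z)
    has W^d(z) as its vertex operator. *)
Theorem invariants_fermions : exists Psi : W -> F,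
  [/\ linear Psi, injective Psi,
      forall y : F, (exists w, Psi w = y) <-> fparity false y /\ so_inv y,
      Psi (va_vac W) = fvac
    & forall (d : nat) (w : W), odd d -> Psi w = Wop d (-1) fvac ->
        forall q u, Psi (va_Y w q u) = Wop d q (Psi u)].
Proof.
have [B [rho [iota [B_P [il iv iY] ii inv]]]] := W_P.
have [Phi [Pl Pi Pp Ps [Pv Pr]]] := basic_fermions B_P n_gt2.
exists (fun w => Phi (iota w)); split.
- exact: lin_comp.
- by move=> w w' /Pi/ii.
- move=> y; split=> [[w <-]|[yp yi]].
    split=> //; apply/so_invP => x sx; rewrite -Pr //.
    by rewrite ((inv (iota w)).2 (ex_intro _ w erefl)) // (lin0 Pl).
  have [u uE] := Ps _ yp; subst y.
  have [|w ->] := (inv u).1; last by exists w.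
  move=> x sx; apply: Pi; rewrite Pr // (lin0 Pl).
  by have /so_invP := yi; apply.
- by rewrite iv.
- move=> d w od wE q u; rewrite iY.
  exact: (Phi_field B_P Pl Pv Pr od wE).
Qed.

End InvariantModel.

(** * The decomposition *)

Section DPlusRepresentations.
Variables (K : numFieldType) (M : lmodType K) (rho : dplus_rep M).
Implicit Types (k : int) (f g : {poly K}) (u v : M).

Lemma dplus0 k : dplus k (0 : {poly K}).
Proof. by apply: dplusP => x; rewrite !horner0 oppr0. Qed.

Lemma dact0 k u : rho k 0 u = 0.
Proof.
have := dact_linear_l rho 1 u (dplus0 k) (dplus0 k).
rewrite scaler0 addr0 scale1r => /eqP.
by rewrite -subr_eq0 opprD addrA subrr sub0r oppr_eq0 => /eqP.
Qed.

Lemma dactZ k c f u : dplus k f -> rho k (c *: f) u = c *: rho k f u.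
Proof.
by move=> df; have := dact_linear_l rho c u df (dplus0 k); rewrite !addr0 dact0 addr0.
Qed.

Lemma dplus_ind k (P : set M) u : is_subspace P ->
  (forall m, odd m -> P (Wact rho m k u)) -> forall f, dplus k f -> P (rho k f u).
Proof.
move=> Ps PW; apply: Wpoly_span => //; first by rewrite dact0; exact: sub0.
move=> c f g df dg Pf Pg; rewrite dact_linear_l //; exact: Ps.2.
Qed.

Lemma dplus_grading k f u : dplus k f ->
  rho 0 (Wpoly K 1 0) (rho k f u) = rho k f (rho 0 (Wpoly K 1 0) u)
    - k%:~R *: rho k f u + dcocycle 0 k (Wpoly K 1 0) f *: dactC rho u.
Proof.
move=> df; have dW := @Wpoly_dplus K 1 0 isT.
have E : dbracket 0 k (Wpoly K 1 0) f = (- k%:~R) *: f.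
  apply: poly_horner_ext => x.
  have Wx (y : K) : (Wpoly K 1 0).[y] = - y - 1 / 2.
    by rewrite Wpoly_horner !big_ord1 /=; field.
  move: (Wpoly K 1 0) Wx => w Wx.
  by rewrite /dbracket !(hornerE, horner_comp) !Wx; ring.
have := dact_bracket rho u dW df; rewrite E add0r (@dactZ k (- k%:~R) f u df) scaleNr => E'.
by rewrite -[LHS](subrK (rho k f (rho 0 (Wpoly K 1 0) u))) E' addrAC [X in X + _]addrC.
Qed.

Hypothesis rho_irr : dplus_irreducible rho.

Lemma dactC_scalar c v u : v <> 0 -> dactC rho v = c *: v -> dactC rho u = c *: u.
Proof.
move=> v0 vc; have [_ irr] := rho_irr.
have Cl := dactC_linear rho.
have [||H|->//] := irr [set u | dactC rho u = c *: u]%classic.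
- split; first by rewrite /= (lin0 Cl) scaler0.
  by move=> a x y /= Hx Hy; rewrite Cl Hx Hy scalerDr !scalerA mulrC.
- move=> g x [[k [f [df ->]]]|->] /= Hx.
    by rewrite dactC_central // Hx (linZ (dact_linear rho df)).
  by rewrite Hx (linZ Cl) Hx.
by case: v0; apply: H.
Qed.

End DPlusRepresentations.

Section DPlusIso.
Variables (K : numFieldType) (M N : lmodType K).
Variables (rho : dplus_rep M) (sigma : dplus_rep N).
Hypothesis rho_irr : dplus_irreducible rho.
Variables (v : M) (w : N) (c : K) (wt : int -> {poly K} -> K) (P : set N).
Hypothesis v0 : v <> 0.
Hypothesis w0 : w <> 0.
Hypothesis v_wt : forall k f, dplus k f -> 0 <= k -> rho k f v = wt k f *: v.
Hypothesis w_wt : forall k f, dplus k f -> 0 <= k -> sigma k f w = wt k f *: w.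
Hypothesis v_c : dactC rho v = c *: v.
Hypothesis w_c : forall u, dactC sigma u = c *: u.
Hypothesis P_sub : is_subspace P.
Hypothesis P_stable : forall k f u, dplus k f -> P u -> P (sigma k f u).
Hypothesis P_w : P w.
Hypothesis P_irr : forall Q : set N, is_subspace Q ->
  (forall k f u, dplus k f -> Q u -> Q (sigma k f u)) ->
  (forall u, Q u -> P u) ->
  (forall u, Q u -> u = 0) \/ (forall u, P u -> Q u).

Theorem dplus_iso : exists g : M -> N,
  [/\ linear g, injective g, forall x, P (g x), forall y, P y -> exists x, g x = y
    & g v = w /\ forall k f x, dplus k f -> g (rho k f x) = sigma k f (g x)].
Proof.
pose I := option (int * {poly K}).
pose ok (i : I) : Prop := if i is Some (k, f) then dplus k f else True.
pose deg (i : I) : int := if i is Some (k, f) then k else 0.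
pose A1 (i : I) : M -> M := if i is Some (k, f) then rho k f else dactC rho.
pose A2 (i : I) : N -> N := if i is Some (k, f) then sigma k f else dactC sigma.
have dW := @Wpoly_dplus K 1 0 isT.
have Cs u := dactC_scalar rho_irr u v0 v_c.
have [_ irr] := rho_irr.
have [|||||||||||||||||f [fl fi fP fs [fv fA]]] := @hw_iso K M N I ok deg A1 A2
  (rho 0 (Wpoly K 1 0)) (sigma 0 (Wpoly K 1 0)) (wt 0 (Wpoly K 1 0)) v w P.
- by move=> [[k f]|] //= ?; [exact: dact_linear|exact: dactC_linear].
- by move=> [[k f]|] //= ?; [exact: dact_linear|exact: dactC_linear].
- exact: dact_linear.
- exact: dact_linear.
- move=> [[r f]|] [[s g]|] //= df dg.
  + exists (Some (r + s, dbracket r s f g)), (dcocycle r s f g), None.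
    split=> //=; first exact: dplus_dbracket.
      by move=> u; rewrite -dact_bracket // addrC subrK.
    by move=> u; rewrite -dact_bracket // addrC subrK.
  + exists (Some (0, 0)), 0, None; split=> //=; first exact: dplus0.
      by move=> u; rewrite dactC_central // dact0 scale0r !addr0.
    by move=> u; rewrite dactC_central // dact0 scale0r !addr0.
  + exists (Some (0, 0)), 0, None; split=> //=; first exact: dplus0.
      by move=> u; rewrite dactC_central // dact0 scale0r !addr0.
    by move=> u; rewrite dactC_central // dact0 scale0r !addr0.
  + exists (Some (0, 0)), 0, None; split=> //=; first exact: dplus0.
      by move=> u; rewrite dact0 scale0r !addr0.
    by move=> u; rewrite dact0 scale0r !addr0.
- move=> [[k f]|] //= df k0; last by exists c; rewrite v_c w_c.
  by exists (wt k f); rewrite v_wt // w_wt.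
- move=> [[k f]|] u //= df k0; rewrite dplus_grading // /dcocycle add0r.
  by rewrite (_ : k != 0) ?scale0r ?addr0 //; lia.
- move=> [[k f]|] u //= df k0; rewrite dplus_grading // /dcocycle add0r.
  by rewrite (_ : k != 0) ?scale0r ?addr0 //; lia.
- exact: v_wt.
- exact: w_wt.
- exact: v0.
- exact: w0.
- move=> Q Qs Qst; apply: irr => // g u [[k [f [df ->]]]|->] Qu.
    exact: (Qst (Some (k, f))).
  exact: (Qst None).
- exact: P_sub.
- move=> [[k f]|] u //= df Pu; first exact: P_stable.
  by rewrite w_c; exact: subZ.
- exact: P_w.
- move=> Q Qs Qst QP; apply: P_irr => // k f u df.
  exact: (Qst (Some (k, f))).
by exists f; split=> //; split=> // k g x dg; exact: (fA (Some (k, g))).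
Qed.

End DPlusIso.

(** * The highest weight attached to the exponent 1 with multiplicity 2l *)

Section DeterminantWeight.
Variables (K : numFieldType) (l : nat).

(** The difference of the expansions of (1/2 + 1/2)^N and (1/2 - 1/2)^N; coefficientwise this is 2
    sinh(x/2)^2 = cosh x - 1. *)
Lemma odd_binomial_sum (N : nat) : (0 < N)%N ->
  \sum_(i < N.+1) (if odd i then 'C(N, i)%:R else 0) * (1 / 2) ^+ N * 2%:R = 1 :> K.
Proof.
move=> N0; have E1 := exprDn (1 / 2 : K) (1 / 2) N.
have E2 := exprBn (1 / 2 : K) (1 / 2) N.
rewrite subrr expr0n eqn0Ngt N0 /= in E2.
have h : 1 / 2 + 1 / 2 = 1 :> K by field.
rewrite h expr1n in E1.
rewrite -[RHS]subr0 [X in _ = X - _]E1 [X in _ = _ - X]E2 -sumrB; apply: eq_bigr => i _.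
have iN : (i <= N)%N by rewrite -ltnS.
have e : (1 / 2 : K) ^+ (N - i) * (1 / 2) ^+ i = (1 / 2) ^+ N by rewrite -exprD subnK.
move: ((1 / 2 : K) ^+ (N - i)) ((1 / 2 : K) ^+ i) ((1 / 2 : K) ^+ N) e => A B C <-.
rewrite -[(-1) ^+ i]signr_odd -[A * B *+ _]mulr_natr -[X in _ - X]mulr_natr.
move: ('C(N, i)%:R : K) => D.
by case: (odd i); rewrite ?expr1 ?expr0; ring.
Qed.

(** As 2 sinh(x/2)^2 = cosh x - 1, the quotient defining the weight is 2l sinh(x/2), whose
    coefficients are those of [x0]. *)
Lemma weight_det (xi : nat -> K) : weight_of_exponents (e_det K l) xi ->
  forall m, odd m -> xi m = (l.*2)%:R * (- (1 / 2)) ^+ m.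
Proof.
move=> xiW; have f0 (i : nat) : i`!%:R != 0 :> K by rewrite pnatr_eq0 -lt0n fact_gt0.
pose x0 m : K := (l.*2)%:R * (- (1 / 2)) ^+ m.
have x0W : weight_of_exponents (e_det K l) x0.
  move=> N; rewrite /e_det big_seq1 /= mul2n /series_mul /cosh_series /sinh_series.
  have [oN|eN] := boolP (odd N).
    rewrite big1 => [|i _].
      by rewrite (_ : N == 0%N = false) ?subrr ?mulr0 //; case: N oN.
    have iN : (i <= N)%N by rewrite -ltnS.
    by rewrite oddB // oN /=; case: (odd i); rewrite /= ?mulr0 ?mul0r.
  have [->|N0] := posnP N.
    by rewrite big_ord1 /= mul0r expr0 fact0 divr1 subrr mulr0.
  rewrite subr0.
  rewrite expr1n -[X in _ * (X / _)](odd_binomial_sum N0) mulr_suml mulr_sumr.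
  apply: eq_bigr => i _; have iN : (i <= N)%N by rewrite -ltnS.
  rewrite oddB // (negPf eN) /=; have [oi|ei] := boolP (odd i); last by rewrite !mul0r mulr0.
  have -> : 'C(N, i)%:R = N`!%:R / (i`!%:R * (N - i)`!%:R) :> K.
    by apply: (mulIf (mulf_neq0 (f0 i) (f0 (N - i)%N))); rewrite divfK ?mulf_neq0 // -!natrM bin_fact.
  rewrite /x0 exprNn -signr_odd oi expr1.
  have -> : (1 / 2 : K) ^+ N = (1 / 2) ^+ i * (1 / 2) ^+ (N - i) by rewrite -exprD subnKC.
  by field; rewrite !f0.
(* Uniqueness of the quotient: in degree m + 1 the last unknown is [xi m], multiplied by the
   coefficient 2 * (1/2) = 1 of x in 2 sinh(x/2). *)
move=> m; elim/ltn_ind: m => m IH om.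
have := xiW m.+1; rewrite -(x0W m.+1) /series_mul.
rewrite big_ord_recr [RHS]big_ord_recr /= subnn /sinh_series /= !mulr0 !addr0.
rewrite big_ord_recr [RHS]big_ord_recr /= subSnn /= om (_ : 1`! = 1%N) // expr1.
rewrite (eq_bigr (fun i : 'I_m => (if odd i then - (x0 i / i`!%:R) else 0) *
    (2 * (if odd (m.+1 - i) then (1 / 2) ^+ (m.+1 - i) / (m.+1 - i)`!%:R else 0)))) => [|i _].
  move/addrI; rewrite (_ : 2 * (1 / 2 / 1) = 1 :> K); last by field.
  by rewrite !mulr1 => /oppr_inj /(divIf (f0 m)).
by case: ifP => // oi; rewrite /x0 IH.
Qed.

End DeterminantWeight.

(** * Transport of the vertex algebra structures through the Fock space *)

Section Main.
Variables (K : numFieldType) (l : nat).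
Hypothesis l_gt1 : (1 < l)%N.
Local Notation n := l.*2.
Local Notation F := (fock K ('I_n * nat)%type).
Local Notation fvac := (fvac K ('I_n * nat)%type).

Lemma fock_rep_bracket r s (f g : {poly K}) (u : F) : dplus r f -> dplus s g ->
  dop r f (dop s g u) - dop s g (dop r f u) =
  dop (r + s) (dbracket r s f g) u + dcocycle r s f g *: (l%:R *: u).
Proof.
move=> df dg; rewrite dop_bracket // scalerA; congr (_ + (_ * _) *: _).
by rewrite -muln2 natrM mulfK // pnatr_eq0.
Qed.

Definition fock_rep : dplus_rep F.
Proof.
refine (@DplusRep K F (@dop K n) (fun u => l%:R *: u) _ _ _ _ _).
- exact: dop_linear.
- exact: lin_scale (@lin_id _ _).
- by move=> k a f g u _ _; exact: dop_linear_l.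
- exact: fock_rep_bracket.
- by move=> k f u df; rewrite (linZ (dop_linear df)).
Defined.

Lemma n_gt0 : (0 < n)%N. Proof. by lia. Qed.
Lemma n_gt2 : (2 < n)%N. Proof. by lia. Qed.
Lemma n_even : ~~ odd n. Proof. by rewrite odd_double. Qed.

Local Notation i0 := (Ordinal n_gt0).
Local Notation inv := (@inv_module K n i0).

Lemma dplus_inv_iso (M : lmodType K) (rho : dplus_rep M) (eps : bool) (v : M) :
  dplus_irreducible rho -> v <> 0 ->
  (forall k f, dplus k f -> 0 <= k -> rho k f v = inv_weight n eps k f *: v) ->
  dactC rho v = l%:R *: v ->
  exists g : M -> F,
  [/\ linear g, injective g, forall x, inv eps (g x),
      forall y, inv eps y -> exists x, g x = y
    & g v = inv_hw K n eps /\ forall k f x, dplus k f -> g (rho k f x) = dop k f (g x)].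
Proof.
move=> irr v0 vw vc.
apply: (@dplus_iso K M F rho fock_rep irr v (inv_hw K n eps) l%:R (inv_weight n eps) (inv eps)) => //.
- rewrite /inv_hw; case: (eps); first exact: (@fdet_neq0 K n).
  exact: fvac_neq0.
- by move=> k f df k0; apply: dop_inv_hw => //; exact: n_even.
- exact: inv_module_subspace.
- by move=> k f u df; exact: inv_module_dop.
- exact: inv_hwP n_even _.
- by move=> Q Qs Qd QP; apply: inv_module_irreducible => //; exact: n_even.
Qed.

Variables (WD : vertexAlgebra K) (V : vertexAlgebra K) (rhoV : dplus_rep V).
Variables (L : lmodType K) (rhoL : dplus_rep L).
Hypothesis WD_P : is_WD l WD.
Hypothesis V_P : is_Vc l%:R rhoV.
Hypothesis L_P : is_L (e_det K l) l%:R rhoL.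

Local Notation wV d := (Wact rhoV d (- d.+1%:Z) (va_vac V)).

Lemma V_iso : exists g : V -> F,
  [/\ linear g, injective g, forall x, inv false (g x),
      forall y, inv false y -> exists x, g x = y
    & g (va_vac V) = fvac /\ forall k f x, dplus k f -> g (rhoV k f x) = dop k f (g x)].
Proof.
have [irr [vac0 vacW vacC] _ _] := V_P.
apply: (dplus_inv_iso (eps := false)) => // k f df k0; rewrite scale0r.
apply: (@dplus_ind K V rhoV k (fun u => u = 0) (va_vac V) _ _ f df).
- by split=> // a x y -> ->; rewrite scaler0 addr0.
- by move=> m om; apply: vacW => //; lia.
Qed.

Lemma L_iso : exists g : L -> F,
  [/\ linear g, injective g, forall x, inv true (g x),
      forall y, inv true y -> exists x, g x = y
    & forall k f x, dplus k f -> g (rhoL k f x) = dop k f (g x)].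
Proof.
have [irr [v [xi [v0 vpos vxi vC xiW]]]] := L_P.
have xiE := weight_det xiW.
have [|g [gl gi gP gs [_ gr]]] := dplus_inv_iso (eps := true) irr v0 _ vC; last by exists g.
move=> k f df k0; rewrite /inv_weight /=.
have [k1|k1] := eqVneq k 0; last first.
  by rewrite vpos ?scale0r //; lia.
subst k; pose P (f : {poly K}) := rhoL 0 f v = (n%:R * f.[-1]) *: v.
suff : P f by [].
(* The highest weight is prescribed only on odd powers of D + 1/2; having all odd degrees, they span
   the degree 0 part by [dplus_span]. At D = -1 such a power is (-1/2)^m, in agreement with
   [weight_det]. *)
pose p (m : nat) : {poly K} := ('X + (1 / 2)%:P) ^+ m.
have pE (m : nat) (x : K) : (p m).[x] = (x + 1 / 2) ^+ m by rewrite /p !hornerE.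
apply: (@dplus_span K 0 p P) => //.
- move=> m om; split; last first.
    by rewrite /p -[(1 / 2)%:P]opprK -polyCN size_exp_XsubC.
  apply: dplusP => x; rewrite !pE (_ : -1 - 0%:~R - x + 1 / 2 = - (x + 1 / 2)).
    by rewrite exprNn -signr_odd om expr1 mulN1r.
  by field.
- by rewrite /P dact0 horner0 mulr0 scale0r.
- move=> c f1 f2 d1 d2 P1 P2; rewrite /P dact_linear_l // P1 P2 !hornerE scalerA -scalerDl.
  by congr (_ *: _); ring.
- move=> m om; rewrite /P vxi // xiE // pE; congr (_ * _ ^+ m *: _).
  by field.
Qed.

Theorem WD_decomposition :
  exists YL : va_module V L,
    [/\ compatible_module rhoV rhoL YL,
        va_module_irreducible YL
      & exists phi : V -> WD,
          [/\ va_hom phi, injective phi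
            & exists f : V * L -> WD,
                [/\ linear f, bijective f
                  & forall (a : V) (n : int) (b : V) (u : L),
                      f (va_Y a n b, YL a n u) =
                      va_Y (phi a) n (f (b, u))]]].
Proof.
have [Psi [Psl Psi_inj PsS Psv PsW]] := invariants_fermions WD_P n_gt2.
have [gV [gVl gVi gVP gVs [gVv gVr]]] := V_iso.
have [gL [gLl gLi gLP gLs gLr]] := L_iso.
have [irrV [vac0 vacW vacC] _ VW] := V_P.
have [irrL [v [xi [v0 _ _ vC _]]]] := L_P.
have CV := fun u => dactC_scalar irrV u vac0 vacC.
have CL := fun u => dactC_scalar irrL u v0 vC.
have invW eps y : inv eps y -> exists w, Psi w = y.
  by move=> [y1 y2 _]; apply/PsS.
have /choice[phi phiE] : forall a, exists w, Psi w = gV a by move=> a; apply: invW (gVP a).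
have /choice[phiL phiLE] : forall u, exists w, Psi w = gL u by move=> u; apply: invW (gLP u).
have phil : linear phi by move=> a x y; apply: Psi_inj; rewrite Psl !phiE gVl.
have phiLl : linear phiL by move=> a x y; apply: Psi_inj; rewrite Psl !phiLE gLl.
have phi_inj : injective phi by move=> x y E; apply: gVi; rewrite -!phiE E.
have phiL_inj : injective phiL by move=> x y E; apply: gLi; rewrite -!phiLE E.
have phiv : phi (va_vac V) = va_vac WD by apply: Psi_inj; rewrite phiE gVv Psv.
have degE (d : nat) : - d.+1%:Z = -1 - d%:Z by lia.
have phiW d : odd d -> Psi (phi (wV d)) = Wop d (-1) fvac.
  move=> od; rewrite phiE /Wact gVr ?gVv; last exact: Wpoly_dplus.
  by rewrite /Wop degE.
have fieldW d : odd d -> forall q u, Psi (va_Y (phi (wV d)) q u) = Wop d q (Psi u).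
  by move=> od; apply: PsW => //; exact: phiW.
have fieldV d : odd d -> forall q b, gV (va_Y (wV d) q b) = Wop d q (gV b).
  move=> od q b; have := VW d (q - d%:Z) od b; rewrite subrK => ->.
  by rewrite /Wact gVr //; exact: Wpoly_dplus.
have phi_field d : odd d -> forall q b,
    phi (va_Y (wV d) q b) = va_Y (phi (wV d)) q (phi b).
  by move=> od q b; apply: Psi_inj; rewrite phiE fieldV // fieldW // phiE.
have V_ind (Q : set V) : is_subspace Q -> Q (va_vac V) ->
    (forall d q a, odd d -> Q a -> Q (va_Y (wV d) q a)) -> forall a, Q a.
  move=> Qs Qv QW; have [_ irr] := irrV.
  have [|H|//] := irr Q Qs; last by case: vac0; apply: H.
  move=> g a [[k [f [df ->]]]|->] Qa; last by rewrite CV; apply: subZ.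
  apply: (dplus_ind Qs _ df) => m om.
  by rewrite -VW //; apply: QW.
have vlV := va_linear_l (va_actionP V); have vlW := va_linear_l (va_actionP WD).
have vrV := va_linear (va_actionP V); have vrW := va_linear (va_actionP WD).
(* The states [wV d] generate V, and for them both fields are [Wop] on the Fock space. [va_product]
   expresses the field of a product through the fields of its factors, so the identity spreads to
   all states. *)
have phi_hom a b q : phi (va_Y a q b) = va_Y (phi a) q (phi b).
  pose Q a := forall q b, phi (va_Y a q b) = va_Y (phi a) q (phi b).
  suff : Q a by apply.
  apply: V_ind => {a b q}.
  - split=> [q b|c a1 a2 H1 H2 q b].
      by rewrite (lin0 (vlV _ _)) !(lin0 phil) (lin0 (vlW _ _)).
    by rewrite vlV !phil vlW H1 H2.
  - move=> q b; rewrite (va_vacuum (va_actionP V)) phiv (va_vacuum (va_actionP WD)).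
    by case: ifP => // _; exact: lin0 phil.
  - move=> d p a od Qa q b; rewrite phi_field //.
    have [N1 H1] := va_product (va_actionP V) (wV d) a b p q.
    have [N2 H2] := va_product (va_actionP WD) (phi (wV d)) (phi a) (phi b) p q.
    rewrite (H1 (N1 + N2)%N) ?leq_addr // (H2 (N1 + N2)%N) ?leq_addl // (lin_sum phil).
    apply: eq_bigr => j _; rewrite (linZ phil) (linB phil) (linZ phil).
    by rewrite phi_field // !Qa phi_field.
(* The determinant part of the invariants, inside [WD]. It must be stable under all modes of [phi] V
   for the action on [L] to be definable by restriction. *)
pose QL w : Prop := inv true (Psi w).
have invs eps := @inv_module_subspace K n i0 eps.
have QLs : is_subspace QL.
  split; first by rewrite /QL (lin0 Psl); exact: sub0 (invs true).
  by move=> c x y Hx Hy; rewrite /QL Psl; apply: (invs true).2.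
have QL_phi a q w : QL w -> QL (va_Y (phi a) q w).
  pose Q a := forall q w, QL w -> QL (va_Y (phi a) q w).
  suff : Q a by apply.
  have QW d q' w' : odd d -> QL w' -> QL (va_Y (phi (wV d)) q' w').
    move=> od; rewrite /QL fieldW // => Hw.
    by apply: inv_module_dop => //; exact: Wpoly_dplus.
  apply: V_ind => {a w q}.
  - split=> [q w _|c a1 a2 H1 H2 q w Hw].
      by rewrite (lin0 phil) (lin0 (vlW _ _)); exact: sub0.
    by rewrite phil vlW; apply: QLs.2; [exact: H1|exact: H2].
  - move=> q w Hw; rewrite phiv (va_vacuum (va_actionP WD)).
    by case: ifP => // _; exact: sub0.
  - move=> d p a od Qa q w Hw; rewrite phi_hom.
    have [N H] := va_product (va_actionP WD) (phi (wV d)) (phi a) w p q.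
    rewrite (H N) //; apply: sub_sum => // j _; apply: subZ => //; apply: subB => //.
      by apply: QW => //; apply: Qa.
    by apply: subZ => //; apply: Qa; apply: QW.
have YL_ex (t : V * int * L) : exists u', phiL u' = va_Y (phi t.1.1) t.1.2 (phiL t.2).
  have : QL (va_Y (phi t.1.1) t.1.2 (phiL t.2)).
    by apply: QL_phi; rewrite /QL phiLE.
  by move=> /gLs[u' uE]; exists u'; apply: Psi_inj; rewrite phiLE.
have /choice[Y0 Y0E] := YL_ex.
(* [L] acts as the image of [phiL] under the modes of [phi] V. Injectivity of [phiL] pulls back the
   module axioms, among them the Borcherds identity. *)
pose YLf (a : V) (q : int) (u : L) := Y0 (a, q, u).
have YLE a q u : phiL (YLf a q u) = va_Y (phi a) q (phiL u) by exact: Y0E.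
have YL_act : va_action (va_vac V) (@va_Y K V) YLf.
  split.
  - by move=> q u c a b; apply: phiL_inj; rewrite phiLl !YLE phil vlW.
  - by move=> a q c u w; apply: phiL_inj; rewrite phiLl !YLE phiLl vrW.
  - move=> a u; have [_ _ H _ _] := va_actionP WD; have [N hN] := H (phi a) (phiL u).
    by exists N => q hq; apply: phiL_inj; rewrite YLE hN // (lin0 phiLl).
  - move=> q u; apply: phiL_inj; rewrite YLE phiv (va_vacuum (va_actionP WD)).
    by case: ifP => // _; rewrite (lin0 phiLl).
  - move=> a b u m q k; have [_ _ _ _ H] := va_actionP WD.
    have [N0 hN] := H (phi a) (phi b) (phiL u) m q k.
    exists N0 => N NN; apply: phiL_inj; rewrite !(lin_sum phiLl).
    transitivity (\sum_(j < N) binz K m j *: va_Y (va_Y (phi a) (q + j%:Z) (phi b))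
       (m + k - j%:Z) (phiL u)).
      by apply: eq_bigr => j _; rewrite (linZ phiLl) YLE phi_hom.
    rewrite hN //; apply: eq_bigr => j _.
    by rewrite (linZ phiLl) (linB phiLl) (linZ phiLl) !YLE.
pose YL := VaModule YL_act.
have compat : compatible_module rhoV rhoL YL.
  move=> d k od u; apply: phiL_inj; rewrite [LHS]YLE; apply: Psi_inj.
  rewrite fieldW // !phiLE /Wact gLr; last exact: Wpoly_dplus.
  by rewrite /Wop addrK.
exists YL; split=> //.
(* The W^n_k are modes of states of V, by [compat], and with the scalar C they span the action of
   \hat D^+; so a V-submodule is a \hat D^+-submodule. *)
- have [[x x0] irr] := irrL; split; first by exists x.
  move=> P Ps Pst; apply: irr => // g u [[k [f [df ->]]]|->] Pu; last first.
    by rewrite CL; apply: subZ.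
  apply: (dplus_ind Ps _ df) => m om; rewrite -compat //.
  by apply: Pst => //; eexists; eexists.
exists phi; split=> //.
exists (fun t => phi t.1 + phiL t.2); split.
- move=> c [b u] [b' u'] /=.
  by rewrite phil phiLl scalerDr addrACA.
- have finj : injective (fun t : V * L => phi t.1 + phiL t.2).
    move=> [b u] [b' u'] /= /(congr1 Psi); rewrite !(linD Psl) !phiE !phiLE => E.
    have E' : gV b - gV b' = gL u' - gL u.
      apply/eqP; rewrite subr_eq addrAC -subr_eq opprK E addrC.
      by rewrite addrC.
    have z : gV b - gV b' = 0.
      apply: (@inv_module_disjoint K n i0).
        exact: (subB (invs false)).
      by rewrite E'; exact: (subB (invs true)).
    have -> : b = b' by apply: gVi; apply/eqP; rewrite -subr_eq0 z.
    have -> : u = u' by apply: gLi; apply/esym/eqP; rewrite -subr_eq0 -E' z.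
    by [].
  have fsurj w : exists t : V * L, phi t.1 + phiL t.2 = w.
    have [y1 y2] := (PsS (Psi w)).1 (ex_intro _ w erefl).
    have [u0 [u1 [h0 h1 E]]] := @inv_module_decomp K n i0 _ y1 y2.
    have [b bE] := gVs _ h0; have [u uE] := gLs _ h1.
    by exists (b, u); apply: Psi_inj; rewrite (linD Psl) phiE phiLE bE uE.
  have /choice[g gE] := fsurj.
  by exists g => [t|w]; [apply: finj; rewrite gE|exact: gE].
- by move=> a q b u /=; rewrite phi_hom YLE (linD (vrW _ _)).
Qed.

End Main.

(** An antisymmetric matrix of size 2 is a multiple of [so_elt K 0 1]. This is what excludes l =
    1. *)
Lemma so2_abelian (K : numFieldType) (x y : 'M[K]_2) :
  so_mx x -> so_mx y -> lie_mx x y = 0.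
Proof.
have ord2 (i : 'I_2) : i = 0 \/ i = 1.
  by case: i => [[|[|//]] ?]; [left|right]; exact: val_inj.
have so2 (z : 'M[K]_2) : so_mx z -> z = z 0 1 *: so_elt K 0 1.
  move=> sz; have zd (i : 'I_2) : z i i = 0.
    have /eqP := so_mxE i i sz; rewrite -subr_eq0 opprK -mulr2n mulrn_eq0 /=.
    by move/eqP.
  apply/matrixP => i j; rewrite !mxE.
  case: (ord2 i) => ->; case: (ord2 j) => ->; rewrite ?zd ?(so_mxE 1 0 sz) //=; ring.
move=> /so2 -> /so2 ->; rewrite /lie_mx -!scalemxAl -!scalemxAr !scalerA mulrC.
exact: subrr.
Qed.

Theorem theorem14p2 (R : realType) (l : nat) (l_gt0 : (0 < l)%N)
    (Dl_simple : so_simple R[i] l.*2)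
    (WD : vertexAlgebra R[i]) (WD_P : is_WD l WD)
    (V : vertexAlgebra R[i]) (rhoV : dplus_rep V) (V_P : is_Vc l%:R rhoV)
    (L : lmodType R[i]) (rhoL : dplus_rep L)
    (L_P : is_L (e_det R[i] l) l%:R rhoL) :
  exists YL : va_module V L,
    [/\ compatible_module rhoV rhoL YL,
        va_module_irreducible YL
      & exists phi : V -> WD,
          [/\ va_hom phi, injective phi
            & exists f : V * L -> WD,
                [/\ linear f, bijective f
                  & forall (a : V) (n : int) (b : V) (u : L),
                      f (va_Y a n b, YL a n u) =
                      va_Y (phi a) n (f (b, u))]]].
Proof.
(* [so_simple] asks for a nonzero bracket, which so(2) does not have; hence 2l > 2, and three
   distinct fermion indices exist. *)
have l_gt1 : (1 < l)%N.
  rewrite ltn_neqAle l_gt0 andbT; apply/eqP => l1; subst l.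
  by have [[x [y [sx sy nz]]] _] := Dl_simple; apply: nz; apply: so2_abelian.
exact (WD_decomposition l_gt1 WD_P V_P L_P).
Qed.
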